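(* Let $H$, $V$ and the skew-adjoint operator $P:V\to H$ be as in the context. Suppose $0<C_*\le C^*$, $0\le C_B$, $0\le C_Q$, $\{(A_m,B_m,Q_m):m\in\mathbb{N}\}\subset\mathcal{P}(C_*,C^*,C_B,C_Q)$, $(A,B,Q)\in\mathcal{P}(C_*,C^*,C_B,C_Q)$, and 1. $\lim_{m\to\infty}\|(A_m-A)w\|=0$ for all $w\in H$; 2. $\lim_{m\to\infty}\|(B_m-B)w\|=0$ for all $w\in H$; 3. the convolution operators $R_m$, $R$ with kernels $Q_m$, $Q$ satisfy $\lim_{m\to\infty}\|R_m[w]-R[w]\|_{L^2((-\infty,T],H)}=0$ for any $T\in\mathbb{R}$ and all $w\in L^2_+(\mathbb{R},H)$. Let $f\in L^2_{\rm loc}(\mathbb{R},H)$ be causal, and let $u_m$, respectively $u$, be the causal weak solutions of $$A_mu_m'+Pu_m+B_mu_m+R_m[u_m]=f,\qquad\text{respectively}\qquad Au'+Pu+Bu+R[u]=f .$$ Then for any choice of $T_0\le T\in\mathbb{R}$, $$\lim_{m\to\infty}\|u_m-u\|_{L^\infty([T_0,T],H)}=0 .$$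
   Context: $H$ is a separable real Hilbert space with inner product $\langle\cdot,\cdot\rangle$ and norm $\|\cdot\|$. $V\subset H$ is a dense subspace, itself a separable Hilbert space with norm $\|\cdot\|_V$ defining a stronger topology than that induced by $H$. $P$ is a skew-adjoint operator on $H$ with domain $V$, whose graph norm is equivalent to $\|\cdot\|_V$. $\mathcal{B}(H)$ is the space of bounded linear operators on $H$ with the operator norm, $\mathcal{B}_{\rm symm}(H)$ its subspace of self-adjoint operators. $\mathbb{R}_+=[0,\infty)$. $\mathcal{P}(C_*,C^*,C_B,C_Q)$ is the set of triples $(A,B,Q)$ with $A\in\mathcal{B}_{\rm symm}(H)$, $C_*I\le A\le C^*I$; $B\in\mathcal{B}(H)$, $\|B\|_{\mathcal{B}(H)}\le C_B$; and $Q\in L^1(\mathbb{R},\mathcal{B}_{\rm symm}(H))\cap C^0(\mathbb{R}_+,\mathcal{B}(H))$, $Q(t)=0$ for $t<0$, $\|Q\|_{L^1(\mathbb{R},\mathcal{B}(H))}+\|Q\|_{L^\infty(\mathbb{R},\mathcal{B}(H))}\le C_Q$. $L^2_+(\mathbb{R},H)=\{v\in L^2_{\rm loc}(\mathbb{R},H): v\in L^2((-\infty,T],H)\text{ for each }T\in\mathbb{R}\}$. The convolution operator with kernel $Q$ is $R[u](t)=\int Q(t-s)u(s)\,ds$ on $L^2_+(\mathbb{R},H)$; its formal adjoint is $R^*[\phi](t)=\int Q(s-t)\phi(s)\,ds$. A function $u\in L^2_{\rm loc}(\mathbb{R},H)$ is causal if ${\rm supp}\,u\subset[T,\infty)$ for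 some $T\in\mathbb{R}$. A weak solution of $Au'+Pu+Bu+R[u]=f$ is a $u\in L^2_+(\mathbb{R},H)$ such that for all $\phi\in C_0^\infty(\mathbb{R},V)$, $$\int\langle u(t),(A\phi'+P\phi-B^*\phi-R^*[\phi])(t)\rangle\,dt=-\int\langle f(t),\phi(t)\rangle\,dt .$$ For every causal $f\in L^2_{\rm loc}(\mathbb{R},H)$ there is exactly one causal weak solution, and it belongs to $C^0(\mathbb{R},H)$. *)

(* Defs.v *)
From HB Require Import structures.
From mathcomp Require Import all_boot all_order all_algebra.
From mathcomp Require Import sesquilinear.
From mathcomp Require Import all_classical all_reals all_analysis.

Set Implicit Arguments.
Unset Strict Implicit.
Unset Printing Implicit Defensive.

Import Order.TTheory GRing.Theory Num.Theory.
Import numFieldNormedType.Exports.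

Local Open Scope classical_set_scope.
Local Open Scope ring_scope.

HB.mixin Record CompleteNormedModule_isHilbert (R : realType) H
    & CompleteNormedModule R H := {
  inner : {dot H for (@idfun R)} ;
  inner_norm : forall x : H, inner x x = `|x| ^+ 2
}.

#[short(type="hilbertType")]
HB.structure Definition Hilbert (R : realType) :=
  {H of CompleteNormedModule R H & CompleteNormedModule_isHilbert R H}.

Definition separable (T : topologicalType) : Prop :=
  exists D : set T, countable D /\ dense D.

Section BoundedOperators.
Context {R : realType} {V W : normedModType R}.

Definition bounded_op : {pred V -> W} := mem [set f : V -> W |
  linear f /\ exists M : R, forall x, `|f x| <= M * `|x|].

Lemma bounded_op_submod : submod_closed bounded_op.
Proof.
split=> [|a f g]; rewrite !inE /=.
  split=> [k x y|]; first by rewrite scaler0 addr0.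
  by exists 0 => x; rewrite normr0 mul0r.
move=> [lf [M Mf]] [lg [N Ng]]; split=> [k x y|].
  rewrite ![(_ + g) _]/GRing.add /= ![(a *: f) _]/GRing.scale /= lf lg.
  rewrite !scalerDr !scalerA addrACA; congr (_ + _).
  by rewrite (mulrC a).
exists (`|a| * M + N) => x; rewrite [(_ + g) _]/GRing.add /=.
rewrite mulrDl (le_trans (ler_normD _ _))// lerD//.
by rewrite [(a *: f) x]/GRing.scale /= normrZ -mulrA ler_wpM2l.
Qed.

HB.instance Definition _ :=
  GRing.isSubmodClosed.Build R (V -> W) bounded_op bounded_op_submod.

Record bop := Bop { bop_fun :> V -> W ; bop_funP : bop_fun \in bounded_op }.

HB.instance Definition _ := [isSub for bop_fun].
HB.instance Definition _ := [Choice of bop by <:].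
HB.instance Definition _ := [SubChoice_isSubLmodule of bop by <:].

Lemma bop_linear (f : bop) : linear f.
Proof. by case: f => f /= /[!inE] -[]. Qed.

HB.instance Definition _ (f : bop) :=
  GRing.isLinear.Build R V W *:%R f (bop_linear f).

Definition opnorm (f : bop) : R :=
  sup [set `|f x| | x in [set x : V | `|x| <= 1]].

Let unit_img_has_sup (f : bop) :
  has_sup [set `|f x| | x in [set x : V | `|x| <= 1]].
Proof.
split; first by exists `|f 0|, 0; rewrite //= normr0.
case: f => f /= /[!inE] -[_ [M Mf]].
exists `|M| => _ [x /= x1 <-]; rewrite (le_trans (Mf x))//.
by rewrite (le_trans (ler_norm _))// normrM normr_id ler_piMr.
Qed.

Lemma opnorm_ge0 (f : bop) : 0 <= opnorm f.
Proof.
rewrite (@le_trans _ _ `|f 0|)// sup_upper_bound//.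
by exists 0; rewrite //= normr0.
Qed.

Lemma le_opnorm (f : bop) x : `|f x| <= opnorm f * `|x|.
Proof.
have [->|x0] := eqVneq x 0; first by rewrite linear0 !normr0 mulr0.
rewrite -ler_pdivrMr ?normr_gt0// sup_upper_bound//; exists (`|x|^-1 *: x) => /=.
  by rewrite normrZ normfV normr_id mulVf ?normr_eq0.
by rewrite linearZ /= normrZ normfV normr_id mulrC.
Qed.

Lemma opnorm_le (f : bop) M : (forall x, `|x| <= 1 -> `|f x| <= M) ->
  opnorm f <= M.
Proof.
move=> fM; apply: ge_sup; first by case: (unit_img_has_sup f).
by move=> _ [x /= x1 <-]; exact: fM.
Qed.

Let opnorm_le1 (f : bop) x : `|x| <= 1 -> `|f x| <= opnorm f.
Proof.
by move=> x1; rewrite (le_trans (le_opnorm f x))// ler_piMr ?opnorm_ge0.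
Qed.

Let opnormD (f g : bop) : opnorm (f + g) <= opnorm f + opnorm g.
Proof.
apply: opnorm_le => x x1; rewrite (le_trans (ler_normD (f x) (g x)))//.
by rewrite lerD ?opnorm_le1.
Qed.

Let opnormZ (a : R) (f : bop) : opnorm (a *: f) = `|a| * opnorm f.
Proof.
have le (b : R) (h : bop) : opnorm (b *: h) <= `|b| * opnorm h.
  apply: opnorm_le => x x1; rewrite [(b *: h) x](_ : _ = b *: h x)//.
  by rewrite normrZ ler_wpM2l// opnorm_le1.
apply/eqP; rewrite eq_le le/=.
have [->|a0] := eqVneq a 0; first by rewrite normr0 mul0r opnorm_ge0.
rewrite mulrC -ler_pdivlMr ?normr_gt0// mulrC.
by have := le a^-1 (a *: f); rewrite scalerA mulVf// scale1r normfV mulrC.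
Qed.

Let opnorm_eq0 (f : bop) : opnorm f = 0 -> f = 0.
Proof.
move=> f0; apply/val_inj/funext => x /=; apply/eqP.
by rewrite -normr_le0 (le_trans (le_opnorm f x))// f0 mul0r.
Qed.

HB.instance Definition _ := Lmodule_isNormed.Build R bop
  opnormD opnormZ opnorm_eq0.

End BoundedOperators.
Arguments bop {R} V W.
Notation "''B' ( H )" := (bop H H) (format "''B' ( H )") : type_scope.

Section HilbertOperators.
Context {R : realType} {H : hilbertType R}.

Definition selfadjoint (A : 'B(H)) : Prop :=
  forall x y : H, inner (A x) y = inner x (A y).

(* The vector [z] exists and is unique by the Riesz representation theorem, so
   the default value 0 is never used. *)
Definition adjoint (B : 'B(H)) (y : H) : H :=
  xget 0 [set z | forall x, inner (B x) y = inner x z].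

End HilbertOperators.

(* An unbounded operator on [H] is given by its domain, the range of
    [iota : V -> H], and by its action [P : V -> H] on that domain. *)

Section UnboundedOperators.
Context {R : realType} {H V : hilbertType R}.

(* [V], as a subspace of [H] through the inclusion [iota]. *)
Definition dense_inclusion (iota : {linear V -> H}) : Prop :=
  [/\ injective iota, continuous iota & dense (range iota)].

Definition adjoint_graph (iota P : {linear V -> H}) : set (H * H) :=
  [set yz | forall v : V, inner (P v) yz.1 = inner (iota v) yz.2].

(* P^* = - P as unbounded operators, hence with equal domains. *)
Definition skew_adjoint (iota P : {linear V -> H}) : Prop :=
  adjoint_graph iota P = range (fun v : V => (iota v, - P v)).

Definition graph_norm (iota P : {linear V -> H}) (v : V) : R :=
  Num.sqrt (`|iota v| ^+ 2 + `|P v| ^+ 2).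

Definition graph_norm_equiv (iota P : {linear V -> H}) : Prop :=
  exists c C : R, [/\ 0 < c, 0 < C &
    forall v : V, c * `|v| <= graph_norm iota P v <= C * `|v|].

End UnboundedOperators.

(* Elements of the Bochner spaces are represented by functions, and not by
   classes.  Measurability is for the Borel sigma-algebra on [R], as for real
   functions in the library: every class has such a representative. *)

Section Bochner.
Context {R : realType} {W : normedModType R}.
Local Notation mu := (@lebesgue_measure R).

Definition simple_fun (s : R -> W) : Prop :=
  finite_set (range s) /\ forall w : W, measurable (s @^-1` [set w]).

Definition strongly_measurable (g : R -> W) : Prop :=
  exists s : nat -> R -> W,
    (forall n, simple_fun (s n)) /\ forall t, s n t @[n --> \oo] --> g t.

Definition integrable_simple_fun (s : R -> W) : Prop :=
  simple_fun s /\ forall w, w != 0 -> (mu (s @^-1` [set w]) < +oo)%E.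

(* If 0 is a value of [s], then it contributes 0 to the sum, also when its
   fiber has infinite measure. *)
Definition simple_integral (s : R -> W) : W :=
  \sum_(w \in range s) fine (mu (s @^-1` [set w])) *: w.

Definition has_bochner_integral (g : R -> W) (I : W) : Prop :=
  strongly_measurable g /\ exists s : nat -> R -> W,
    [/\ forall n, integrable_simple_fun (s n),
        (\int[mu]_t (`|g t - s n t|)%:E)%E @[n --> \oo] --> 0%E &
        simple_integral (s n) @[n --> \oo] --> I].

(* The value is 0 if [g] is not Bochner integrable. *)
Definition bochner_integral (g : R -> W) : W :=
  xget 0 [set I | has_bochner_integral g I].

(* [g] is extended by 0 outside [D]; for p = +oo this is an essential supremum. *)
Definition LpNorm (p : \bar R) (D : set R) (g : R -> W) : \bar R :=
  'N[mu]_p[(fun t => `|g t|%:E) \_ D].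

Definition in_Lp (p : \bar R) (D : set R) (g : R -> W) : Prop :=
  strongly_measurable g /\ (LpNorm p D g < +oo)%E.

Definition in_L2loc (g : R -> W) : Prop :=
  forall K : set R, compact K -> in_Lp 2%:E K g.

Definition in_L2plus (g : R -> W) : Prop :=
  in_L2loc g /\ forall T : R, in_Lp 2%:E `]-oo, T] g.

(* The support of the class of [g] modulo null sets: the complement of the
   union of all open sets on which [g] vanishes almost everywhere. *)
Definition ess_support (g : R -> W) : set R :=
  [set t | forall U : set R, open U -> U t ->
    ~ {ae mu, forall s, U s -> g s = 0}].

Definition causal (g : R -> W) : Prop :=
  exists T : R, ess_support g `<=` `[T, +oo[.

(* Differentiability is for the norm of [W]. *)
Definition test_function (phi : R -> W) : Prop :=
  (forall (n : nat) (t : R), derivable (derive1n n phi) t 1) /\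
  compact (closure [set t | phi t != 0]).

End Bochner.

Section Equation.
Context {R : realType} {H V : hilbertType R}.
Local Notation mu := (@lebesgue_measure R).

Definition convolution (Q : R -> 'B(H)) (u : R -> H) (t : R) : H :=
  bochner_integral (fun s => Q (t - s) (u s)).

Definition convolution_adj (Q : R -> 'B(H)) (phi : R -> H) (t : R) : H :=
  bochner_integral (fun s => Q (s - t) (phi s)).

(* [Q] is the representative of its class that is continuous on [0, +oo[ and
   vanishes on ]-oo, 0[; [coef_Q_continuous] is for the operator norm. *)
Record coef_class (Clow Cup CB CQ : R) (A B : 'B(H)) (Q : R -> 'B(H)) : Prop := {
  coef_A_selfadjoint : selfadjoint A ;
  coef_A_bounds : forall x : H,
    Clow * inner x x <= inner (A x) x <= Cup * inner x x ;
  coef_B_bound : `|B| <= CB ;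
  coef_Q_selfadjoint : forall t, selfadjoint (Q t) ;
  coef_Q_L1 : in_Lp 1%:E setT Q ;
  coef_Q_continuous : {within `[0, +oo[, continuous Q} ;
  coef_Q_causal : forall t, t < 0 -> Q t = 0 ;
  coef_Q_bound : (LpNorm 1%:E setT Q + LpNorm +oo setT Q <= CQ%:E)%E
}.

Definition weak_solution (iota P : {linear V -> H}) (A B : 'B(H))
    (Q : R -> 'B(H)) (f u : R -> H) : Prop :=
  in_L2plus u /\ forall phi : R -> V, test_function phi ->
    \int[mu]_t inner (u t)
        (A (iota (derive1 phi t)) + P (phi t) - adjoint B (iota (phi t))
         - convolution_adj Q (iota \o phi) t)
    = - \int[mu]_t inner (f t) (iota (phi t)).

End Equation.

(* Main.v *)
(* Mollifying a weak solution in time by a kernel supported in the past yields a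
   strong solution w_n for the mollified source f_n: the equation commutes with
   the mollification, and skew-adjointness of P puts w_n(t) in V.  For strong
   solutions, the energy <A w, w> + (int_{-oo}^t |w|)^2 obeys a Gronwall
   inequality with a rate depending only on C_*, C_B and C_Q.  Hence u - w_n is
   bounded on ]-oo, T] by the L^2 norm of f_n - f, for the limit problem as for
   the m-th one, uniformly in m.  For fixed n, the difference of the mollified
   solutions of the two problems solves the m-th equation with source
   (A_m - A) w_n' + (B_m - B) w_n + (R_m - R) w_n, which tends to 0 in L^2 by
   dominated convergence and by hypothesis; so strong convergence of the
   coefficients suffices because w_n' is a function with values in H. *)
Require Import Defs.
From HB Require Import structures.
From mathcomp Require Import all_boot all_order all_algebra.
From mathcomp Require Import all_classical all_reals all_analysis.
From mathcomp Require Import measurable_realfun ess_sup_inf.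
From mathcomp Require Import ring lra.

Set Implicit Arguments.
Unset Strict Implicit.
Unset Printing Implicit Defensive.

Import Order.TTheory GRing.Theory Num.Theory.
Import numFieldNormedType.Exports.

Local Open Scope classical_set_scope.
Local Open Scope ring_scope.

(** * Hilbert spaces *)

(** A weak solution is only square integrable, so neither [u'] nor [P u] can be paired with [u]; and
    [A_ m] converges only strongly, so the perturbation [(A_ m - A) u'] has no meaning in [H].
    Smoothing in time removes both obstacles, because [A], [B] and [P] are constant in time and the
    memory is a convolution. The order of the limits matters: the smoothing index [n] is fixed
    first, from [f] alone and hence for all [m] together, and only then does [m] grow. Kernels
    supported in []0, r[] look only backwards. They preserve vanishing before a given time, and they
    act on functions whose integrability is known only on half-lines []-oo, T]]. The time before
    which [u_ m] vanishes may depend on [m]; the energy estimate, applied to the mollified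
    solutions, moves it to that of [f], so that one exponential factor serves all [m]. Vector
    integrals are identified throughout by pairing them with a fixed vector, which leaves scalar
    integrals to compute. *)

Section InnerProduct.
Context {R : realType} {H : hilbertType R}.
Implicit Types (x y z : H) (a : R).

Lemma innerC x y : inner x y = inner y x.
Proof. by rewrite (hermC inner x y) /= expr0 mul1r. Qed.

Lemma innerDr x y z : inner x (y + z) = inner x y + inner x z.
Proof. exact: linearDr. Qed.

Lemma innerZr x a y : inner x (a *: y) = a * inner x y.
Proof. exact: linearZr_LR. Qed.

Lemma innerDl x y z : inner (y + z) x = inner y x + inner z x.
Proof. by rewrite !(innerC _ x) innerDr. Qed.

Lemma innerZl x a y : inner (a *: y) x = a * inner y x.
Proof. by rewrite !(innerC _ x) innerZr. Qed.

Lemma innerNr x y : inner x (- y) = - inner x y.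
Proof. by rewrite -scaleN1r innerZr mulN1r. Qed.

Lemma innerNl x y : inner (- y) x = - inner y x.
Proof. by rewrite !(innerC _ x) innerNr. Qed.

Lemma innerBr x y z : inner x (y - z) = inner x y - inner x z.
Proof. by rewrite innerDr innerNr. Qed.

Lemma innerBl x y z : inner (y - z) x = inner y x - inner z x.
Proof. by rewrite innerDl innerNl. Qed.

Lemma inner0r x : inner x 0 = 0.
Proof. by rewrite -(scale0r x) innerZr mul0r. Qed.

Lemma inner0l x : inner 0 x = 0.
Proof. by rewrite innerC inner0r. Qed.

Lemma cauchy_schwarz x y : `|inner x y| <= `|x| * `|y|.
Proof.
have [->|y0] := eqVneq y 0; first by rewrite inner0r !normr0 mulr0.
have y2 : 0 < `|y| ^+ 2 by rewrite exprn_gt0// normr_gt0.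
have : 0 <= `|x - (inner x y / `|y| ^+ 2) *: y| ^+ 2 by rewrite sqr_ge0.
rewrite -inner_norm !(innerBl, innerBr, innerZl, innerZr) (innerC y x) !inner_norm.
set c := inner x y; rewrite divfK ?gt_eqF// subrr subr0 subr_ge0 => cle.
rewrite -(@ler_pXn2r _ 2)// ?nnegrE ?mulr_ge0// exprMn.
rewrite -ler_pdivrMr// (le_trans _ cle)//.
by rewrite -normrX ger0_norm ?sqr_ge0// expr2 mulrAC.
Qed.

Lemma le_inner x y : inner x y <= `|x| * `|y|.
Proof. exact: le_trans (ler_norm _) (cauchy_schwarz _ _). Qed.

Lemma inner_ext x y : (forall z, inner x z = inner y z) -> x = y.
Proof.
move=> xy; apply/eqP; rewrite -subr_eq0 -normr_eq0 -sqrf_eq0 -inner_norm.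
by rewrite innerBl xy subrr.
Qed.

Lemma inner_cvg {T : Type} {F : set_system T} {FF : Filter F} (f g : T -> H) x y :
  f t @[t --> F] --> x -> g t @[t --> F] --> y ->
  inner (f t) (g t) @[t --> F] --> inner x y.
Proof.
move=> fx gy; apply/cvgrPdist_le => e e0.
(* Eventually [|f t| <= |x| + 1], so this quantity dominates the distance between the inner
   products. *)
have lim0 : (`|x| + 1) * `|y - g t| + `|x - f t| * `|y| @[t --> F] --> (0 : R).
  rewrite -[X in _ --> X](_ : (`|x| + 1) * `|y - y| + `|x - x| * `|y| = 0); last first.
    by rewrite !subrr !normr0 mulr0 mul0r addr0.
  apply: cvgD; [apply: cvgMr|apply: cvgMl]; apply: cvg_norm;
    by apply: cvgB => //; exact: cvg_cst.
have fx1 : \forall t \near F, `|x - f t| < 1 by move/cvgrPdist_lt : fx; exact.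
move/cvgrPdist_le : lim0 => /(_ _ e0); apply: filterS2 fx1 => t f1.
rewrite sub0r normrN; apply: le_trans.
have -> : inner x y - inner (f t) (g t) =
    inner (f t) (y - g t) + inner (x - f t) y.
  by rewrite innerBr innerBl; ring.
rewrite (le_trans (ler_normD _ _))// [leRHS]ger0_norm ?addr_ge0 ?mulr_ge0 ?addr_ge0//.
rewrite lerD//; last exact: cauchy_schwarz.
rewrite (le_trans (cauchy_schwarz _ _))// ler_wpM2r//.
have -> : f t = x - (x - f t) by rewrite opprB addrCA subrr addr0.
by rewrite (le_trans (ler_normB _ _))// lerD// ltW.
Qed.

Lemma parallelogram x y :
  `|x + y| ^+ 2 + `|x - y| ^+ 2 = 2 * `|x| ^+ 2 + 2 * `|y| ^+ 2.
Proof.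
by rewrite -!inner_norm !(innerDl, innerDr, innerNl, innerNr) (innerC y x); ring.
Qed.

(* The Riesz vector minimizes [J x = |x|^2 / 2 - l x]; minimizing sequences are
   Cauchy by the parallelogram identity. *)
Lemma riesz (l : {linear H -> R^o}) (M : R) :
  (forall x, `|l x| <= M * `|x|) -> exists z, forall x, l x = inner x z.
Proof.
move=> lM.
have lD u v (a : R) : l (u + a *: v) = (l u : R) + a * (l v : R).
  by rewrite linearD linearZ.
pose J x : R := `|x| ^+ 2 / 2 - l x.
have J_lb x : - (M ^+ 2 / 2) <= J x.
  have := lM x; have := ler_norm (l x); rewrite /J => l1 l2.
  have := sqr_ge0 (`|x| - M); rewrite sqrrB; nra.
pose S := range J.
have hS : has_inf S.
  by split; [exists (J 0), 0|exists (- (M ^+ 2 / 2)) => _ [x _ <-]].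
have Jx n : exists x, J x < inf S + n.+1%:R^-1.
  have [|_ [x _ <-] Jx] := inf_adherent (_ : 0 < n.+1%:R^-1 :> R) hS; first by [].
  by exists x.
pose x_ n := projT1 (cid (Jx n)).
have Jx_ n : J (x_ n) < inf S + n.+1%:R^-1 by exact: projT2 (cid (Jx n)).
have J_inf x : inf S <= J x by apply: ge_inf; [case: hS|exists x].
(* [J] at the midpoint is at least [inf S]; the parallelogram identity turns this into a bound on
   the squared distance. *)
have dist x y : `|x - y| ^+ 2 <= 4 * (J x - inf S) + 4 * (J y - inf S).
  have := J_inf (2^-1 *: (x + y)).
  rewrite /J normrZ linearZ /= linearD /= exprMn.
  have := parallelogram x y.
  rewrite ger0_norm// [_ *: _]/GRing.scale /=; lra.
have cx : cauchy (x_ @ \oo).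
  apply/cauchy_exP => e e0.
  have e2 : 0 < e ^+ 2 / 8 by rewrite divr_gt0// exprn_gt0.
  have [N _ hN] : \forall n \near \oo, n.+1%:R^-1 < e ^+ 2 / 8 :> R.
    by apply: cvgr_lt e2; exact: cvg_harmonic.
  exists (x_ N), N => // n Nn.
  rewrite /= -ball_normE /ball_ /= -(@ltr_pXn2r _ 2)// ?nnegrE ?(ltW e0)//.
  apply: le_lt_trans (dist _ _) _; have := Jx_ n; have := Jx_ N.
  have := hN _ Nn; have := hN _ (leqnn N). move: (N.+1%:R^-1) (n.+1%:R^-1) => a b.
  move: e2 (J (x_ N)) (J (x_ n)) (inf S); clear => ? ? ? ?; lra.
have /cvg_ex[z xz] : cvg (x_ @ \oo) by exact: cauchy_cvg.
exists z => y; apply/eqP; rewrite innerC -subr_eq0 -oppr_eq0 opprB.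
set c := inner z y - l y; pose k := `|y| ^+ 2 + 1.
have k0 : 0 < k by rewrite ltr_wpDl// sqr_ge0.
(* First-order optimality at [z]: [inf S <= J (x_ n + a *: y)] passes to the limit, since [J (x_ n)]
   exceeds [inf S] by less than [n.+1%:R^-1]. *)
have key a : 0 <= a * c + a ^+ 2 * `|y| ^+ 2 / 2.
  have lim n : 0 <= a * (inner (x_ n) y - l y) + a ^+ 2 * `|y| ^+ 2 / 2 + n.+1%:R^-1.
    have := J_inf (x_ n + a *: y); have := Jx_ n.
    rewrite /J lD -!inner_norm.
    rewrite !(innerDl, innerDr, innerZl, innerZr) (innerC y (x_ n)).
    rewrite !inner_norm.
    move: (inner _ _) (l _ : R) (l y : R) (inf S) (n.+1%:R^-1) (`|y|) (`|x_ n|).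
    by clear => ? ? ? ? ? ? ?; lra.
  have: a * (inner (x_ n) y - l y) + a ^+ 2 * `|y| ^+ 2 / 2 + n.+1%:R^-1
      @[n --> \oo] --> a * c + a ^+ 2 * `|y| ^+ 2 / 2 + 0.
    apply: cvgD; last exact: cvg_harmonic.
    apply: cvgD; last exact: cvg_cst.
    apply: cvgMr; apply: cvgB; last exact: cvg_cst.
    by apply: inner_cvg; [exact: xz|exact: cvg_cst].
  by rewrite addr0 => /cvgr_to_ge; apply; exact: nearW.
apply: contraT => c0.
(* This choice makes the quadratic polynomial negative unless [c = 0]; the 1 in [k] keeps the
   denominator positive when [y = 0]. *)
have := key (- c / k).
have -> : - c / k * c + (- c / k) ^+ 2 * `|y| ^+ 2 / 2 =
    - (c ^+ 2 / k) * (1 - `|y| ^+ 2 / k / 2).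
  by field; rewrite gt_eqF.
have : 0 < c ^+ 2 / k by rewrite divr_gt0// exprn_even_gt0.
have : `|y| ^+ 2 / k <= 1 by rewrite ler_pdivrMr// mul1r lerDl.
nra.
Qed.

Lemma adjointE (B : 'B(H)) x y : inner (B x) y = inner x (adjoint B y).
Proof.
rewrite /adjoint; case: xgetP => [z _ /(_ x)//|noz].
have lin : linear (fun x => inner (B x) y : R^o).
  by move=> a u v; rewrite linearP innerDl innerZl.
pose l : {linear H -> R^o} := HB.pack (fun x => inner (B x) y : R^o)
  (GRing.isLinear.Build _ _ _ _ _ lin).
have [w lw] : exists w, forall x, l x = inner x w.
  apply: (@riesz l (`|B| * `|y|)) => u.
  rewrite (le_trans (cauchy_schwarz _ _))// mulrAC ler_wpM2r//.
  exact: le_opnorm.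
by have /(_ w) := noz => /(_ (fun u => lw u)).
Qed.
End InnerProduct.

(** * Strong measurability and the Bochner integral *)

Import HBSimple.

Section StrongMeasurability.
Context {R : realType}.
Local Notation mu := (@lebesgue_measure R).

(** Source and target are arbitrary, because simple functions on the plane and functions with values
    in [bool] occur below. *)
Definition finitely_valued d (X : measurableType d) (Y : Type) (a : X -> Y) :=
  finite_set (range a) /\ forall y, measurable (a @^-1` [set y]).

Lemma finitely_valued_preimage2 d (X : measurableType d) (Y Z : Type)
    (a : X -> Y) (b : X -> Z) (S : set (Y * Z)) :
  finitely_valued a -> finitely_valued b -> measurable [set x | S (a x, b x)].
Proof.
move=> [fa ma] [fb mb].
have -> : [set x | S (a x, b x)] =
    \bigcup_(p in (range a `*` range b) `&` S) (a @^-1` [set p.1] `&` b @^-1` [set p.2]).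
  apply/seteqP; split=> x /=.
    by move=> Sx; exists (a x, b x); split=> //=; split; [exists x|exists x].
  by move=> [[y z] [_ /= Syz] /= [-> ->]].
apply: fin_bigcup_measurable; first exact/finite_setIl/finite_setX.
by move=> p _; apply: measurableI; [exact: ma|exact: mb].
Qed.

Lemma finitely_valued2 d (X : measurableType d) (Y Z W : Type)
    (F : Y -> Z -> W) (a : X -> Y) (b : X -> Z) :
  finitely_valued a -> finitely_valued b -> finitely_valued (fun x => F (a x) (b x)).
Proof.
move=> fva fvb; split; last first.
  by move=> w; exact: (finitely_valued_preimage2 [set p | F p.1 p.2 = w] fva fvb).
apply: (@sub_finite_set _ _ ((fun p => F p.1 p.2) @` (range a `*` range b))).
  by move=> _ [x _ <-]; exists (a x, b x) => //; split; exists x.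
by apply/finite_image/finite_setX; [case: fva|case: fvb].
Qed.

Lemma finitely_valued_comp d d' (X : measurableType d) (X' : measurableType d')
    (Y : Type) (a : X -> Y) (h : X' -> X) :
  measurable_fun setT h -> finitely_valued a -> finitely_valued (a \o h).
Proof.
move=> mh [fa ma]; split.
  by apply: sub_finite_set fa => _ [x _ <-]; exists (h x).
by move=> y; rewrite -[X in measurable X]setTI; exact: (mh measurableT _ (ma y)).
Qed.

Lemma finitely_valued_measurable d (X : measurableType d) (a : X -> R) :
  finitely_valued a -> measurable_fun setT a.
Proof.
move=> fva _ Y mY; rewrite setTI.
exact: (finitely_valued_preimage2 [set p | Y p.1] fva fva).
Qed.

Lemma finitely_valued_sfun (a : {sfun R >-> R}) : finitely_valued (a : R -> R).
Proof. by split => [|y]; [exact: fimfunP|exact: measurable_funPTI]. Qed.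

Section Combine.
Context {X Y Z : normedModType R}.

Lemma strongly_measurable2 (F : X -> Y -> Z) (a : R -> X) (b : R -> Y) :
  (forall (x_ : nat -> X) (y_ : nat -> Y) x y,
    x_ @ \oo --> x -> y_ @ \oo --> y -> F (x_ n) (y_ n) @[n --> \oo] --> F x y) ->
  strongly_measurable a -> strongly_measurable b ->
  strongly_measurable (fun t => F (a t) (b t)).
Proof.
move=> cF [a_ [sa ca]] [b_ [sb cb]].
exists (fun n t => F (a_ n t) (b_ n t)); split=> [n|t]; last exact: cF.
exact: (finitely_valued2 F (sa n) (sb n)).
Qed.

Lemma strongly_measurable_comp (a : R -> X) (h : R -> R) :
  measurable_fun setT h -> strongly_measurable a -> strongly_measurable (a \o h).
Proof.
move=> mh [a_ [sa ca]]; exists (fun n => a_ n \o h); split=> [n|t]; last exact: ca.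
exact: (finitely_valued_comp mh (sa n)).
Qed.

End Combine.

Lemma strongly_measurable1 {X Y : normedModType R} (F : X -> Y) (a : R -> X) :
  continuous F -> strongly_measurable a -> strongly_measurable (F \o a).
Proof.
move=> cF ma; suff h : forall (x_ y_ : nat -> X) (x y : X), x_ @ \oo --> x ->
    y_ @ \oo --> y -> F (x_ n) @[n --> \oo] --> F x.
  exact (@strongly_measurable2 X X Y (fun x _ => F x) a a h ma ma).
move=> x_ y_ x y cx _; apply: continuous_cvg => //; exact: cF.
Qed.

Lemma strongly_measurable_real (a : R -> R^o) :
  measurable_fun setT a <-> strongly_measurable a.
Proof.
split=> [ma|[a_ [sa ca]]].
  have /measurable_EFinP ma' := ma.
  have [g gf] := approximation_sfun measurableT ma'.
  exists (fun n => g n : R -> R^o); split => [n|t]; first exact: finitely_valued_sfun.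
  have := gf t I; rewrite /comp; exact: fine_cvg.
apply: (@measurable_fun_cvg _ _ R setT (fun n => a_ n : R -> R)).
- by move=> n; exact: (finitely_valued_measurable (sa n)).
- by move=> t _; exact: ca.
Qed.

Lemma continuous_strongly_measurable {X : normedModType R} (g : R -> X) :
  continuous g -> strongly_measurable g.
Proof.
move=> cg; apply: (@strongly_measurable1 R^o X g (fun t => t)) => //.
by apply/strongly_measurable_real; exact: measurable_id.
Qed.

Lemma strongly_measurable_norm {X : normedModType R} (g : R -> X) :
  strongly_measurable g -> measurable_fun setT (fun t => `|g t|).
Proof.
move=> mg; apply/(strongly_measurable_real (fun t => `|g t|)).
apply: (@strongly_measurable1 X R^o (fun x => `|x|)) => //.
exact: norm_continuous.
Qed.

Lemma strongly_measurable_scale {X : normedModType R} (a : R -> R) (g : R -> X) :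
  measurable_fun setT a -> strongly_measurable g ->
  strongly_measurable (fun t => a t *: g t).
Proof.
move=> /(strongly_measurable_real a) ma mg.
apply: (@strongly_measurable2 R^o X X (fun x y => (x : R) *: y)) => //.
by move=> x_ y_ x y cx cy; exact: cvgZ.
Qed.

Lemma strongly_measurableB {X : normedModType R} (g h : R -> X) :
  strongly_measurable g -> strongly_measurable h ->
  strongly_measurable (fun t => g t - h t).
Proof. by apply: (strongly_measurable2 (F := fun x y => x - y)) => x_ y_ x y; exact: cvgB. Qed.

Lemma strongly_measurable_cst {X : normedModType R} (x : X) :
  strongly_measurable (fun _ : R => x).
Proof. by apply: continuous_strongly_measurable => t; exact: cvg_cst. Qed.

Lemma strongly_measurable_inner {H : hilbertType R} (g h : R -> H) :
  strongly_measurable g -> strongly_measurable h ->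
  measurable_fun setT (fun t => inner (g t) (h t)).
Proof.
move=> mg mh; apply/strongly_measurable_real.
apply: (@strongly_measurable2 H H R^o (fun x y => inner x y)) => //.
by move=> x_ y_ x y; exact: inner_cvg.
Qed.

Lemma bopBE {V W : normedModType R} (p q : bop V W) x : (p - q) x = p x - q x.
Proof. by []. Qed.

Lemma bop_cvg {V W : normedModType R} {T : Type} {F : set_system T} {FF : Filter F}
    (q : T -> bop V W) (x : T -> V) (q0 : bop V W) (x0 : V) :
  q t @[t --> F] --> q0 -> x t @[t --> F] --> x0 -> q t (x t) @[t --> F] --> q0 x0.
Proof.
move=> cq cx; apply/cvgrPdist_le => e e0.
have lim0 : (`|q0| + 1) * `|x0 - x t| + `|q0 - q t| * `|x0| @[t --> F] --> (0 : R).
  rewrite -[X in _ --> X](_ : (`|q0| + 1) * `|x0 - x0| + `|q0 - q0| * `|x0| = 0); last first.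
    by rewrite !subrr !normr0 mulr0 mul0r addr0.
  apply: cvgD; [apply: cvgMr|apply: cvgMl]; apply: cvg_norm;
    by apply: cvgB => //; exact: cvg_cst.
have q1 : \forall t \near F, `|q0 - q t| < 1 by move/cvgrPdist_lt : cq; exact.
move/cvgrPdist_le : lim0 => /(_ _ e0); apply: filterS2 q1 => t f1.
rewrite sub0r normrN; apply: le_trans.
have -> : q0 x0 - q t (x t) = q t (x0 - x t) + (q0 - q t) x0.
  by rewrite bopBE [q t (_ - _)]linearB /= [RHS]addrC addrA subrK.
rewrite (le_trans (ler_normD _ _))// [leRHS]ger0_norm ?addr_ge0 ?mulr_ge0 ?addr_ge0//.
rewrite lerD//; last exact: le_opnorm.
rewrite (le_trans (le_opnorm _ _))// ler_wpM2r//.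
rewrite -[opnorm _]/`|q t|.
have -> : q t = q0 - (q0 - q t) by rewrite opprB addrC subrK.
by rewrite (le_trans (ler_normB _ _))// lerD// ltW.
Qed.

Lemma bop_continuous {V W : normedModType R} (q : bop V W) : continuous q.
Proof. by move=> x; apply: (@bop_cvg V W _ _ _ (fun=> q)); [exact: cvg_cst|]. Qed.

Lemma strongly_measurable_bop {V W : normedModType R} (q : R -> bop V W) (g : R -> V) :
  strongly_measurable q -> strongly_measurable g ->
  strongly_measurable (fun t => q t (g t)).
Proof.
apply: (@strongly_measurable2 (bop V W) V W (fun x y => x y)) => x_ y_ x y.
exact: bop_cvg.
Qed.

(** Fubini's theorem will require joint measurability. Strong measurability is defined on the line
    only, so the simple approximants are combined on the plane. *)
Lemma measurable_inner_prod {H : hilbertType R} (g h : R -> H) :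
  strongly_measurable g -> strongly_measurable h ->
  measurable_fun setT (fun z : R * R => inner (g z.1) (h z.2)).
Proof.
move=> [g_ [sg cg]] [h_ [sh ch]].
apply: (@measurable_fun_cvg _ _ R setT
  (fun n (z : R * R) => inner (g_ n z.1) (h_ n z.2))).
- move=> n; apply: finitely_valued_measurable.
  apply: (finitely_valued2 (fun x y => inner x y)).
    exact: (finitely_valued_comp (@measurable_fst _ _ _ _) (sg n)).
  exact: (finitely_valued_comp (@measurable_snd _ _ _ _) (sh n)).
- by move=> z _; exact: inner_cvg.
Qed.

End StrongMeasurability.

(** * Lebesgue integrals of real functions on the line *)

Section RealIntegral.
Context {R : realType}.
Local Notation mu := (@lebesgue_measure R).

Lemma ae_imply (P Q : R -> Prop) : {ae mu, forall t, P t} ->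
  (forall t, P t -> Q t) -> {ae mu, forall t, Q t}.
Proof.
move=> aeP PQ; have FF := ae_filter_ringOfSetsType mu.
exact: (@filterS _ _ FF _ _ PQ aeP).
Qed.

Lemma ae_and (P Q : R -> Prop) : {ae mu, forall t, P t} ->
  {ae mu, forall t, Q t} -> {ae mu, forall t, P t /\ Q t}.
Proof.
move=> aeP aeQ; have FF := ae_filter_ringOfSetsType mu.
exact: (@filterI _ _ FF _ _ aeP aeQ).
Qed.

Definition rintegrable (f : R -> R) := mu.-integrable setT (EFin \o f).

Lemma rintegrableP (f : R -> R) : rintegrable f <->
  measurable_fun setT f /\ (\int[mu]_t (`|f t|)%:E < +oo)%E.
Proof.
by split=> [/integrableP[/measurable_EFinP]|[mf fi]] //; apply/integrableP; split => //;
  exact/measurable_EFinP.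
Qed.

Lemma le_rintegrable (f g : R -> R) : measurable_fun setT f ->
  (forall t, `|f t| <= g t) -> rintegrable g -> rintegrable f.
Proof.
move=> mf fg; apply: le_integrable => //; first exact/measurable_EFinP.
by move=> t _; rewrite /= lee_fin (le_trans (fg t))// ler_norm.
Qed.

Lemma rintegrable_indic (A : set R) : measurable A -> (mu A < +oo)%E ->
  rintegrable \1_A.
Proof.
move=> mA fA; apply/rintegrableP; split; first exact: measurable_indic.
under eq_integral do rewrite ger0_norm//.
by rewrite integral_indic// setIT.
Qed.

Lemma rintegrableD (f g : R -> R) : rintegrable f -> rintegrable g ->
  rintegrable (fun t => f t + g t).
Proof. by move=> fi gi; exact: (integrableD measurableT fi gi). Qed.

Lemma rintegrableB (f g : R -> R) : rintegrable f -> rintegrable g ->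
  rintegrable (fun t => f t - g t).
Proof. by move=> fi gi; exact: (integrableB measurableT fi gi). Qed.

Lemma rintegrableZ (a : R) (f : R -> R) : rintegrable f ->
  rintegrable (fun t => a * f t).
Proof. by move=> fi; exact: (integrableZl measurableT a fi). Qed.

Lemma rintegrable0 : rintegrable (fun=> 0).
Proof. exact: integrable0. Qed.

Lemma rintegrable_sum (I : Type) (s : seq I) (f : I -> R -> R) :
  (forall i, rintegrable (f i)) -> rintegrable (fun t => \sum_(i <- s) f i t).
Proof.
move=> fi; elim: s => [|i s ih].
  rewrite (_ : (fun t => _) = fun=> 0); first exact: rintegrable0.
  by apply/funext => t; rewrite big_nil.
rewrite (_ : (fun t => _) = fun t => f i t + \sum_(i <- s) f i t).
  exact: rintegrableD.
by apply/funext => t; rewrite big_cons.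
Qed.

Lemma Rintegral_sum (I : Type) (s : seq I) (f : I -> R -> R) :
  (forall i, rintegrable (f i)) ->
  \int[mu]_t (\sum_(i <- s) f i t) = \sum_(i <- s) \int[mu]_t f i t.
Proof.
move=> fi; elim: s => [|i s ih].
  by rewrite big_nil; under eq_Rintegral do rewrite big_nil;
    rewrite Rintegral_cst// mul0r.
rewrite big_cons -ih -RintegralD//; [|exact: fi|exact: rintegrable_sum].
by apply: eq_Rintegral => t _; rewrite big_cons.
Qed.

Lemma ae_eq_Rintegral (f g : R -> R) : measurable_fun setT f ->
  measurable_fun setT g -> {ae mu, forall t, f t = g t} ->
  \int[mu]_t f t = \int[mu]_t g t.
Proof.
move=> mf mg fg; congr fine; apply: ae_eq_integral => //.
- exact/measurable_EFinP.
- exact/measurable_EFinP.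
- by apply: (ae_imply fg) => t -> _.
Qed.

Lemma Rintegral_dominated_cvg (f_ : nat -> R -> R) (f g : R -> R) :
  (forall n, measurable_fun setT (f_ n)) -> measurable_fun setT f ->
  {ae mu, forall t, f_ n t @[n --> \oo] --> f t} ->
  rintegrable g -> (forall n t, `|f_ n t| <= g t) ->
  \int[mu]_t f_ n t @[n --> \oo] --> \int[mu]_t f t.
Proof.
move=> mf_ mf cf gi fg.
have cE t : f_ n t @[n --> \oo] --> f t -> [set: R] t ->
    (EFin \o f_ n) t @[n --> \oo] --> (EFin \o f) t.
  by move=> h _; apply/fine_cvgP; split; [exact: nearW|exact: h].
have fgE t : forall n, [set: R] t -> (`|(EFin \o f_ n) t| <= (EFin \o g) t)%E.
  by move=> n _; rewrite /= lee_fin.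
case: (@dominated_convergence _ _ _ mu setT measurableT
    (fun n => EFin \o f_ n) (EFin \o f) (EFin \o g)) => //.
- by move=> n; exact: (proj2 (measurable_EFinP _ _) (mf_ n)).
- exact: (proj2 (measurable_EFinP _ _) mf).
- exact: ae_imply cf cE.
- exact: aeW.
move=> fi _ cv.
apply: fine_cvg; rewrite fineK//; exact: integrable_fin_num.
Qed.

Lemma Rintegral_norm_ge0 (W : normedModType R) (f : R -> W) : 0 <= \int[mu]_t `|f t|.
Proof. exact: Rintegral_ge0. Qed.

Lemma EFin_Rintegral (f : R -> R) : rintegrable f ->
  (\int[mu]_t f t)%:E = (\int[mu]_t (f t)%:E)%E.
Proof. by move=> fi; rewrite /Rintegral fineK//; exact: integrable_fin_num. Qed.

End RealIntegral.

(** * The Bochner integral in a Hilbert space *)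

Section Bochner.
Context {R : realType} {H : hilbertType R}.
Local Notation mu := (@lebesgue_measure R).

(** Bochner's criterion; by [bochner_integral_exists] it yields an integral in the sense of
    [has_bochner_integral]. *)
Definition bochner_integrable (g : R -> H) :=
  strongly_measurable g /\ rintegrable (fun t => `|g t|).

Lemma bochner_integrable_inner g h : bochner_integrable g ->
  rintegrable (fun t => inner (g t) h).
Proof.
move=> [mg ig]; apply: (le_rintegrable _ _ (rintegrableZ `|h| ig)).
  by apply: strongly_measurable_inner => //; exact: strongly_measurable_cst.
by move=> t; rewrite mulrC cauchy_schwarz.
Qed.

Lemma le_bochner_integrable (g : R -> H) (a : R -> R) : strongly_measurable g ->
  (forall t, `|g t| <= a t) -> rintegrable a -> bochner_integrable g.
Proof.
move=> mg ga ia; split=> //; apply: le_rintegrable ia.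
  exact: strongly_measurable_norm.
by move=> t; rewrite normr_id.
Qed.

Lemma bochner_integrableZ (a : R) (f : R -> H) : bochner_integrable f ->
  bochner_integrable (fun t => a *: f t).
Proof.
move=> [mf fi].
apply: (le_bochner_integrable _ _ (rintegrableZ `|a| fi)).
  exact: (strongly_measurable_scale (measurable_cst a)).
by move=> t; rewrite normrZ.
Qed.

Lemma bochner_integrableB (f g : R -> H) : bochner_integrable f ->
  bochner_integrable g -> bochner_integrable (fun t => f t - g t).
Proof.
move=> [mf fi] [mg gi].
apply: (le_bochner_integrable _ _ (rintegrableD fi gi)).
  exact: strongly_measurableB.
by move=> t; exact: ler_normB.
Qed.

Section Simple.
Variables (s : R -> H) (s_int : integrable_simple_fun s).

Let r : seq H := finmap.enum_fset (fset_set (range s)).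

Let fin_s : finite_set (range s). Proof. by case: s_int => -[]. Qed.

Let decomp (F : H -> R) t :
  F (s t) = \sum_(w <- r) F w * \1_(s @^-1` [set w]) t.
Proof.
have sr : s t \in r by rewrite in_fset_set// inE; exists t.
rewrite (bigD1_seq (s t))//= ?finmap.fset_uniq// indicE mem_set// mulr1.
rewrite big1_seq ?addr0// => w /andP[ws _]; rewrite indicE memNset ?mulr0//=.
by move=> sw; move: ws; rewrite sw eqxx.
Qed.

(** The fiber of 0 may have infinite measure; [F 0 = 0] removes its term. *)
Let term_integrable (F : H -> R) w : F 0 = 0 ->
  rintegrable (fun t => F w * \1_(s @^-1` [set w]) t).
Proof.
move=> F0; have [->|w0] := eqVneq w 0.
  rewrite (_ : (fun t => _) = fun=> 0); first exact: rintegrable0.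
  by apply/funext => t; rewrite F0 mul0r.
apply: rintegrableZ; apply: rintegrable_indic; first by case: s_int => -[].
by case: s_int => _; exact.
Qed.

Lemma simple_rintegrable (F : H -> R) : F 0 = 0 -> rintegrable (F \o s).
Proof.
move=> F0; have -> : F \o s = fun t => \sum_(w <- r) F w * \1_(s @^-1` [set w]) t.
  by apply/funext => t; exact: decomp.
by apply: rintegrable_sum => w; exact: term_integrable.
Qed.

Lemma simple_integral_inner h : inner (simple_integral s) h = \int[mu]_t inner (s t) h.
Proof.
have inner0 : inner (0 : H) h = 0 by exact: inner0l.
under eq_Rintegral do rewrite (decomp (fun w => inner w h)).
rewrite Rintegral_sum; last by move=> w; exact: (@term_integrable (fun w => inner w h)).
rewrite /simple_integral fsbig_finite//= -/r innerC.
elim: (r : seq H) => [|w q ih]; first by rewrite !big_nil inner0r.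
rewrite !big_cons innerDr ih; congr (_ + _).
have [->|w0] := eqVneq w 0.
  rewrite scaler0 inner0r inner0; under eq_Rintegral do rewrite mul0r.
  by rewrite Rintegral_cst// mul0r.
have mw : measurable (s @^-1` [set w]) by case: s_int => -[].
rewrite RintegralZl//; last first.
  by apply: rintegrable_indic => //; case: s_int => _; exact.
by rewrite innerZr innerC mulrC /Rintegral integral_indic// setIT.
Qed.

Lemma simple_bochner_integrable : bochner_integrable s.
Proof.
split; last exact: (simple_rintegrable (normr0 _)).
by exists (fun=> s); split=> [n|t]; [case: s_int|exact: cvg_cst].
Qed.

End Simple.

(** As [h] is arbitrary, this determines [I], whichever approximating sequence produced it. *)
Lemma has_bochner_integral_inner g I h : bochner_integrable g ->
  has_bochner_integral g I -> inner I h = \int[mu]_t inner (g t) h.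
Proof.
move=> ig [mg [s [s_int s0 sI]]].
have sgi n : rintegrable (fun t => `|g t - s n t|).
  by have [] := bochner_integrableB ig (simple_bochner_integrable (s_int n)).
have d0 : \int[mu]_t `|g t - s n t| @[n --> \oo] --> (0 : R).
  by apply: (@fine_cvg _ _ _ _ _ 0); exact: s0.
have lim1 : inner (simple_integral (s n)) h @[n --> \oo] --> inner I h.
  by apply: inner_cvg => //; exact: cvg_cst.
suff lim2 : inner (simple_integral (s n)) h @[n --> \oo] --> \int[mu]_t inner (g t) h.
  exact: (cvg_unique _ lim1 lim2).
apply/cvgrPdist_le => e e0.
have e1 : 0 < e / (`|h| + 1) by rewrite divr_gt0// ltr_wpDl.
move/cvgrPdist_le : d0 => /(_ _ e1); apply: filterS => n.
rewrite sub0r normrN ger0_norm ?Rintegral_norm_ge0// => dn.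
rewrite simple_integral_inner// -RintegralB//; last 2 first.
- exact: bochner_integrable_inner.
- exact: bochner_integrable_inner (simple_bochner_integrable _).
have gsi : rintegrable (fun t => inner (g t - s n t) h).
  apply: bochner_integrable_inner.
  exact: bochner_integrableB ig (simple_bochner_integrable (s_int n)).
under eq_Rintegral do rewrite -innerBl.
rewrite (le_trans (le_normr_Rintegral _ gsi))//.
rewrite (@le_trans _ _ (\int[mu]_t (`|h| * `|g t - s n t|)))//.
  apply: le_Rintegral => //; first exact: integrable_norm.
    exact: rintegrableZ.
  by move=> t _; rewrite mulrC cauchy_schwarz.
rewrite RintegralZl//; last exact: sgi.
move: dn; rewrite ler_pdivlMr ?ltr_wpDl// => dn.
by rewrite (le_trans _ dn)// mulrC ler_wpM2l ?Rintegral_norm_ge0// lerDl.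
Qed.

Lemma bochner_integral_exists g : bochner_integrable g ->
  exists I, has_bochner_integral g I.
Proof.
move=> [mg ig]; have [s [ss sg]] := mg.
(* Truncation: [s' n] keeps the values of [s n] that are at most [2 * |g t|] and is 0 elsewhere. It
   is dominated by [2 * |g|] and still converges: where [g t != 0] the test eventually succeeds, and
   where [g t = 0] it leaves only 0. *)
pose b n t := `|s n t| <= 2 * `|g t|.
pose s' n t := (b n t)%:R *: s n t.
have fvb n : finitely_valued (b n).
  split; first exact: finite_finset.
  move=> y; rewrite -[X in measurable X]setTI.
  apply: (measurable_fun_ler _ _ measurableT) => //.
    by apply: strongly_measurable_norm; exists (fun=> s n); split => // t; exact: cvg_cst.
  by apply: measurable_funM => //; exact: strongly_measurable_norm.
have ss' n : simple_fun (s' n) := finitely_valued2 (fun (c : bool) x => c%:R *: x) (fvb n) (ss n).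
have s'2 n t : `|s' n t| <= 2 * `|g t|.
  by rewrite /s'; have [bt|bt] := boolP (b n t); rewrite ?scale1r// scale0r normr0 mulr_ge0.
have s'g t : s' n t @[n --> \oo] --> g t.
  have [g0|g0] := eqVneq (g t) 0.
    have -> : s' ^~ t = fun=> 0.
      by apply/funext => n; apply/eqP; rewrite -normr_le0 (le_trans (s'2 n t))// g0 normr0 mulr0.
    by rewrite g0; exact: cvg_cst.
  apply: cvg_trans (sg t); apply: near_eq_cvg.
  have : `|s n t| @[n --> \oo] --> `|g t| by exact: cvg_norm.
  move=> /cvgr_lt /(_ (2 * `|g t|)); rewrite ltr_pMl ?normr_gt0// ltr1n => /(_ isT).
  by apply: filterS => n /ltW bn; rewrite /s' /b bn scale1r.
have is' n : integrable_simple_fun (s' n).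
  split=> // w w0.
  have mw : measurable (s' n @^-1` [set w]) by case: (ss' n).
  (* Chebyshev's inequality: on the fiber of [w], [|w| <= 2 * |g t|]. *)
  have : rintegrable (fun t => 2 / `|w| * `|g t|) by exact: rintegrableZ.
  move=> /integrable_lty-/(_ measurableT); apply: le_lt_trans.
  rewrite -(setIT (s' n @^-1` [set w])) -integral_indic//.
  apply: ge0_le_integral => //=.
  - exact/measurable_EFinP/measurable_indic.
  - by apply/measurable_EFinP/measurable_funM => //; exact: strongly_measurable_norm.
  - move=> t _; rewrite lee_fin indicE; have [|_] := boolP (t \in _).
      rewrite inE /= => sw; have := s'2 n t; rewrite sw.
      by rewrite mulrAC ler_pdivlMr ?normr_gt0// mul1r.
    by rewrite mulr_ge0.
have mgs n : measurable_fun setT (fun t => `|g t - s' n t|).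
  by have [mb _] := simple_bochner_integrable (is' n);
    apply: strongly_measurable_norm; exact: strongly_measurableB.
have gs' n : rintegrable (fun t => `|g t - s' n t|).
  apply: (le_rintegrable (mgs n) _ (rintegrableZ 3 ig)) => t.
  rewrite normr_id (le_trans (ler_normB _ _))//; have := s'2 n t; lra.
have d0 : \int[mu]_t `|g t - s' n t| @[n --> \oo] --> (0 : R).
  rewrite -[X in _ --> X](_ : \int[mu]_t 0 = 0); last by rewrite Rintegral_cst// mul0r.
  apply: (Rintegral_dominated_cvg mgs (measurable_cst _) _ (rintegrableZ 3 ig)).
    apply: aeW => t; rewrite [X in _ --> X](_ : _ = `|g t - g t|).
      by apply: cvg_norm; apply: cvgB; [exact: cvg_cst|exact: s'g].
    by rewrite subrr normr0.
  move=> n t; rewrite normr_id (le_trans (ler_normB _ _))//; have := s'2 n t; lra.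
have dist n m : `|simple_integral (s' n) - simple_integral (s' m)| <=
    \int[mu]_t `|g t - s' n t| + \int[mu]_t `|g t - s' m t|.
  (* Pairing [D] with itself reduces the bound to scalar integrals, after division by [|D|]. *)
  set D := _ - _; have [->|D0] := eqVneq D 0.
    by rewrite normr0 addr_ge0 ?Rintegral_norm_ge0.
  rewrite -(ler_pM2r (_ : 0 < `|D|)) ?normr_gt0// -expr2 -inner_norm {1}/D innerBl.
  have isi k := bochner_integrable_inner D (simple_bochner_integrable (is' k)).
  rewrite !simple_integral_inner//.
  rewrite -RintegralB//; [|exact: isi|exact: isi].
  rewrite -RintegralD//; [|exact: gs'|exact: gs'].
  rewrite -RintegralZr//; last exact: rintegrableD.
  apply: le_Rintegral => //; first exact: rintegrableB.
    under [X in _.-integrable _ (_ \o X)]eq_fun do rewrite mulrC.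
    by apply: rintegrableZ; exact: rintegrableD.
  move=> t _; rewrite -innerBl (le_trans (le_inner _ _))// ler_wpM2r//.
  have -> : s' n t - s' m t = (g t - s' m t) - (g t - s' n t).
    by rewrite opprB [RHS]addrC addrA subrK.
  by rewrite [leRHS]addrC ler_normB.
have : cauchy (simple_integral (s' n) @[n --> \oo]).
  apply/cauchy_exP => e e0.
  have e2 : 0 < e / 2 by rewrite divr_gt0.
  have [N _ hN] : \forall n \near \oo, \int[mu]_t `|g t - s' n t| < e / 2.
    by apply: cvgr_lt e2; exact: d0.
  exists (simple_integral (s' N)), N => // n Nn.
  rewrite /= -ball_normE /ball_ /= (le_lt_trans (dist _ _))//.
  by rewrite [ltRHS]splitr ltrD//; [exact: (hN _ (leqnn N))|exact: (hN _ Nn)].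
move=> /cauchy_cvg/cvg_ex[I cI]; exists I; split => //; exists s'; split => //.
rewrite (_ : (fun n => _) = fun n => (\int[mu]_t `|g t - s' n t|)%:E).
  by apply/fine_cvgP; split; [exact: nearW|exact: d0].
by apply/funext => n; rewrite EFin_Rintegral.
Qed.

Lemma bochner_integral_inner g h : bochner_integrable g ->
  inner (bochner_integral g) h = \int[mu]_t inner (g t) h.
Proof.
move=> ig; rewrite /bochner_integral; case: xgetP => [I _ hI|noI].
  exact: has_bochner_integral_inner.
by have [I hI] := bochner_integral_exists ig; have := noI I hI.
Qed.

Lemma norm_bochner_integral_le g : bochner_integrable g ->
  `|bochner_integral g| <= \int[mu]_t `|g t|.
Proof.
move=> ig; set I := bochner_integral g.
have [->|I0] := eqVneq I 0; first by rewrite normr0 Rintegral_norm_ge0.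
rewrite -(ler_pM2r (_ : 0 < `|I|)) ?normr_gt0// -expr2 -inner_norm {1}/I.
rewrite bochner_integral_inner// -RintegralZr//; last by case: ig.
apply: le_Rintegral => //; first exact: bochner_integrable_inner.
  under [X in _.-integrable _ (_ \o X)]eq_fun do rewrite mulrC.
  by apply: rintegrableZ; case: ig.
by move=> t _; exact: le_inner.
Qed.

Lemma bochner_integralB f g : bochner_integrable f -> bochner_integrable g ->
  bochner_integral (fun t => f t - g t) = bochner_integral f - bochner_integral g.
Proof.
move=> fi gi; apply: inner_ext => h; rewrite innerBl.
rewrite !bochner_integral_inner//; last exact: bochner_integrableB.
rewrite -RintegralB//; [|exact: bochner_integrable_inner..].
by apply: eq_Rintegral => t _; rewrite innerBl.
Qed.

Lemma bochner_integralZ a f : bochner_integrable f ->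
  bochner_integral (fun t => a *: f t) = a *: bochner_integral f.
Proof.
move=> fi; apply: inner_ext => h; rewrite innerZl.
rewrite !bochner_integral_inner//; last exact: bochner_integrableZ.
rewrite -RintegralZl//; last exact: bochner_integrable_inner.
by apply: eq_Rintegral => t _; rewrite innerZl.
Qed.

End Bochner.

(** * Compactly supported mollifiers *)

Section Reflection.
Context {R : realType}.
Local Notation mu := (@lebesgue_measure R).
Implicit Types (c : R) (f : R -> R).

Definition reflection c : measurableTypeR R -> measurableTypeR R := fun s => c - s.

Lemma measurable_reflection c : measurable_fun setT (reflection c).
Proof. exact: measurable_funB. Qed.

HB.instance Definition _ c := @isMeasurableFun.Build _ _ _ _ (reflection c)
  (measurable_reflection c).

(** It suffices to compare the measures of []a, b]]; the reflection moves the open end to the other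
    side, which does not affect the length. *)
Lemma lebesgue_measure_reflection c (A : set R) : measurable A ->
  pushforward mu (reflection c) A = mu A.
Proof.
move=> mA; apply/esym/lebesgue_measure_unique => //= _ [[a b]] _ <-.
rewrite /pushforward (_ : _ @^-1` _ = `[c - b, c - a[%classic); last first.
  apply/seteqP; split=> x /=; rewrite /reflection !in_itv /= => /andP[h1 h2];
    apply/andP; split; lra.
rewrite !lebesgue_measure_itv/= !lte_fin -!EFinB.
have -> : (c - b < c - a) = (a < b) by rewrite ltrD2l ltrN2.
by case: ifP => // _; congr EFin; ring.
Qed.

Lemma ge0_integral_reflection c (f : R -> \bar R) : measurable_fun setT f ->
  (forall t, 0 <= f t)%E ->
  (\int[mu]_t f (c - t)%R = \int[mu]_t f t)%E.
Proof.
move=> mf f0.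
rewrite -[RHS](@eq_measure_integral _ _ _ _ _ (pushforward mu (reflection c))); last first.
  by move=> A mA _; exact: lebesgue_measure_reflection.
rewrite (ge0_integral_pushforward (measurable_reflection c))//.
Qed.

Lemma integral_reflection c (f : R -> \bar R) : measurable_fun setT f ->
  (\int[mu]_t f (c - t)%R = \int[mu]_t f t)%E.
Proof.
move=> mf; rewrite integralE [RHS]integralE.
rewrite -[fun x => f (c - x)]/(f \o (fun x => c - x)) funepos_comp funeneg_comp.
congr (_ - _)%E.
  apply: (ge0_integral_reflection c (measurable_funepos mf)) => t.
  exact: funepos_ge0.
apply: (ge0_integral_reflection c (measurable_funeneg mf)) => t.
exact: funeneg_ge0.
Qed.

Lemma Rintegral_reflection c f : measurable_fun setT f ->
  \int[mu]_t f (c - t) = \int[mu]_t f t.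
Proof.
move=> mf; congr fine; apply: (integral_reflection c (f := EFin \o f)).
exact/measurable_EFinP.
Qed.

Lemma rintegrable_reflection c f : rintegrable f -> rintegrable (fun t => f (c - t)).
Proof.
move=> /rintegrableP[mf fi]; apply/rintegrableP; split.
  exact: (measurableT_comp mf (measurable_reflection c)).
rewrite (integral_reflection c (f := fun t => (`|f t|)%:E))//.
by apply/measurable_EFinP; exact: measurableT_comp.
Qed.

End Reflection.

(** * Functions flat at the origin *)

Section Flat.
Context {R : realType}.
Implicit Types (p q : {poly R}) (x y : R).

(** For [N = n.+1], [expR y] is the [N]-th power of [expR (y / N)], which is at least [y / N];
    whence the constant [N ^+ N]. *)
Lemma expRN_pow_bounded n : exists C : R, forall y, 0 < y -> y ^+ n * expR (- y) <= C.
Proof.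
case: n => [|n].
  exists 1 => y y0; rewrite expr0 mul1r -expR0 ler_expR; lra.
exists (n.+1%:R ^+ n.+1) => y y0.
rewrite expRN ler_pdivrMr ?expR_gt0//.
have -> : expR y = expR (n.+1%:R^-1 * y) ^+ n.+1.
  by rewrite -expRM_natl mulrA divff ?mul1r// pnatr_eq0.
have n0 : 0 <= n.+1%:R * expR (n.+1%:R^-1 * y) by rewrite mulr_ge0 ?expR_ge0.
rewrite -exprMn lerXn2r ?nnegrE ?(ltW y0)//.
rewrite -ler_pdivrMl ?ltr0n// (le_trans _ (expR_ge1Dx _))// lerDr//.
Qed.

Lemma expRN_horner_bounded p n :
  exists C : R, forall y, 0 < y -> `|p.[y]| * y ^+ n * expR (- y) <= C.
Proof.
elim/poly_ind: p n => [|p c ih] n.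
  by exists 0 => y _; rewrite horner0 normr0 !mul0r.
have [C1 h1] := ih n.+1; have [C2 h2] := expRN_pow_bounded n.
exists (C1 + `|c| * C2) => y y0; rewrite !hornerE.
have yn : 0 <= y ^+ n * expR (- y) by rewrite mulr_ge0 ?expR_ge0 ?exprn_ge0 ?ltW.
rewrite -mulrA (@le_trans _ _ ((`|p.[y]| * y + `|c|) * (y ^+ n * expR (- y))))//.
  by rewrite ler_wpM2r// (le_trans (ler_normD _ _))// normrM (gtr0_norm y0).
rewrite mulrDl lerD//.
  by rewrite mulrA -(mulrA _ y) -exprS h1.
by rewrite ler_wpM2l// h2.
Qed.

(** The polynomial factor makes the class stable under differentiation. *)
Definition flat p x : R := if 0 < x then p.[x^-1] * expR (- x^-1) else 0.

(** With [y = 1 / x], differentiation in [x] is [- y ^+ 2] times differentiation in [y], here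
    applied to [p(y) exp(- y)]. *)
Definition dflat p : {poly R} := 'X^2 * (p - p^`()).

Lemma flat_bounded p : exists C : R, 0 <= C /\ forall x, `|flat p x| <= C.
Proof.
have [C hC] := expRN_horner_bounded p 0; exists `|C|; split=> // x; rewrite /flat.
case: ifPn => [x0|_]; last by rewrite normr0.
rewrite normrM (ger0_norm (expR_ge0 _)) (le_trans _ (ler_norm _))//.
by have := hC x^-1; rewrite expr0 mulr1 invr_gt0; exact.
Qed.

(** A quadratic bound, so that the difference quotient at 0 tends to 0. *)
Lemma flat_le p : exists C : R, forall x, `|flat p x| <= C * x ^+ 2.
Proof.
have [C hC] := expRN_horner_bounded p 2; exists `|C| => x; rewrite /flat.
case: ifPn => [x0|_]; last by rewrite normr0 mulr_ge0// sqr_ge0.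
rewrite normrM (ger0_norm (expR_ge0 _)) -ler_pdivrMr ?exprn_gt0//.
rewrite (le_trans _ (ler_norm _))// -exprVn mulrAC.
by have := hC x^-1; rewrite invr_gt0; exact.
Qed.

Lemma is_derive_flat p x : is_derive x 1 (flat p) (flat (dflat p) x).
Proof.
have [x0|x0|<-] := ltrgtP 0 x.
- have nx : \forall y \near x, 0 < y by exact: lt_nbhsr.
  apply: (@near_eq_is_derive _ _ _ (fun y => p.[y^-1] * expR (- y^-1))).
    by apply: filterS nx => y y0; rewrite /flat y0.
  have d1 : is_derive x 1 (fun y : R => y^-1) (- x ^- 2).
    rewrite -[- _]mulr1; apply: is_deriveV; rewrite ?gt_eqF//.
  have d2 : is_derive x 1 (fun y : R => p.[y^-1]) (p^`().[x^-1] * - x ^- 2).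
    by apply: (@is_derive1_comp _ (horner p) (fun y => y^-1)).
  have d3 : is_derive x 1 (fun y : R => expR (- y^-1)) (expR (- x^-1) * x ^- 2).
    rewrite -[x ^- 2]opprK.
    by apply: (@is_derive1_comp _ expR (fun y => - y^-1)); apply: is_deriveN.
  apply: (is_derive_eq (is_deriveM d2 d3)).
  rewrite /flat x0 /dflat !hornerE /= exprVn /GRing.scale /=; ring.
- have nx : \forall y \near x, y < 0 by exact: lt_nbhsl.
  have -> : flat (dflat p) x = 0 by rewrite /flat ltNge (ltW x0).
  apply: (@near_eq_is_derive _ _ _ (cst 0)).
    by apply: filterS nx => y y0; rewrite /flat ltNge (ltW y0).
have -> : flat (dflat p) 0 = 0 by rewrite /flat ltxx.
have [C hC] := flat_le p.
suff cv : h^-1 *: (flat p (h *: 1 + 0) - flat p 0) @[h --> 0^'] --> (0 : R).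
  by apply: DeriveDef; [apply/cvg_ex; exists 0|exact: cvg_lim cv].
apply/cvgrPdist_le => e e0.
have Ce : 0 < e / (`|C| + 1) by rewrite divr_gt0// ltr_wpDl.
near=> h.
have h0 : h != 0 by near: h; exact: nbhs_dnbhs_neq.
have he : `|h| < e / (`|C| + 1).
  by near: h; apply: dnbhs0_lt.
rewrite sub0r normrN addr0 [flat p 0]/flat ltxx subr0 normrM normfV.
rewrite [_ *: 1]mulr1 ler_pdivrMl ?normr_gt0//.
rewrite (le_trans (hC h))// (le_trans (ler_norm _))// normrM normrX expr2 mulrCA.
rewrite ler_wpM2l//; move: he; rewrite ltr_pdivlMr ?ltr_wpDl// => he.
by rewrite (le_trans _ (ltW he))// mulrC ler_wpM2l// lerDl.
Unshelve. all: by end_near. Qed.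

End Flat.

(** * Smooth bumps and normalized mollifiers *)

Section Bumps.
Context {R : realType}.
Local Notation mu := (@lebesgue_measure R).
Implicit Types (l : seq ({poly R} * {poly R})) (x y : R).

(* The span of products of flat functions at [0] and [1]: it is closed under
   differentiation, whence smoothness. *)
Definition bumps l x := \sum_(pq <- l) flat pq.1 x * flat pq.2 (1 - x).

(** The product rule; the sign produced by the inner function [1 - x] is carried by the first
    polynomial. *)
Definition dbumps l :=
  flatten [seq [:: (dflat pq.1, pq.2); (- pq.1, dflat pq.2)] | pq <- l].

Lemma is_derive_bumps l x : is_derive x 1 (bumps l) (bumps (dbumps l) x).
Proof.
elim: l => [|[p q] l ih].
  rewrite /dbumps /= /bumps big_nil.
  have -> : (fun x : R => \sum_(pq <- [::]) flat pq.1 x * flat pq.2 (1 - x)) = cst 0.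
    by apply/funext => y; rewrite big_nil.
  exact: is_derive_cst.
have -> : bumps ((p, q) :: l) = (fun y => flat p y * flat q (1 - y)) + bumps l.
  by apply/funext => y; rewrite /bumps big_cons.
have -> : bumps (dbumps ((p, q) :: l)) x = (flat p x *: (flat (dflat q) (1 - x) * (-1))
    + flat q (1 - x) *: flat (dflat p) x) + bumps (dbumps l) x.
  rewrite /bumps /dbumps /= !big_cons addrA; congr (_ + _) => /=.
  rewrite /GRing.scale /= [flat (- p) x](_ : _ = - flat p x); first ring.
  by rewrite /flat hornerN mulNr; case: ifP; rewrite ?oppr0.
apply: is_deriveD; apply: is_deriveM; first exact: is_derive_flat.
have d1 : is_derive x 1 (fun y : R => 1 - y) (-1).
  by apply: (is_derive_eq (is_deriveB (is_derive_cst (1 : R) x 1) (is_derive_id x 1)));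
    rewrite sub0r.
exact: (@is_derive1_comp _ (flat q) (fun y => 1 - y) _ _ _ (is_derive_flat q _) d1).
Qed.

Lemma bumps_bounded l : exists C : R, 0 <= C /\ forall x, `|bumps l x| <= C.
Proof.
elim: l => [|[p q] l [C [C0 hC]]].
  by exists 0; split => // x; rewrite /bumps big_nil normr0.
have [C1 [C10 h1]] := flat_bounded p; have [C2 [C20 h2]] := flat_bounded q.
exists (C1 * C2 + C); split; first by rewrite addr_ge0 ?mulr_ge0.
move=> x; rewrite /bumps big_cons (le_trans (ler_normD _ _))//= lerD//; last exact: hC.
by rewrite normrM ler_pM.
Qed.

Lemma bumps_support l x : ~~ (0 < x < 1) -> bumps l x = 0.
Proof.
rewrite negb_and => h; rewrite /bumps big1// => pq _; rewrite /flat.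
by case/orP : h => [/negPf ->|]; rewrite ?mul0r// -subr_gt0 => /negPf ->; rewrite mulr0.
Qed.

Lemma is_derive_lipschitz (f df : R -> R) (M : R) :
  (forall x, is_derive x 1 f (df x)) -> (forall x, `|df x| <= M) ->
  forall x y, `|f x - f y| <= M * `|x - y|.
Proof.
move=> fdf dfM.
suff h x y : x < y -> `|f x - f y| <= M * `|x - y|.
  move=> x y; have [xy|yx|->] := ltgtP x y; first exact: h.
    by rewrite distrC [X in _ <= _ * X]distrC; exact: h.
  by rewrite !subrr normr0 mulr0.
move=> xy; rewrite distrC [X in _ <= _ * X]distrC.
have cf : {within `[x, y], continuous f}.
  apply: continuous_subspaceT => z; apply: differentiable_continuous.
  by apply/derivable1_diffP; case: (fdf z).
have [c _ ->] := MVT xy (fun z _ => fdf z) cf.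
by rewrite normrM ler_wpM2r.
Qed.

Lemma is_derive_bumps_affine l (a t s : R) :
  is_derive s 1 (fun s => bumps l (a * (t - s))) (- a * bumps (dbumps l) (a * (t - s))).
Proof.
have d1 : is_derive s 1 (fun y : R => t - y) (-1).
  by apply: (is_derive_eq (is_deriveB (is_derive_cst (t : R) s 1) (is_derive_id s 1)));
    rewrite sub0r.
have d2 : is_derive s 1 (fun y : R => a * (t - y)) (- a).
  by apply: (is_derive_eq (is_deriveZ a d1)); rewrite /GRing.scale /= mulrN1.
apply: (is_derive_eq (@is_derive1_comp _ (bumps l) (fun y => a * (t - y)) _ _ _
  (is_derive_bumps l _) d2)).
by rewrite mulrC.
Qed.

Lemma is_derive_scalev (V : normedModType R) (f : R -> R) (df : R) (v : V) (s : R) :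
  is_derive s 1 f df -> is_derive s 1 (fun s => f s *: v) (df *: v).
Proof.
move=> [/cvg_ex/= [l fl] dfE].
have cv : h^-1 *: (f (h *: 1 + s) *: v - f s *: v) @[h --> 0^'] --> df *: v.
  rewrite -dfE /derive (cvg_lim _ fl)//.
  under eq_cvg do rewrite -scalerBl scalerA.
  by apply: cvgZr_tmp.
by apply: DeriveDef; [apply/cvg_ex; exists (df *: v)|exact: cvg_lim cv].
Qed.

Lemma test_function_bumps (V : normedModType R) (c a t : R) l (v : V) : 0 < a ->
  test_function (fun s => (c * bumps l (a * (t - s))) *: v).
Proof.
move=> a0.
have der (c' : R) l' (s : R) : is_derive s 1 (fun s => (c' * bumps l' (a * (t - s))) *: v)
    ((c' * (- a * bumps (dbumps l') (a * (t - s)))) *: v).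
  apply: is_derive_scalev; apply: is_deriveZ; exact: is_derive_bumps_affine.
have ders n : exists c' l', derive1n n (fun s => (c * bumps l (a * (t - s))) *: v) =
    fun s => (c' * bumps l' (a * (t - s))) *: v.
  elim: n => [|n [c' [l' ih]]]; first by exists c, l.
  exists (c' * - a), (dbumps l'); rewrite derive1nS ih; apply/funext => s.
  rewrite derive1E; have [_ ->] := der c' l' s.
  by rewrite mulrA.
split=> [n s|].
  by have [c' [l' ->]] := ders n; have [] := der c' l' s.
apply: (@subclosed_compact _ _ `[t - a^-1, t]%classic).
- exact: closed_closure.
- exact: segment_compact.
have cI : closed `[t - a^-1, t]%classic by exact: interval_closed.
rewrite [X in _ `<=` X]((closure_id _).1 cI).
apply: closure_subset => s /= hs.
have : 0 < a * (t - s) < 1.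
  by apply: contraNT hs => hs; rewrite bumps_support// mulr0 scale0r.
move=> /andP[]; rewrite pmulr_rgt0// => h1; rewrite -ltr_pdivlMl// mulr1 => h2.
rewrite in_itv/=; apply/andP; split; lra.
Qed.

(** The support in []0, r[] makes [k (t - s)] vanish unless [s < t], which is causality. The
    Lipschitz bound on [dk] serves to differentiate under the integral sign, and [mollifier_test]
    supplies the test functions of the weak formulation. *)
Record mollifier (r : R) (k dk : R -> R) (M : R) : Prop := {
  mollifier_ge0 : forall x, 0 <= k x ;
  mollifier_support : forall x, ~~ (0 < x < r) -> k x = 0 ;
  mollifier_dsupport : forall x, ~~ (0 < x < r) -> dk x = 0 ;
  mollifier_le : forall x, k x <= M ;
  mollifier_dle : forall x, `|dk x| <= M ;
  mollifier_lipschitz : forall x y, `|dk x - dk y| <= M * `|x - y| ;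
  mollifier_is_derive : forall x, is_derive x 1 k (dk x) ;
  mollifier_mass : \int[mu]_x k x = 1 ;
  mollifier_test : forall (V : normedModType R) (v : V) t,
    test_function (fun s => k (t - s) *: v)
}.

Definition bump : R -> R := bumps [:: (1, 1)].

Lemma bumpE x : bump x = flat 1 x * flat 1 (1 - x).
Proof. by rewrite /bump /bumps big_seq1. Qed.

Lemma flat1_ge0 x : 0 <= flat (1 : {poly R}) x.
Proof. by rewrite /flat hornerE mul1r; case: ifP => // _; exact: expR_ge0. Qed.

Lemma flat1_le1 x : flat (1 : {poly R}) x <= 1.
Proof.
rewrite /flat hornerE mul1r; case: ifP => // x0.
by rewrite -expR0 ler_expR oppr_le0 invr_ge0 ltW.
Qed.

Lemma bump_ge0 x : 0 <= bump x.
Proof. by rewrite bumpE mulr_ge0 ?flat1_ge0. Qed.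

Lemma bump_le1 x : bump x <= 1.
Proof. by rewrite bumpE mulr_ile1 ?flat1_ge0 ?flat1_le1. Qed.

Lemma flat1_ge x : 4^-1 <= x -> expR (-4) <= flat (1 : {poly R}) x.
Proof.
move=> x4; have x0 : 0 < x by rewrite (lt_le_trans _ x4).
rewrite /flat x0 hornerE mul1r ler_expR lerN2 -[leRHS]invrK lef_pV2 ?posrE//.
Qed.

(** An explicit bound on the middle half of the support, which bounds the mass of the rescaled bump
    from below by a constant over [a]. *)
Lemma bump_ge x : 4^-1 <= x <= 3 / 4 -> expR (-4) * expR (-4) <= bump x.
Proof.
move=> /andP[x1 x2]; rewrite bumpE ler_pM ?expR_ge0 ?flat1_ge//; lra.
Qed.

Lemma bumps_continuous l : continuous (bumps l).
Proof.
move=> x; apply: differentiable_continuous.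
by apply/derivable1_diffP; case: (is_derive_bumps l x).
Qed.

Lemma bumps_scaled_measurable l (a : R) : measurable_fun setT (fun x => bumps l (a * x)).
Proof.
apply: (measurableT_comp (f := bumps l)); last exact: measurable_funM.
apply: continuous_measurable_fun; exact: bumps_continuous.
Qed.

Lemma bump_scaled_rintegrable (a : R) : 0 < a -> rintegrable (fun x => bump (a * x)).
Proof.
move=> a0; apply: (@le_rintegrable _ _ \1_(`[0, a^-1]%classic)).
- exact: bumps_scaled_measurable.
- move=> x; rewrite ger0_norm ?bump_ge0// indicE; have [_|xa] := boolP (x \in _).
    exact: bump_le1.
  rewrite /bump bumps_support//; apply: contraNN xa; rewrite inE /= in_itv /=.
  move=> /andP[]; rewrite pmulr_rgt0// => /ltW -> /=.
  by rewrite -ltr_pdivlMl// mulr1 => /ltW.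
- by apply: rintegrable_indic => //=; rewrite lebesgue_measure_itv/=; case: ifP => // _;
    rewrite -EFinB ltry.
Qed.

Lemma bump_scaled_mass (a : R) : 0 < a ->
  expR (-4) * expR (-4) / (2 * a) <= \int[mu]_x bump (a * x).
Proof.
move=> a0; set b := _ * expR _.
pose A : set R := `[4^-1 / a, 3 / 4 / a]%classic.
have mA : mu A = (2^-1 / a)%:E.
  rewrite lebesgue_measure_itv/= lte_fin ltr_pM2r ?invr_gt0// ifT; last lra.
  by rewrite -EFinB -mulrBl; congr (_ / _)%:E; lra.
have fA : (mu A < +oo)%E by rewrite mA ltry.
have mmA : measurable A by exact: measurable_itv.
have iA : rintegrable \1_A by exact: rintegrable_indic.
rewrite (@le_trans _ _ (\int[mu]_x (b * \1_A x)))//.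
  rewrite RintegralZl// /Rintegral integral_indic// setIT.
  rewrite (_ : fine _ = 2^-1 / a); last by rewrite -[RHS]/(fine (2^-1 / a)%:E) -mA.
  by rewrite invfM mulrA.
apply: le_Rintegral => //; first exact: rintegrableZ.
  exact: bump_scaled_rintegrable.
move=> x _; rewrite indicE; have [|_] := boolP (x \in A); last first.
  by rewrite mulr0 bump_ge0.
rewrite inE /A /= in_itv/= ler_pdivrMr// ler_pdivlMr// mulr1 => h.
by apply: bump_ge; rewrite mulrC.
Qed.

(** With [C] independent of [n], the kernel is dominated by a multiple of the normalized indicator
    of a ball of radius [n.+1%:R^-1], so that mollifications converge at Lebesgue points. The bound
    [M], which also controls derivatives, may depend on [n]. *)
Lemma mollifier_exists : exists C : R, forall n : nat, exists k dk M,
  mollifier n.+1%:R^-1 k dk M /\ forall x, k x <= C * n.+1%:R.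
Proof.
pose b : R := expR (-4) * expR (-4).
have b0 : 0 < b by rewrite mulr_gt0 ?expR_gt0.
exists (2 / b) => n; pose a : R := n.+1%:R; have a0 : 0 < a by rewrite ltr0n.
pose m := \int[mu]_x bump (a * x).
have m_ge : b / (2 * a) <= m by exact: bump_scaled_mass.
have m0 : 0 < m by rewrite (lt_le_trans _ m_ge)// divr_gt0// mulr_gt0.
pose l0 : seq ({poly R} * {poly R}) := [:: (1, 1)].
have [C1 [C10 h1]] := bumps_bounded (dbumps l0).
have [C2 [C20 h2]] := bumps_bounded (dbumps (dbumps l0)).
pose k x := m^-1 * bump (a * x).
pose dk x := m^-1 * (a * bumps (dbumps l0) (a * x)).
pose d2k x := m^-1 * (a * (a * bumps (dbumps (dbumps l0)) (a * x))).
(* The sum of the bounds for [k], [dk] and [d2k], so that it serves for all three. *)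
pose M := m^-1 + m^-1 * (a * C1) + m^-1 * (a * (a * C2)).
have der l x : is_derive x 1 (fun x => bumps l (a * x)) (a * bumps (dbumps l) (a * x)).
  have d1 : is_derive x 1 (fun y : R => a * y) a.
    by apply: (is_derive_eq (is_deriveZ a (is_derive_id x 1)));
      rewrite /GRing.scale /= mulr1.
  apply: (is_derive_eq (@is_derive1_comp _ (bumps l) (fun y => a * y) _ _ _
    (is_derive_bumps l _) d1)).
  by rewrite mulrC.
have supp x : ~~ (0 < x < a^-1) -> ~~ (0 < a * x < 1).
  apply: contraNN => /andP[]; rewrite pmulr_rgt0// => -> /=.
  by rewrite -ltr_pdivlMl// mulr1.
have mi0 : 0 <= m^-1 by rewrite invr_ge0 ltW.
have t1 : 0 <= m^-1 * (a * C1) by rewrite !mulr_ge0// ltW.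
have t2 : 0 <= m^-1 * (a * (a * C2)) by rewrite !mulr_ge0// ltW.
exists k, dk, M; split; last first.
  move=> x; rewrite (@le_trans _ _ m^-1)//.
    by rewrite ler_piMr// bump_le1.
  have : (b / (2 * a))^-1 = 2 / b * a by field; rewrite ?gt_eqF.
  by move=> <-; rewrite lef_pV2 ?posrE// divr_gt0// mulr_gt0.
split.
- by move=> x; rewrite mulr_ge0// bump_ge0.
- by move=> x /supp h; rewrite /k /bump bumps_support// mulr0.
- by move=> x /supp h; rewrite /dk bumps_support// !mulr0.
- move=> x; rewrite (@le_trans _ _ m^-1)//; first by rewrite ler_piMr// bump_le1.
  by rewrite /M -addrA lerDl addr_ge0.
- move=> x; rewrite normrM (ger0_norm mi0) normrM (gtr0_norm a0).
  rewrite (@le_trans _ _ (m^-1 * (a * C1)))//.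
    by rewrite ler_wpM2l// ler_wpM2l ?(ltW a0)// h1.
  by rewrite /M addrAC lerDr addr_ge0.
- apply: (@is_derive_lipschitz dk d2k).
  move=> x; rewrite !normrM (ger0_norm mi0) (gtr0_norm a0).
  rewrite (@le_trans _ _ (m^-1 * (a * (a * C2))))//.
    by rewrite ler_wpM2l// !ler_wpM2l ?(ltW a0)// h2.
  by rewrite /M lerDr addr_ge0.
- by move=> x; exact: (is_deriveZ m^-1 (der l0 x)).
- rewrite /k RintegralZl//; last exact: bump_scaled_rintegrable.
  by rewrite mulVf// gt_eqF.
- by move=> V v t; exact: test_function_bumps.
Qed.

End Bumps.

(** * Causal mollification *)

Section Kernels.
Context {R : realType} {H : hilbertType R}.
Local Notation mu := (@lebesgue_measure R).
Implicit Types (u : R -> H) (c : R -> R) (T t : R).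

(** The indicator of []-oo, T]] as a real factor, so that integrals over half-lines are integrals
    over the whole line. *)
Definition past T : R -> R := fun t => (t <= T)%R%:R.

Lemma past_ge0 T t : 0 <= past T t.
Proof. by []. Qed.

Lemma pastT T t : t <= T -> past T t = 1.
Proof. by rewrite /past => ->. Qed.

Lemma past_gt T t : T < t -> past T t = 0.
Proof. by rewrite /past ltNge => /negPf ->. Qed.

Lemma past_mono T T' t : T <= T' -> past T t <= past T' t.
Proof.
move=> TT'; rewrite /past; case: (leP t T) => // tT.
by rewrite (le_trans tT TT').
Qed.

Lemma measurable_past T : measurable_fun setT (past T).
Proof.
have -> : past T = \1_(`]-oo, T]%classic).
  apply/funext => t; rewrite /past indicE; congr ((nat_of_bool _)%:R); apply/idP/idP.
    by move=> tT; apply/mem_set; rewrite /= in_itv.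
  by rewrite inE /= in_itv.
exact: measurable_indic.
Qed.

Definition past_integrable u := strongly_measurable u /\
  forall T, rintegrable (fun t => past T t * `|u t|).

(** The properties shared by a mollifier and its derivative: [mollify] is used with both. *)
Record kernel (r : R) c (M : R) : Prop := {
  kernel_support : forall x, ~~ (0 < x < r) -> c x = 0 ;
  kernel_le : forall x, `|c x| <= M ;
  kernel_lipschitz : forall x y, `|c x - c y| <= M * `|x - y|
}.

Lemma mollifier_kernel (r : R) k dk M : mollifier r k dk M -> kernel r k M.
Proof.
move=> km; split=> [x|x|]; first exact: mollifier_support km x.
  by rewrite ger0_norm ?(mollifier_ge0 km) ?(mollifier_le km).
exact: is_derive_lipschitz (mollifier_is_derive km) (mollifier_dle km).
Qed.

Lemma mollifier_dkernel (r : R) k dk M : mollifier r k dk M -> kernel r dk M.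
Proof.
move=> km; split; [exact: mollifier_dsupport km|exact: mollifier_dle km|].
exact: mollifier_lipschitz km.
Qed.

Section Kernel.
Variables (r M : R) (c : R -> R).
Hypothesis ck : kernel r c M.

Lemma kernel_bound_ge0 : 0 <= M.
Proof. by rewrite (le_trans _ (kernel_le ck 0)). Qed.

Lemma kernel_continuous : continuous c.
Proof.
move=> x; apply/cvgrPdist_le => e e0.
have M0 := kernel_bound_ge0.
have e1 : 0 < e / (M + 1) by rewrite divr_gt0// ltr_wpDl.
near=> y.
rewrite (le_trans (kernel_lipschitz ck _ _))//.
have : `|x - y| <= e / (M + 1) by near: y; apply: cvgr_dist_le => //; exact: cvg_id.
rewrite ler_pdivlMr ?ltr_wpDl// => h; rewrite (le_trans _ h)// mulrC ler_wpM2l// lerDl//.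
Unshelve. all: by end_near. Qed.

Lemma kernel_measurable : measurable_fun setT c.
Proof. by apply: continuous_measurable_fun; exact: kernel_continuous. Qed.

Lemma kernel_reflection_measurable t : measurable_fun setT (fun s : R => c (t - s)).
Proof. exact: (measurableT_comp kernel_measurable (measurable_reflection t)). Qed.

Lemma kernel_past_le T t s : t <= T -> `|c (t - s)| <= M * past T s.
Proof.
move=> tT; have [st|ts] := ltP s t.
  by rewrite pastT ?mulr1 ?(kernel_le ck)// (le_trans (ltW st)).
rewrite (kernel_support ck) ?normr0 ?mulr_ge0 ?kernel_bound_ge0//.
by rewrite negb_and -leNgt subr_le0 ts.
Qed.

Lemma kernel_bochner_integrable u t : past_integrable u ->
  bochner_integrable (fun s => c (t - s) *: u s).
Proof.
move=> [mu_ iu].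
apply: (le_bochner_integrable _ _ (rintegrableZ M (iu t))).
  by apply: strongly_measurable_scale => //; exact: kernel_reflection_measurable.
by move=> s; rewrite normrZ mulrA ler_wpM2r// kernel_past_le.
Qed.

Definition mollify c u t := bochner_integral (fun s => c (t - s) *: u s).

Lemma mollify_lipschitz u T t t' : past_integrable u -> t <= T -> t' <= T ->
  `|mollify c u t - mollify c u t'| <=
    M * (\int[mu]_s (past T s * `|u s|)) * `|t - t'|.
Proof.
move=> iu tT t'T.
rewrite /mollify -bochner_integralB; last 2 first.
- exact: (kernel_bochner_integrable t iu).
- exact: (kernel_bochner_integrable t' iu).
have ii := bochner_integrableB (kernel_bochner_integrable t iu) (kernel_bochner_integrable t' iu).
rewrite (le_trans (norm_bochner_integral_le ii))//.
rewrite mulrAC -RintegralZl//; last exact: iu.2.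
apply: le_Rintegral => //; first by case: ii.
  by apply: rintegrableZ; exact: iu.2.
move=> s _; rewrite -scalerBl normrZ mulrA ler_wpM2r//.
have [sT|Ts] := leP s T.
  rewrite pastT// mulr1 (le_trans (kernel_lipschitz ck _ _))//.
  by rewrite [X in `|X|](_ : _ = t - t')//; ring.
have neg t0 : t0 <= T -> c (t0 - s) = 0.
  move=> t0T; apply: (kernel_support ck).
  by rewrite negb_and -leNgt subr_le0 (le_trans t0T)// ltW.
by rewrite !neg// subrr normr0 past_gt// mulr0.
Qed.

Lemma mollify_continuous u : past_integrable u -> continuous (mollify c u).
Proof.
move=> iu t; apply/cvgrPdist_le => e e0.
set L := M * (\int[mu]_s (past (t + 1) s * `|u s|)).
have L0 : 0 <= L.
  rewrite mulr_ge0 ?kernel_bound_ge0//; apply: Rintegral_ge0 => s _.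
  by rewrite mulr_ge0.
have e1 : 0 < e / (L + 1) by rewrite divr_gt0// ltr_wpDl.
near=> t'.
have t'1 : t' <= t + 1.
  near: t'; have : t < t + 1 by rewrite ltrDl.
  by move=> /lt_nbhsl; apply: filterS => x /ltW.
rewrite (le_trans (@mollify_lipschitz u (t + 1) t t' iu _ t'1)) ?lerDl// -/L.
have : `|t - t'| <= e / (L + 1) by near: t'; apply: cvgr_dist_le => //; exact: cvg_id.
rewrite ler_pdivlMr ?ltr_wpDl// => h; rewrite (le_trans _ h)// mulrC ler_wpM2l// lerDl//.
Unshelve. all: by end_near. Qed.

Lemma mollify_inner u t h : past_integrable u ->
  inner (mollify c u t) h = \int[mu]_s (c (t - s) * inner (u s) h).
Proof.
move=> iu; rewrite bochner_integral_inner; last exact: kernel_bochner_integrable.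
by apply: eq_Rintegral => s _; rewrite innerZl.
Qed.

(** Only the values of [u] before [t] are seen, so the endpoint [t = T] is included. *)
Lemma mollify_vanishes u T : past_integrable u ->
  {ae mu, forall t, t < T -> u t = 0} -> forall t, t <= T -> mollify c u t = 0.
Proof.
move=> iu u0 t tT; have ii := kernel_bochner_integrable t iu.
apply/eqP; rewrite -normr_le0 (le_trans (norm_bochner_integral_le ii))//.
rewrite (@ae_eq_Rintegral _ _ (fun=> 0)) ?Rintegral_cst ?mul0r//.
- by apply: strongly_measurable_norm; case: ii.
- apply: (ae_imply u0) => s us; have [st|ts] := ltP s t.
    by rewrite us ?scaler0 ?normr0// (lt_le_trans st).
  by rewrite (kernel_support ck) ?scale0r ?normr0// negb_and -leNgt subr_le0 ts.
Qed.

End Kernel.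

(** Mean value theorem for [k y - y * dk x], whose derivative [dk y - dk x] is at most [M * |h|]
    between [x] and [x + h]. The bound is uniform in [x]. *)
Lemma mollifier_taylor (r : R) k dk M (x h : R) : mollifier r k dk M ->
  `|k (x + h) - k x - h * dk x| <= M * `|h| ^+ 2.
Proof.
move=> km.
pose g y := k y - y * dk x.
have dg (y : R) : is_derive y 1 g (dk y - dk x).
  have d1 := mollifier_is_derive km y.
  have d2 : is_derive y 1 (fun y : R => y * dk x) (dk x).
    have := is_derive_scalev (V := R^o) (dk x) (is_derive_id y 1).
    by rewrite scale1r.
  exact: (is_deriveB d1 d2).
have cg : continuous g.
  by move=> y; apply: differentiable_continuous; apply/derivable1_diffP; case: (dg y).
have M0 := kernel_bound_ge0 (mollifier_kernel km).
have key (a b : R) : a < b -> x \in `[a, b] -> `|g b - g a| <= M * (b - a) ^+ 2.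
  move=> ab xab; have [d dab ->] := MVT ab (fun y _ => dg y) (continuous_subspaceT cg).
  rewrite /= normrM (gtr0_norm (_ : 0 < b - a)) ?subr_gt0// expr2 mulrA.
  rewrite ler_wpM2r ?subr_ge0 ?(ltW ab)//.
  rewrite (le_trans (mollifier_lipschitz km _ _))// ler_wpM2l//.
  move: xab dab; rewrite !in_itv /= => /andP[? ?] /andP[? ?].
  by rewrite ler_norml; apply/andP; split; lra.
have -> : k (x + h) - k x - h * dk x = g (x + h) - g x by rewrite /g; ring.
rewrite real_normK ?num_real//.
have [h0|h0|->] := ltrgtP h 0.
- rewrite distrC -sqrrN (_ : - h = x - (x + h)); last ring.
  by apply: key; rewrite ?gtrDl// in_itv/= lexx gerDl (ltW h0).
- rewrite [in leRHS](_ : h = (x + h) - x); last ring.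
  by apply: key; rewrite ?ltrDl// in_itv/= lexx lerDl (ltW h0).
- by rewrite addr0 subrr normr0 mulr_ge0// sqr_ge0.
Qed.

Lemma is_derive_mollify (r : R) k dk M u t : mollifier r k dk M -> past_integrable u ->
  is_derive t 1 (mollify k u) (mollify dk u t).
Proof.
move=> km iu; have kk := mollifier_kernel km; have kd := mollifier_dkernel km.
have M0 := kernel_bound_ge0 kk.
(* Increments with [|h| < 1] involve [u] up to time [t + 1] only; Taylor's bound under the integral
   then gives an error of at most [L * |h|]. *)
set L := M * (\int[mu]_s (past (t + 1) s * `|u s|)).
have L0 : 0 <= L.
  by rewrite mulr_ge0//; apply: Rintegral_ge0 => s _; rewrite mulr_ge0.
suff cv : h^-1 *: (mollify k u (h *: 1 + t) - mollify k u t) @[h --> 0^'] --> mollify dk u t.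
  by apply: DeriveDef; [apply/cvg_ex; exists (mollify dk u t)|exact: cvg_lim cv].
apply/cvgrPdist_le => e e0.
have e1 : 0 < e / (L + 1) by rewrite divr_gt0// ltr_wpDl.
near=> h.
have h0 : h != 0 by near: h; exact: nbhs_dnbhs_neq.
have h1 : `|h| < 1 by near: h; exact: dnbhs0_lt.
have he : `|h| < e / (L + 1) by near: h; exact: dnbhs0_lt.
have it := kernel_bochner_integrable kk t iu.
have ith := kernel_bochner_integrable kk (t + h) iu.
have idt := kernel_bochner_integrable kd t iu.
have i1 := bochner_integrableZ h^-1 (bochner_integrableB ith it).
have i2 := bochner_integrableB idt i1.
rewrite [_ *: 1]mulr1 [h + t]addrC /mollify -bochner_integralB//.
rewrite -bochner_integralZ; last exact: bochner_integrableB.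
rewrite -bochner_integralB// (le_trans (norm_bochner_integral_le i2))//.
rewrite (@le_trans _ _ (L * `|h|))//; last first.
  move: he; rewrite ltr_pdivlMr ?ltr_wpDl// => /ltW he; rewrite (le_trans _ he)//.
  by rewrite mulrC ler_wpM2l// lerDl.
rewrite mulrAC -RintegralZl//; last exact: iu.2.
apply: le_Rintegral => //; first by case: i2.
  by apply: rintegrableZ; exact: iu.2.
move=> s _; rewrite -scalerBl scalerA -scalerBl normrZ mulrA ler_wpM2r//.
have [st|ts] := leP s (t + 1); last first.
  have neg t0 x : t0 <= t + 1 -> kernel r x M -> x (t0 - s) = 0.
    move=> t0T xk; apply: (kernel_support xk).
    by rewrite negb_and -leNgt subr_le0 (le_trans t0T)// ltW.
  have th1 : t + h <= t + 1 by rewrite lerD2l (le_trans (ler_norm _))// ltW.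
  rewrite (neg t dk) ?lerDl// (neg t k) ?lerDl// (neg _ k)// !subrr mulr0 subrr.
  by rewrite normr0 past_gt// mulr0.
rewrite pastT// mulr1.
have := mollifier_taylor (t - s) h km.
rewrite (_ : t - s + h = t + h - s); last by rewrite addrAC.
set a := k _ - k _ => ah.
rewrite -(ler_pM2l (_ : 0 < `|h|)) ?normr_gt0// -normrM mulrBr mulrA mulfV// mul1r.
by rewrite distrC (le_trans ah)// expr2 mulrCA.
Unshelve. all: by end_near. Qed.

End Kernels.

(** * Lebesgue points of vector-valued functions *)

Section LebesguePoints.
Context {R : realType}.
Local Notation mu := (@lebesgue_measure R).

(** Twice the average over the ball, whose measure is [2 / n.+1%:R]. *)
Definition mean_osc (W : normedModType R) (u : R -> W) (t : R) (n : nat) : R :=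
  n.+1%:R * \int[mu]_s (\1_(ball t (n.+1%:R^-1 : R)) s * `|u s - u t|).

Definition locally_rintegrable (W : normedModType R) (u : R -> W) :=
  forall r : R, rintegrable (fun s => \1_(ball (0 : R) r) s * `|u s|).

Lemma past_locally_rintegrable (W : normedModType R) (u : R -> W) :
  measurable_fun setT (fun s => `|u s|) ->
  (forall T, rintegrable (fun s => past T s * `|u s|)) -> locally_rintegrable u.
Proof.
move=> mu_ iu r; apply: le_rintegrable (iu r).
  by apply: measurable_funM => //; apply: measurable_indic; exact: measurable_ball.
move=> s; rewrite ger0_norm ?mulr_ge0// ler_wpM2r// indicE.
have [|_] := boolP (s \in (ball (0 : R) r : set R)); last exact: past_ge0.
rewrite inE -ball_normE /ball_ /= sub0r normrN => sr.
by rewrite pastT// (le_trans (ler_norm _))// ltW.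
Qed.

Lemma rintegrable_ball (t r : R) : rintegrable (\1_(ball t r)).
Proof.
apply: rintegrable_indic; first exact: measurable_ball.
have [r0|r0] := leP r 0; first by rewrite (ball0 _ _).2// measure0 ltry.
by rewrite lebesgue_measure_ball ?ltry// ltW.
Qed.

Lemma Rintegral_indic_ball (t r : R) : 0 <= r ->
  \int[mu]_s \1_(ball t r) s = r *+ 2.
Proof.
move=> r0; rewrite /Rintegral integral_indic//; last exact: measurable_ball.
by rewrite setIT; exact: (congr1 fine (lebesgue_measure_ball t r0)).
Qed.

Lemma rintegrable_local_ball (W : normedModType R) (u : R -> W) (w : W) (t r : R) :
  measurable_fun setT (fun s => `|u s - w|) ->
  locally_rintegrable u ->
  rintegrable (fun s => \1_(ball t r) s * `|u s - w|).
Proof.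
move=> mu_ iu.
have ib := rintegrable_ball t r.
apply: (le_rintegrable _ _ (rintegrableD (iu (`|t| + r)) (rintegrableZ `|w| ib))).
  by apply: measurable_funM => //; apply: measurable_indic; exact: measurable_ball.
move=> s; rewrite ger0_norm ?mulr_ge0// !indicE.
have [|_] := boolP (s \in (ball t r : set R)); last first.
  by rewrite mul0r mulr0 addr0 mulr_ge0.
rewrite inE -ball_normE /ball_ /= => sr.
rewrite mem_set ?mul1r ?mulr1 ?ler_normB//= /ball_ /= sub0r normrN.
rewrite (_ : s = t - (t - s)); last by rewrite opprB addrCA subrr addr0.
by rewrite (le_lt_trans (ler_normB _ _))// ltrD2l.
Qed.

Lemma mean_osc_cvg0_real (q : R -> R) : measurable_fun setT q ->
  locally_rintegrable (q : R -> R^o) ->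
  {ae mu, forall t, mean_osc (q : R -> R^o) t n @[n --> \oo] --> (0 : R)}.
Proof.
move=> mq iq.
have lq : locally_integrable setT q.
  split => //; first exact: openT.
  move=> K _ cK.
  have [B [_ hB]] := compact_bounded cK.
  pose T := `|B| + 1.
  have KT s : K s -> `|s| <= T.
    by move=> Ks; have := hB T; rewrite (le_lt_trans (ler_norm B)) ?ltrDl// => /(_ isT s Ks).
  have /rintegrableP[_] := iq (T + 1); apply: le_lt_trans.
  rewrite integral_mkcond; apply: ge0_le_integral => //.
  - by move=> s _; rewrite patchE; case: ifP.
  - apply/(measurable_restrictT _ _).1; first exact: compact_measurable.
    by apply/measurable_EFinP; apply: measurable_funTS; exact: measurableT_comp.
  - apply/measurable_EFinP; apply: measurableT_comp => //; apply: measurable_funM.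
      by apply: measurable_indic; exact: measurable_ball.
    exact: measurableT_comp.
  - move=> s _; rewrite patchE; case: ifPn => [|_]; last by rewrite lee_fin.
    rewrite inE => Ks; rewrite lee_fin indicE mem_set ?mul1r ?normr_id//.
    rewrite -ball_normE /ball_ /= sub0r normrN (le_lt_trans (KT _ Ks))//.
    by rewrite ltrDl.
apply: (ae_imply (lebesgue_differentiation lq)) => t qt.
have qn : (davg q t (n.+1%:R^-1)) @[n --> \oo] --> 0%E.
  have r0 : (n.+1%:R^-1 : R) @[n --> \oo] --> (0 : R)^'+.
    move=> A hA; have [N _ hN] := @cvg_harmonic R _ hA.
    by exists N => // n Nn; apply: (hN n Nn); rewrite /= invr_gt0.
  exact: cvg_comp r0 qt.
suff -> : mean_osc (q : R -> R^o) t = fun n => 2 * fine (davg q t n.+1%:R^-1).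
  rewrite -[X in _ --> X](mulr0 2); apply: cvgMr.
  by apply: (@fine_cvg _ _ _ _ _ 0).
apply/funext => n; rewrite /mean_osc /davg /iavg lebesgue_measure_ball//.
have ri : rintegrable (fun s => \1_(ball t (n.+1%:R^-1 : R)) s * `|(q s : R^o) - q t|).
  apply: (@rintegrable_local_ball R^o) => //.
  by apply: measurableT_comp => //; exact: measurable_funB.
have -> : (\int[mu]_(y in ball t (n.+1%:R^-1 : R)) `|((center (q t) \o q) y)%:E| =
    (\int[mu]_s (\1_(ball t (n.+1%:R^-1 : R)) s * `|q s - q t|))%:E)%E.
  rewrite EFin_Rintegral// integral_mkcond; apply: eq_integral => s _.
  by rewrite patchE indicE; case: ifP => _; rewrite ?mul1r ?mul0r.
have -> : ((n.+1%:R^-1 *+ 2 : R)%:E^-1 = (n.+1%:R / 2)%:E)%E.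
  have n0 : (n.+1%:R^-1 *+ 2 : R) != 0 by rewrite mulrn_eq0/= invr_eq0 pnatr_eq0.
  rewrite inver (negPf n0); congr EFin; rewrite -[_ *+ 2]mulr_natr.
  by rewrite invfM invrK.
by rewrite -EFinM /= mulrA; congr (_ * _); field.
Qed.

Lemma separable_dense_seq (X : normedModType R) : separable X ->
  exists h : nat -> X, forall x (e : R), 0 < e -> exists n, `|x - h n| < e.
Proof.
move=> [D [cD dD]].
have dDx x (e : R) : 0 < e -> exists2 y, D y & `|x - y| < e.
  move=> e0; have [|y] := dD (ball x e) _ (ball_open x e).
    by exists x; exact: ballxx.
  by rewrite -ball_normE => -[xy Dy]; exists y.
have [y Dy _] := dDx 0 1 ltr01.
have [f injf] := countable_injP _ cD.
exists (fun n => xget 0 [set x | D x /\ f x = n]) => x e e0.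
have [z Dz xz] := dDx x e e0; exists (f z).
case: xgetP => [w _ [Dw fw]|/(_ z)[]//].
by rewrite (injf w z)// inE.
Qed.

(** The scalar theorem applies to [|u - h j|] for each point [h j] of a countable dense set, outside
    one common null set. At a good [t], choosing [h j] close to [u t] controls [|u s - u t|] by the
    oscillation of [|u s - h j|] plus [2 * |u t - h j|]. *)
Lemma mean_osc_cvg0 (X : normedModType R) (u : R -> X) : separable X ->
  strongly_measurable u -> locally_rintegrable u ->
  {ae mu, forall t, mean_osc u t n @[n --> \oo] --> (0 : R)}.
Proof.
move=> /separable_dense_seq[h hd] mu_ iu.
have mB (w : X) : measurable_fun setT (fun s => `|u s - w|).
  apply: strongly_measurable_norm; apply: strongly_measurableB => //.
  exact: strongly_measurable_cst.
have li (w : X) : locally_rintegrable (fun s => `|u s - w| : R^o).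
  move=> r; have := rintegrable_local_ball 0 r (mB w) iu.
  by under eq_fun do rewrite -[`|u _ - _|]normr_id.
have ae_h : {ae mu, forall t, forall j, mean_osc (fun s => `|u s - h j| : R^o) t n
    @[n --> \oo] --> (0 : R)}.
  apply: ae_foralln => j; exact: (mean_osc_cvg0_real (mB (h j)) (li (h j))).
apply: (ae_imply ae_h) => t ht; apply/cvgrPdist_le => e e0.
have e8 : 0 < e / 8 by rewrite divr_gt0.
have [j uj] := hd (u t) _ e8.
have e2 : 0 < e / 2 by rewrite divr_gt0.
have /cvgrPdist_le/(_ _ e2) := ht j; apply: filterS => n.
rewrite !sub0r !normrN; set O := mean_osc _ t n => On.
have n0 : (0 : R) < n.+1%:R by rewrite ltr0n.
have iB := rintegrable_ball t (n.+1%:R^-1 : R).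
have i1 := rintegrable_local_ball t (n.+1%:R^-1 : R) (mB (u t)) iu.
have m2 : measurable_fun setT (fun s => `|(`|u s - h j| : R^o) - `|u t - h j| |).
  by apply: measurableT_comp => //; apply: measurable_funB.
have i2 := rintegrable_local_ball t (n.+1%:R^-1 : R) m2 (li (h j)).
have i3 := rintegrableD i2 (rintegrableZ (2 * `|u t - h j|) iB).
(* Integrated over the ball and normalized, the constant [2 * |u t - h j|] gives 4 times the
   distance, which is less than [e / 2] by the choice of [e / 8]. *)
have le1 : mean_osc u t n <= O + 4 * `|u t - h j|.
  rewrite /O /mean_osc (@le_trans _ _ (n.+1%:R * (\int[mu]_s
    (\1_(ball t (n.+1%:R^-1 : R)) s * `|(`|u s - h j| : R^o) - `|u t - h j| |
      + 2 * `|u t - h j| * \1_(ball t (n.+1%:R^-1 : R)) s))))//.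
    rewrite ler_wpM2l//; apply: le_Rintegral => // s _.
    rewrite indicE; have [_|_] := boolP (s \in _); last by rewrite !mul0r mulr0 addr0.
    rewrite !mul1r mulr1 (_ : u s - u t = (u s - h j) - (u t - h j)); last first.
      by rewrite opprB addrA subrK.
    rewrite (le_trans (ler_normB _ _))//.
    by have := ler_norm (`|u s - h j| - `|u t - h j|); lra.
  rewrite RintegralD//; last exact: rintegrableZ.
  rewrite mulrDr lerD2l RintegralZl//.
  rewrite Rintegral_indic_ball// -[n.+1%:R^-1 *+ 2]mulr_natr.
  have -> : n.+1%:R * (2 * `|u t - h j| * (n.+1%:R^-1 * 2)) =
      n.+1%:R / n.+1%:R * (4 * `|u t - h j|) by ring.
  by rewrite divff ?mul1r// gt_eqF.
have O0 : 0 <= mean_osc u t n.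
  by rewrite /mean_osc mulr_ge0//; apply: Rintegral_ge0 => s _; rewrite mulr_ge0.
rewrite ger0_norm// (le_trans le1)//.
have := ler_norm O; lra.
Qed.

End LebesguePoints.

(** * Mollification of scalar functions *)

Section RealMollification.
Context {R : realType}.
Local Notation mu := (@lebesgue_measure R).
Implicit Types (q k dk : R -> R) (t T M r : R).

Lemma mollifier_measurable r k dk M : mollifier r k dk M -> measurable_fun setT k.
Proof. by move=> km; exact: kernel_measurable (mollifier_kernel km). Qed.

Lemma mollifier_rintegrable r k dk M : mollifier r k dk M -> rintegrable k.
Proof.
move=> km; apply/rintegrableP; split; first exact: mollifier_measurable km.
under eq_integral do rewrite ger0_norm ?(mollifier_ge0 km)//.
have := mollifier_mass km; rewrite /Rintegral ltey; apply: contra_eq_neq => ->.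
by rewrite /= eq_sym oner_neq0.
Qed.

Lemma mollifier_reflection_rintegrable r k dk M t : mollifier r k dk M ->
  rintegrable (fun s => k (t - s)).
Proof. by move=> km; apply: rintegrable_reflection; exact: mollifier_rintegrable km. Qed.

Lemma mollifier_reflection_mass r k dk M t : mollifier r k dk M ->
  \int[mu]_s k (t - s) = 1.
Proof.
move=> km; rewrite Rintegral_reflection; first exact: mollifier_mass km.
exact: mollifier_measurable km.
Qed.

Lemma mollifier_shift_mass r k dk M s : mollifier r k dk M ->
  (\int[mu]_t (k (t - s))%:E = 1)%E.
Proof.
move=> km; have mk := mollifier_measurable km.
have mN : measurable_fun setT (fun x : R => k (0 - x)).
  exact: (measurableT_comp mk (measurable_reflection 0)).
have := integral_reflection s ((measurable_EFinP _ _).2 mN).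
under eq_integral do rewrite /= sub0r opprB.
move=> ->; have := integral_reflection 0 ((measurable_EFinP _ _).2 mk).
move=> /= ->; rewrite -EFin_Rintegral; last exact: mollifier_rintegrable km.
by rewrite (mollifier_mass km).
Qed.

Definition rmollify k q t : R := \int[mu]_s (k (t - s) * q s).

Lemma rmollify_rintegrable r k dk M q t : mollifier r k dk M ->
  measurable_fun setT q -> (forall T, rintegrable (fun s => past T s * `|q s|)) ->
  rintegrable (fun s => k (t - s) * q s).
Proof.
move=> km mq iq; have kk := mollifier_kernel km.
apply: (le_rintegrable _ _ (rintegrableZ M (iq t))).
  by apply: measurable_funM => //; exact: kernel_reflection_measurable kk t.
by move=> s; rewrite normrM mulrA ler_wpM2r// (kernel_past_le kk).
Qed.

(* Tonelli: causality of the mollifier confines the mass to the past. *)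
Lemma rmollify_past_le r k dk M q T : mollifier r k dk M ->
  measurable_fun setT q -> (forall t, 0 <= q t) ->
  (forall T, rintegrable (fun s => past T s * `|q s|)) ->
  rintegrable (fun t => past T t * rmollify k q t) /\
  \int[mu]_t (past T t * rmollify k q t) <= \int[mu]_t (past T t * q t).
Proof.
move=> km mq q0 iq; have kk := mollifier_kernel km.
pose F (z : R * R) : \bar R := (past T z.1 * (k (z.1 - z.2) * q z.2))%:E.
have mF : measurable_fun setT F.
  apply/measurable_EFinP; apply: measurable_funM.
    exact: (measurableT_comp (measurable_past T) measurable_fst).
  apply: measurable_funM.
    apply: (measurableT_comp (mollifier_measurable km)).
    by apply: measurable_funB; [exact: measurable_fst|exact: measurable_snd].
  exact: (measurableT_comp mq measurable_snd).
have F0 z : (0 <= F z)%E by rewrite lee_fin !mulr_ge0// (mollifier_ge0 km).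
have FE t : (\int[mu]_s F (t, s) = (past T t * rmollify k q t)%:E)%E.
  have ik := rmollify_rintegrable t km mq iq.
  by rewrite -RintegralZl// EFin_Rintegral//; exact: rintegrableZ.
have ge0 t : 0 <= past T t * rmollify k q t.
  by rewrite mulr_ge0//; apply: Rintegral_ge0 => s _; rewrite mulr_ge0 ?(mollifier_ge0 km).
have mP : measurable_fun setT (fun t => past T t * rmollify k q t).
  apply/measurable_EFinP.
  have := @measurable_fun_fubini_tonelli_F _ _ _ _ _ mu F mF F0.
  by rewrite /fubini_F; under eq_fun do rewrite FE.
have mks s : measurable_fun setT (fun t : R => k (t - s)).
  by apply: (measurableT_comp (mollifier_measurable km)); exact: measurable_funB.
have le1 : (\int[mu]_t (past T t * rmollify k q t)%:E <= \int[mu]_t (past T t * q t)%:E)%E.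
  under eq_integral do rewrite -FE.
  rewrite (@fubini_tonelli _ _ _ _ _ mu mu F mF F0).
  apply: ge0_le_integral => //.
  - by move=> s _; apply: integral_ge0 => t _; exact: F0.
  - exact: (@measurable_fun_fubini_tonelli_G _ _ _ _ _ mu F mF F0).
  - by apply/measurable_EFinP; apply: measurable_funM => //; exact: measurable_past.
  move=> s _; rewrite (@le_trans _ _ (\int[mu]_t ((past T s * q s)%:E * (k (t - s))%:E))%E)//.
    apply: ge0_le_integral => //.
    - exact: (measurableT_comp mF (measurable_pair2 s)).
    - by apply: measurable_funeM; apply/measurable_EFinP; exact: mks.
    - move=> t _; rewrite -EFinM lee_fin [k _ * _]mulrC mulrA.
      have [st|ts] := ltP s t.
        rewrite ler_wpM2r ?(mollifier_ge0 km)// ler_wpM2r// /past.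
        by case: (leP t T) => // tT; rewrite (le_trans (ltW st) tT).
      rewrite (mollifier_support km) ?mulr0//.
      by rewrite negb_and -leNgt subr_le0 ts.
  rewrite ge0_integralZl//.
  - by rewrite (mollifier_shift_mass _ km) mule1.
  - by apply/measurable_EFinP; exact: mks.
  - by move=> t _; rewrite lee_fin (mollifier_ge0 km).
  - by rewrite lee_fin mulr_ge0.
have iq' : rintegrable (fun t => past T t * q t).
  by have := iq T; under eq_fun do rewrite ger0_norm//.
have ip : rintegrable (fun t => past T t * rmollify k q t).
  apply/rintegrableP; split => //.
  under eq_integral do rewrite ger0_norm//.
  by rewrite (le_lt_trans le1)// -EFin_Rintegral// ltry.
by split=> //; rewrite -lee_fin !EFin_Rintegral.
Qed.

End RealMollification.

(** * Convergence of mollifications, almost everywhere and in L^2 *)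

Section Approximation.
Context {R : realType} {H : hilbertType R}.
Local Notation mu := (@lebesgue_measure R).
Variables (k dk : nat -> R -> R) (M : nat -> R) (C : R).
Hypothesis km : forall n, mollifier n.+1%:R^-1 (k n) (dk n) (M n).
Hypothesis kC : forall n x, k n x <= C * n.+1%:R.

Lemma mollifier_le_ball n (t s : R) :
  k n (t - s) <= C * n.+1%:R * \1_(ball t (n.+1%:R^-1 : R)) s.
Proof.
rewrite indicE; have [_|st] := boolP (s \in (ball t (n.+1%:R^-1 : R) : set R)).
  by rewrite mulr1 kC.
rewrite mulr0 (mollifier_support (km n))//; apply: contraNN st => /andP[h1 h2].
by rewrite inE -ball_normE /ball_ /= gtr0_norm.
Qed.

Lemma mollifier_mean_osc (W : normedModType R) (u : R -> W) n t :
  measurable_fun setT (fun s => `|u s - u t|) -> locally_rintegrable u ->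
  rintegrable (fun s => k n (t - s) * `|u s - u t|) /\
  \int[mu]_s (k n (t - s) * `|u s - u t|) <= C * mean_osc u t n.
Proof.
move=> mu_ iu; have ii := rintegrable_local_ball t (n.+1%:R^-1 : R) mu_ iu.
have le1 s : k n (t - s) * `|u s - u t| <=
    C * n.+1%:R * (\1_(ball t (n.+1%:R^-1 : R)) s * `|u s - u t|).
  by rewrite mulrA ler_wpM2r// mollifier_le_ball.
have ik : rintegrable (fun s => k n (t - s) * `|u s - u t|).
  apply: (le_rintegrable _ _ (rintegrableZ (C * n.+1%:R) ii)).
    apply: measurable_funM => //.
    exact: kernel_reflection_measurable (mollifier_kernel (km n)) t.
  by move=> s; rewrite ger0_norm// mulr_ge0// (mollifier_ge0 (km n)).
split=> //; rewrite /mean_osc mulrA -RintegralZl//.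
by apply: le_Rintegral => //; exact: rintegrableZ.
Qed.

Lemma rmollify_cvg_ae (q : R -> R) : measurable_fun setT q ->
  (forall T, rintegrable (fun s => past T s * `|q s|)) ->
  {ae mu, forall t, rmollify (k n) q t @[n --> \oo] --> q t}.
Proof.
move=> mq iq.
have lq : locally_rintegrable (q : R -> R^o).
  by apply: past_locally_rintegrable => //; exact: measurableT_comp.
apply: (ae_imply (mean_osc_cvg0_real mq lq)) => t osc0.
apply/cvgrPdist_le => e e0.
have : C * mean_osc (q : R -> R^o) t n @[n --> \oo] --> C * 0 by exact: cvgMr.
rewrite mulr0 => /cvgrPdist_le /(_ _ e0); apply: filterS => n.
rewrite sub0r normrN => /(le_trans (ler_norm _)); apply: le_trans.
have mqt : measurable_fun setT (fun s => `|(q s : R^o) - q t|).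
  by apply: measurableT_comp => //; exact: measurable_funB.
have [ik le1] := mollifier_mean_osc n (u := q : R -> R^o) mqt lq.
rewrite (le_trans _ le1)//.
have it := mollifier_reflection_rintegrable t (km n).
(* Unit mass writes [q t] as a mean with the same weight, so that the error is a weighted mean of
   [q s - q t]. *)
have qE : q t = \int[mu]_s (q t * k n (t - s)).
  by rewrite RintegralZl// (mollifier_reflection_mass _ (km n)) mulr1.
rewrite {1}qE /rmollify distrC -RintegralB//; last 2 first.
- exact: rmollify_rintegrable (km n) mq iq.
- exact: rintegrableZ.
have ib : rintegrable (fun s => k n (t - s) * q s - q t * k n (t - s)).
  by apply: rintegrableB; [exact: rmollify_rintegrable (km n) mq iq|exact: rintegrableZ].
rewrite (le_trans (le_normr_Rintegral _ ib))//.
apply: le_Rintegral => //; first exact: integrable_norm.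
move=> s _; rewrite [q t * _]mulrC -mulrBr normrM ger0_norm ?(mollifier_ge0 (km n))//.
Qed.

Variable u : R -> H.
Hypothesis iu : past_integrable u.

Lemma mollify_cvg_ae : separable H ->
  {ae mu, forall t, mollify (k n) u t @[n --> \oo] --> u t}.
Proof.
move=> sH; have [mu_ iu'] := iu.
have lu : locally_rintegrable u.
  by apply: past_locally_rintegrable => //; exact: strongly_measurable_norm.
apply: (ae_imply (mean_osc_cvg0 sH mu_ lu)) => t osc0.
apply/cvgrPdist_le => e e0.
have : C * mean_osc u t n @[n --> \oo] --> C * 0 by exact: cvgMr.
rewrite mulr0 => /cvgrPdist_le /(_ _ e0); apply: filterS => n.
rewrite sub0r normrN => /(le_trans (ler_norm _)); apply: le_trans.
have sB : strongly_measurable (fun s => u s - u t).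
  by apply: strongly_measurableB => //; exact: strongly_measurable_cst.
have mut : measurable_fun setT (fun s => `|u s - u t|) by exact: strongly_measurable_norm.
have [ik le1] := mollifier_mean_osc n mut lu.
rewrite distrC (le_trans _ le1)//.
have it := mollifier_reflection_rintegrable t (km n).
have iku := kernel_bochner_integrable (mollifier_kernel (km n)) t iu.
have iB : bochner_integrable (fun s => k n (t - s) *: (u s - u t)).
  split; first by apply: strongly_measurable_scale => //; case/rintegrableP : it.
  by under eq_fun do rewrite normrZ ger0_norm ?(mollifier_ge0 (km n))//.
suff -> : mollify (k n) u t - u t = bochner_integral (fun s => k n (t - s) *: (u s - u t)).
  rewrite (le_trans (norm_bochner_integral_le iB))//.
  by under eq_Rintegral do rewrite normrZ ger0_norm ?(mollifier_ge0 (km n))//.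
apply: inner_ext => h; rewrite innerBl bochner_integral_inner//.
rewrite (mollify_inner (mollifier_kernel (km n)))//.
have -> : inner (u t) h = \int[mu]_s (inner (u t) h * k n (t - s)).
  by rewrite RintegralZl// (mollifier_reflection_mass _ (km n)) mulr1.
rewrite -RintegralB//.
- by apply: eq_Rintegral => s _; rewrite innerZl innerBl mulrBr [in RHS](mulrC _ (inner (u t) h)).
- by have := bochner_integrable_inner h iku; under eq_fun do rewrite innerZl.
- exact: rintegrableZ.
Qed.

Hypothesis iu2 : forall T, rintegrable (fun s => past T s * `|u s| ^+ 2).

Let q s := `|u s| ^+ 2.

Let mq : measurable_fun setT q.
Proof. by apply: measurable_funX; apply: strongly_measurable_norm; case: iu. Qed.

Let q0 s : 0 <= q s. Proof. exact: sqr_ge0. Qed.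

Let iq T : rintegrable (fun s => past T s * `|q s|).
Proof. by have := iu2 T; under eq_fun do rewrite -[_ ^+ 2](ger0_norm (sqr_ge0 _)). Qed.

(* Jensen's inequality. *)
Lemma mollify_sqr_le n t : `|mollify (k n) u t| ^+ 2 <= rmollify (k n) q t.
Proof.
have kk := mollifier_kernel (km n).
have iku := kernel_bochner_integrable kk t iu.
pose b := \int[mu]_s (k n (t - s) * `|u s|).
have ib : rintegrable (fun s => k n (t - s) * `|u s|).
  have [_] := iku.
  by under eq_fun do rewrite normrZ ger0_norm ?(mollifier_ge0 (km n))//.
have it := mollifier_reflection_rintegrable t (km n).
have iQ := rmollify_rintegrable t (km n) mq iq.
have ab : `|mollify (k n) u t| <= b.
  rewrite (le_trans (norm_bochner_integral_le iku))// /b.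
  by under eq_Rintegral do rewrite normrZ ger0_norm ?(mollifier_ge0 (km n))//.
have b0 : 0 <= b by rewrite (le_trans _ ab).
rewrite (@le_trans _ _ (b ^+ 2))//; first by rewrite ler_sqr ?nnegrE.
have : 0 <= \int[mu]_s (k n (t - s) * (`|u s| - b) ^+ 2).
  by apply: Rintegral_ge0 => s _; rewrite mulr_ge0 ?sqr_ge0 ?(mollifier_ge0 (km n)).
have -> : \int[mu]_s (k n (t - s) * (`|u s| - b) ^+ 2) =
    \int[mu]_s (k n (t - s) * q s - (2 * b * (k n (t - s) * `|u s|) - b ^+ 2 * k n (t - s))).
  by apply: eq_Rintegral => s _; rewrite /q; ring.
have i1 := rintegrableZ (2 * b) ib; have i2 := rintegrableZ (b ^+ 2) it.
rewrite RintegralB//; last exact: rintegrableB.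
rewrite RintegralB// !RintegralZl// (mollifier_reflection_mass _ (km n)) -/b.
rewrite /rmollify; lra.
Qed.

(** There is no fixed integrable majorant of [w' n], only the moving one [2 * Q' n + 2 * q']. It
    converges almost everywhere, and its integrals do not exceed that of the limit, which suffices
    by an argument of Scheffé's type. *)
Lemma mollify_L2_cvg T : separable H ->
  \int[mu]_t (past T t * `|mollify (k n) u t - u t| ^+ 2) @[n --> \oo] --> (0 : R).
Proof.
move=> sH.
pose Q n := rmollify (k n) q.
pose w n t := `|mollify (k n) u t - u t| ^+ 2.
have mw n : measurable_fun setT (w n).
  apply: measurable_funX; apply: strongly_measurable_norm.
  apply: strongly_measurableB; last by case: iu.
  apply: continuous_strongly_measurable.
  exact: (mollify_continuous (mollifier_kernel (km n)) iu).
have mP := measurable_past T.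
have iPq : rintegrable (fun t => past T t * q t) by exact: iu2.
have [iPQ PQ] : (forall n, rintegrable (fun t => past T t * Q n t)) /\
    (forall n, \int[mu]_t (past T t * Q n t) <= \int[mu]_t (past T t * q t)).
  by split=> n; have [] := rmollify_past_le T (km n) mq q0 iq.
pose w' n t := past T t * w n t.
pose q' t := past T t * q t.
pose Q' n t := past T t * Q n t.
have Q0 n t : 0 <= Q n t.
  by apply: Rintegral_ge0 => s _; rewrite mulr_ge0 ?(mollifier_ge0 (km n)).
have w'0 n t : 0 <= w' n t by rewrite mulr_ge0// sqr_ge0.
have w'le n t : w' n t <= 2 * Q' n t + 2 * q' t.
  rewrite [2 * Q' n t]mulrCA [2 * q' t]mulrCA -mulrDr ler_wpM2l//.
  rewrite (@le_trans _ _ (2 * `|mollify (k n) u t| ^+ 2 + 2 * q t))//; last first.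
    by rewrite lerD2r ler_wpM2l// mollify_sqr_le.
  have := parallelogram (mollify (k n) u t) (u t); rewrite /w /q => <-.
  by rewrite lerDr sqr_ge0.
have mw' n : measurable_fun setT (w' n) by exact: measurable_funM.
have iw' n : rintegrable (w' n).
  apply: (le_rintegrable (mw' n) _ (rintegrableD (rintegrableZ 2 (iPQ n)) (rintegrableZ 2 iPq))).
  by move=> t; rewrite ger0_norm.
pose D n t := q' t - Q' n t.
have iD n : rintegrable (D n) := rintegrableB iPq (iPQ n).
have mD n : measurable_fun setT (D n) by case/rintegrableP : (iD n).
(* [D n] has no majorant, but its positive part is at most [q']. By [PQ] the integral of [D n] is
   nonnegative, so its negative part is no larger in mean than the positive one. *)
pose Dp n t := Num.max (D n t) 0.
have mDp n : measurable_fun setT (Dp n).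
  by apply: measurable_maxr => //.
have Dp0 n t : 0 <= Dp n t by rewrite le_max lexx orbT.
have Dp_le n t : `|Dp n t| <= q' t.
  by rewrite ger0_norm// ge_max mulr_ge0// andbT gerBl mulr_ge0.
have iDp n : rintegrable (Dp n) := le_rintegrable (mDp n) (Dp_le n) iPq.
have cDp : \int[mu]_t Dp n t @[n --> \oo] --> (0 : R).
  rewrite -[X in _ --> X](_ : \int[mu]_t 0 = 0); last by rewrite Rintegral_cst// mul0r.
  apply: (Rintegral_dominated_cvg mDp (measurable_cst _) _ iPq Dp_le).
  apply: (ae_imply (rmollify_cvg_ae mq iq)) => t Qt.
  have D0 : `|D n t| @[n --> \oo] --> (0 : R).
    rewrite -[X in _ --> X](_ : `|q' t - past T t * q t| = 0); last by rewrite subrr normr0.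
    by apply: cvg_norm; apply: cvgB; [exact: cvg_cst|exact: cvgMr].
  apply: (squeeze_cvgr _ (cvg_cst 0) D0); apply: nearW => n.
  by rewrite Dp0 ge_max ler_norm normr_ge0.
(* [4 * q'] is the limit of the moving majorant. What exceeds it in [w' n] is at most [- 2 * D n],
   hence at most [2 * (Dp n - D n)]. *)
pose m n t := Num.min (w' n t) (4 * q' t).
have mm n : measurable_fun setT (m n).
  by apply: measurable_minr => //; case/rintegrableP : (rintegrableZ 4 iPq).
have q'0 t : 0 <= 4 * q' t by rewrite !mulr_ge0.
have m_le n t : `|m n t| <= 4 * q' t.
  by rewrite ger0_norm ?ge_min ?lexx ?orbT// le_min w'0 q'0.
have im n : rintegrable (m n) := le_rintegrable (mm n) (m_le n) (rintegrableZ 4 iPq).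
have cm : \int[mu]_t m n t @[n --> \oo] --> (0 : R).
  rewrite -[X in _ --> X](_ : \int[mu]_t 0 = 0); last by rewrite Rintegral_cst// mul0r.
  apply: (Rintegral_dominated_cvg mm (measurable_cst _) _ (rintegrableZ 4 iPq) m_le).
  apply: (ae_imply (mollify_cvg_ae sH)) => t ut.
  have m0 n : 0 <= m n t by rewrite le_min w'0 q'0.
  have w0 : w' n t @[n --> \oo] --> (0 : R).
    have -> : w' ^~ t = fun n => past T t *
        (`|mollify (k n) u t - u t| * `|mollify (k n) u t - u t|).
      by apply/funext => n; rewrite /w' /w expr2.
    rewrite -[X in _ --> X](_ : past T t * (`|u t - u t| * `|u t - u t|) = 0); last first.
      by rewrite subrr normr0 !mulr0.
    by apply: cvgMr; apply: cvgM; apply: cvg_norm; apply: cvgB => //; exact: cvg_cst.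
  apply: (squeeze_cvgr _ (cvg_cst 0) w0); apply: nearW => n.
  by rewrite m0 ge_min lexx.
have key n : \int[mu]_t w' n t <= \int[mu]_t m n t + 2 * \int[mu]_t Dp n t.
  have i2 : rintegrable (fun t => Dp n t - D n t) by exact: rintegrableB.
  have i3 := rintegrableD (im n) (rintegrableZ 2 i2).
  rewrite (@le_trans _ _ (\int[mu]_t (m n t + 2 * (Dp n t - D n t))))//.
    apply: le_Rintegral => //; [exact: iw'|move=> t _].
    have h1 : D n t <= Dp n t by rewrite le_max lexx.
    have h2 : D n t = q' t - Q' n t by [].
    have h3 := Dp0 n t; have h4 := w'le n t.
    rewrite /m; move: (w' n t) (q' t) (Q' n t) (D n t) (Dp n t) h1 h2 h3 h4.
    by move=> a b c d e ? ? ? ?; case: (leP a (4 * b)) => ?; lra.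
  rewrite RintegralD//; [|exact: im|exact: rintegrableZ].
  rewrite lerD2l RintegralZl// ler_wpM2l//.
  have -> : \int[mu]_t (Dp n t - D n t) = \int[mu]_t Dp n t - \int[mu]_t D n t.
    by apply: RintegralB => //; [exact: iDp|exact: iD].
  have -> : \int[mu]_t D n t = \int[mu]_t q' t - \int[mu]_t Q' n t.
    by apply: RintegralB => //; exact: iPQ.
  by rewrite gerBl subr_ge0 PQ.
have lim0 : \int[mu]_t m n t + 2 * \int[mu]_t Dp n t @[n --> \oo] --> (0 : R).
  rewrite -[X in _ --> X](_ : 0 + 2 * 0 = 0); last by rewrite mulr0 addr0.
  by apply: cvgD => //; exact: cvgMr.
apply: (squeeze_cvgr _ (cvg_cst 0) lim0); apply: nearW => n.
by rewrite key andbT; apply: Rintegral_ge0 => t _; exact: w'0.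
Qed.

End Approximation.

(** * Causal functions and the mollified equation *)

Section MollifyPast.
Context {R : realType} {H : hilbertType R}.
Local Notation mu := (@lebesgue_measure R).

Lemma mollify_norm_le (r M : R) (k dk : R -> R) (u : R -> H) t :
  mollifier r k dk M -> past_integrable u ->
  `|mollify k u t| <= rmollify k (fun s => `|u s|) t.
Proof.
move=> km iu; have iku := kernel_bochner_integrable (mollifier_kernel km) t iu.
rewrite (le_trans (norm_bochner_integral_le iku))// /rmollify.
by under eq_Rintegral do rewrite normrZ ger0_norm ?(mollifier_ge0 km)//.
Qed.

Lemma mollify_past_integrable (r M : R) (k dk : R -> R) (u : R -> H) :
  mollifier r k dk M -> past_integrable u -> past_integrable (mollify k u).
Proof.
move=> km iu; have mk : strongly_measurable (mollify k u).
  apply: continuous_strongly_measurable.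
  exact: (mollify_continuous (mollifier_kernel km) iu).
split=> // T; have [mu_ iu'] := iu.
have mnu : measurable_fun setT (fun s => `|u s|) by exact: strongly_measurable_norm.
have inu T' : rintegrable (fun s => past T' s * `| `|u s| |).
  by under eq_fun do rewrite normr_id; exact: iu'.
have [iP _] := rmollify_past_le T km mnu (fun s => normr_ge0 (u s)) inu.
apply: le_rintegrable iP.
  apply: measurable_funM; first exact: measurable_past.
  exact: strongly_measurable_norm.
move=> s; rewrite ger0_norm ?mulr_ge0// ler_wpM2l//; exact: mollify_norm_le km iu.
Qed.

End MollifyPast.

Section RealFubini.
Context {R : realType}.
Local Notation mu := (@lebesgue_measure R).

(** Integrability on the plane is certified by [b], an integrable bound on the inner absolute
    integrals. *)
Lemma Rintegral_Fubini (F : R -> R -> R) (b : R -> R) :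
  measurable_fun setT (fun z : R * R => F z.1 z.2) ->
  (forall x, rintegrable (F x)) -> (forall y, rintegrable (F ^~ y)) ->
  (forall x, \int[mu]_y `|F x y| <= b x) -> rintegrable b ->
  rintegrable (fun x => \int[mu]_y F x y) /\
  \int[mu]_x \int[mu]_y F x y = \int[mu]_y \int[mu]_x F x y.
Proof.
move=> mF i1 i2 Fb ib.
pose G (z : R * R) : \bar R := (F z.1 z.2)%:E.
have mG : measurable_fun setT G by exact/measurable_EFinP.
have iG : (mu \x mu)%E.-integrable setT G.
  apply/integrable12ltyP => //.
  have b0 x : 0 <= b x by rewrite (le_trans _ (Fb x))// Rintegral_norm_ge0.
  have bE : (\int[mu]_x (b x)%:E < +oo)%E by rewrite -EFin_Rintegral// ltry.
  apply: le_lt_trans bE; apply: ge0_le_integral => //.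
  - by move=> x _; apply: integral_ge0.
  - apply: (@measurable_fun_fubini_tonelli_F _ _ _ _ _ mu (fun z => `|G z|%E)) => //.
    exact: measurableT_comp.
  - by apply/measurable_EFinP; case/rintegrableP : ib.
  - move=> x _; rewrite -[X in (X <= _)%E](_ : (\int[mu]_y `|F x y|)%:E = _).
      by rewrite lee_fin.
    by rewrite EFin_Rintegral//; exact: (integrable_norm (i1 x)).
have e1 x : (\int[mu]_y F x y)%:E = (\int[mu]_y G (x, y))%E by rewrite EFin_Rintegral.
have e2 y : (\int[mu]_x F x y)%:E = (\int[mu]_x G (x, y))%E by rewrite EFin_Rintegral.
split.
  have := integrable_fubini_F iG; rewrite /rintegrable /fubini_F.
  by apply: eq_integrable => // x _; rewrite /= e1.
rewrite /Rintegral.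
under eq_integral => x _ do rewrite [(fine _)%:E]e1.
under [in RHS]eq_integral => y _ do rewrite [(fine _)%:E]e2.
by rewrite (Fubini iG).
Qed.

End RealFubini.

(** * L^2 and essential supremum norms; essential support *)

Section LpNorms.
Context {R : realType} {W : normedModType R}.
Local Notation mu := (@lebesgue_measure R).
Implicit Types (g : R -> W) (D : set R).

(** The norm of exponent [+oo] is defined by cases on the positivity of the total measure. *)
Lemma lebesgue_measureT_gt0 : (0 < mu [set: R])%E.
Proof.
rewrite (@lt_le_trans _ _ (mu `[0, 1]%classic))//.
  by rewrite lebesgue_measure_itv/= lte_fin ltr01 sube0 lte_fin.
have m01 : measurable (`[0, 1]%classic : set R) by exact: measurable_itv.
exact: (le_measure mu (mem_set m01) (mem_set measurableT)).
Qed.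

Lemma LpNorm_oo_leP D g (c : R) : (LpNorm +oo D g <= c%:E)%E <->
  {ae mu, forall t, `|((fun t => `|g t|%:E) \_ D) t|%E <= c%:E}%E.
Proof.
rewrite /LpNorm unlock /= lebesgue_measureT_gt0.
by split=> [/ess_supP//|h]; apply/ess_supP.
Qed.

Lemma LpNorm2_sqr D g : (LpNorm 2%:E D g `^ 2 = \int[mu]_t (\1_D t * `|g t| ^+ 2)%:E)%E.
Proof.
rewrite /LpNorm poweR_Lnorm ?pnatr_eq0//; apply: eq_integral => t _.
rewrite patchE indicE; case: ifP => _ /=.
  by rewrite normr_id powR_mulrn// mul1r.
by rewrite normr0 powR0 ?pnatr_eq0// mul0r.
Qed.

Lemma LpNorm2_lty D g : (LpNorm 2%:E D g < +oo)%E <->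
  (\int[mu]_t (\1_D t * `|g t| ^+ 2)%:E < +oo)%E.
Proof.
rewrite -LpNorm2_sqr; split; first exact: poweR_lty.
case E: (LpNorm 2%:E D g) => [x| |]//; first by move=> _; exact: ltry.
by rewrite poweRyr ?pnatr_eq0.
Qed.

Lemma in_L2_rintegrable D g : measurable D -> in_Lp 2%:E D g ->
  rintegrable (fun t => \1_D t * `|g t| ^+ 2).
Proof.
move=> mD [mg /LpNorm2_lty gi]; apply/rintegrableP; split.
  apply: measurable_funM; first exact: measurable_indic.
  by apply: measurable_funX; exact: strongly_measurable_norm.
by under eq_integral do rewrite ger0_norm ?mulr_ge0 ?sqr_ge0//.
Qed.

(** Off the essential support, [g] vanishes almost everywhere near each point. Intervals with
    rational endpoints reduce the covering to a countable one, so that the exceptional sets have a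
    null union. *)
Lemma causal_vanishes g : causal g ->
  exists T, {ae mu, forall t, t < T -> g t = 0}.
Proof.
move=> [T gT]; exists T.
pose rat_itv (pq : rat * rat) : set R := `]ratr pq.1, ratr pq.2[%classic.
pose Z (pq : rat * rat) := {ae mu, forall s, rat_itv pq s -> g s = 0}.
have ae_n : {ae mu, forall t, forall n, forall pq, unpickle n = Some pq -> Z pq ->
    rat_itv pq t -> g t = 0}.
  apply: ae_foralln => n; case: (unpickle n) => [pq|]; last by exact: aeW.
  have [zpq|nz] := pselect (Z pq); last by apply: aeW => t _ [<-].
  by apply: (ae_imply zpq) => t h _ [<-].
apply: (ae_imply ae_n) => t ht tT.
have : ~ ess_support g t.
  by move=> /gT; rewrite /= in_itv/= andbT leNgt tT.
move=> /existsNP[U] /not_implyP[oU] /not_implyP[Ut] /contrapT gU.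
have [e e0 teU] : exists2 e : R, 0 < e & ball t e `<=` U.
  by move: oU; rewrite openE => /(_ t Ut) /nbhs_ballP[e e0 h]; exists e.
have h1 : t - e < t by rewrite gtrBl.
have h2 : t < t + e by rewrite ltrDl.
have [p] := rat_in_itvoo h1; have [q] := rat_in_itvoo h2.
rewrite !in_itv/= => /andP[q1 q2] /andP[p1 p2].
apply: (ht (pickle (p, q)) (p, q)); first exact: pickleK.
  apply: (ae_imply gU) => s hs; rewrite /rat_itv /= in_itv/= => /andP[s1 s2].
  apply: hs; apply: teU; rewrite -ball_normE /ball_ /= ltr_norml; apply/andP; split; lra.
by rewrite /rat_itv /= in_itv/= p2.
Qed.

End LpNorms.

(** * The pointwise bound on the memory kernel *)

Section Coefficients.
Context {R : realType} {H V : hilbertType R}.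
Local Notation mu := (@lebesgue_measure R).
Variables (iota P : {linear V -> H}).
Variables (Clow Cup CB CQ : R) (A B : 'B(H)) (Q : R -> 'B(H)).
Hypothesis coef : coef_class Clow Cup CB CQ A B Q.

Lemma coef_Q_measurable : strongly_measurable Q.
Proof. by have [] := coef_Q_L1 coef. Qed.

(** The norm bounds [Q] almost everywhere only. If it failed at some [t >= 0], continuity from the
    right would make it fail on []t, t + e[], which has positive measure. *)
Lemma coef_Q_le t : `|Q t| <= CQ.
Proof.
have CQ0 : 0 <= CQ.
  by rewrite -lee_fin (le_trans _ (coef_Q_bound coef))// adde_ge0// /LpNorm Lnorm_ge0.
have [t0|t0] := ltP t 0; first by rewrite (coef_Q_causal coef)// normr0.
have Qae : {ae mu, forall s, `|Q s| <= CQ}.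
  have h : (LpNorm +oo setT Q <= CQ%:E)%E.
    by rewrite (le_trans _ (coef_Q_bound coef))// leeDr// /LpNorm Lnorm_ge0.
  move/LpNorm_oo_leP : h => h; apply: (ae_imply h) => s.
  by rewrite patchE in_setT /= lee_fin normr_id.
rewrite leNgt; apply/negP => Qt.
have [N [mN N0 sN]] := Qae.
have /subspace_continuousP/(_ t) := coef_Q_continuous coef.
rewrite /= in_itv/= andbT => /(_ t0) /cvgrPdist_lt /(_ (`|Q t| - CQ)).
rewrite subr_gt0 => /(_ Qt) /nbhs_ballP[e /= e0 he].
have sub : `]t, t + e[%classic `<=` N.
  move=> s; rewrite /= in_itv/= => /andP[ts se]; apply: sN => /= h.
  have : `|Q t - Q s| < `|Q t| - CQ.
    apply: he; last by rewrite /= in_itv/= andbT (le_trans t0)// ltW.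
    by rewrite -ball_normE /ball_ /= ltr_norml; apply/andP; split; lra.
  by have := lerB_dist (Q t) (Q s); lra.
have : (mu `]t, (t + e)%R[%classic <= mu N)%E by apply: le_measure; rewrite ?inE.
rewrite N0 lebesgue_measure_itv/= lte_fin ltrDl e0 -EFinB lee_fin.
by rewrite addrAC subrr add0r leNgt e0.
Qed.

End Coefficients.

(** * Causal, locally square integrable functions *)

Section CausalL2loc.
Context {R : realType} {W : normedModType R}.
Local Notation mu := (@lebesgue_measure R).
Implicit Types (g : R -> W).

Lemma ae_eq_rintegrable (f h : R -> R) : measurable_fun setT f ->
  {ae mu, forall t, f t = h t} -> rintegrable h -> rintegrable f.
Proof.
move=> mf fh /rintegrableP[mh ih]; apply/rintegrableP; split => //.
have -> : (\int[mu]_t (`|f t|)%:E = \int[mu]_t (`|h t|)%:E)%E => //.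
apply: ae_eq_integral => //.
- by apply/measurable_EFinP; exact: measurableT_comp.
- by apply/measurable_EFinP; exact: measurableT_comp.
- by apply: (ae_imply fh) => t ->.
Qed.

Lemma in_L2loc_measurable g : in_L2loc g -> strongly_measurable g.
Proof. by move=> /(_ _ (@segment_compact R 0 0)) []. Qed.

(** Local integrability speaks of compact sets; vanishing before [T1] lets [[T1, T]] replace the
    half-line. *)
Lemma in_L2loc_past_sqr g (T1 : R) : in_L2loc g ->
  {ae mu, forall t, t < T1 -> g t = 0} ->
  forall T, rintegrable (fun t => past T t * `|g t| ^+ 2).
Proof.
move=> gL g0 T; have mg := in_L2loc_measurable gL.
have iK := in_L2_rintegrable (measurable_itv `[T1, T]) (gL _ (@segment_compact _ T1 T)).
apply: ae_eq_rintegrable iK.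
  apply: measurable_funM; first exact: measurable_past.
  by apply: measurable_funX; exact: strongly_measurable_norm.
apply: (ae_imply g0) => t gt; have [tT1|T1t] := ltP t T1.
  by rewrite gt// normr0 expr0n !mulr0.
congr (_ * _); rewrite /past indicE; congr ((nat_of_bool _)%:R).
by apply/idP/idP => [tT|]; [apply/mem_set|rewrite inE]; rewrite /= in_itv/= T1t.
Qed.

Lemma in_L2loc_past g (T1 : R) : in_L2loc g ->
  {ae mu, forall t, t < T1 -> g t = 0} ->
  forall T, rintegrable (fun t => past T t * `|g t|).
Proof.
move=> gL g0 T; have mg := in_L2loc_measurable gL.
have iK := in_L2_rintegrable (measurable_itv `[T1, T]) (gL _ (@segment_compact _ T1 T)).
have i1 : rintegrable (\1_(`[T1, T]%classic)).
  apply: rintegrable_indic => //.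
  by rewrite lebesgue_measure_itv/=; case: ifP => // _;
    rewrite -EFinB ltry.
have mn : measurable_fun setT (fun t => `|g t|) by exact: strongly_measurable_norm.
(* On the segment, of finite measure, [|g| <= 1 + |g| ^+ 2]. *)
have i2 : rintegrable (fun t => \1_(`[T1, T]%classic) t * `|g t|).
  apply: (le_rintegrable _ _ (rintegrableD i1 iK)).
    by apply: measurable_funM => //; exact: measurable_indic.
  move=> t; rewrite ger0_norm ?mulr_ge0// -[X in X + _]mulr1 -mulrDr ler_wpM2l//.
  by have := sqr_ge0 (`|g t| - 1); rewrite sqrrB; nra.
apply: ae_eq_rintegrable i2.
  by apply: measurable_funM => //; exact: measurable_past.
apply: (ae_imply g0) => t gt; have [tT1|T1t] := ltP t T1.
  by rewrite gt// normr0 !mulr0.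
congr (_ * _); rewrite /past indicE; congr ((nat_of_bool _)%:R).
by apply/idP/idP => [tT|]; [apply/mem_set|rewrite inE]; rewrite /= in_itv/= T1t.
Qed.

End CausalL2loc.

(** * The memory term and the mollified equation *)

Section Equation.
Context {R : realType} {H V : hilbertType R}.
Local Notation mu := (@lebesgue_measure R).
Variables (iota P : {linear V -> H}).
Variables (Clow Cup CB CQ : R) (A B : 'B(H)) (Q : R -> 'B(H)).
Hypothesis coef : coef_class Clow Cup CB CQ A B Q.
Implicit Types (u f w : R -> H) (t : R).

Let CQ0 : 0 <= CQ. Proof. by rewrite (le_trans _ (coef_Q_le coef 0)). Qed.

Lemma coef_Q_past t s x : `|Q (t - s) x| <= CQ * (past t s * `|x|).
Proof.
have [ts|st] := ltP t s.
  by rewrite (coef_Q_causal coef) ?subr_lt0// normr0 mulr_ge0// mulr_ge0.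
rewrite pastT// mul1r (le_trans (le_opnorm _ _))// ler_wpM2r//.
exact: (coef_Q_le coef).
Qed.

Lemma coef_Q_reflection_measurable t : strongly_measurable (fun s => Q (t - s)).
Proof.
exact: (strongly_measurable_comp (measurable_reflection t) (coef_Q_measurable coef)).
Qed.

Lemma convolution_bochner_integrable u t : past_integrable u ->
  bochner_integrable (fun s => Q (t - s) (u s)).
Proof.
move=> [mu_ iu]; apply: (le_bochner_integrable _ _ (rintegrableZ CQ (iu t))).
  by apply: strongly_measurable_bop => //; exact: coef_Q_reflection_measurable.
by move=> s; exact: coef_Q_past.
Qed.

Lemma convolution_norm_le u t : past_integrable u ->
  `|convolution Q u t| <= CQ * \int[mu]_s (past t s * `|u s|).
Proof.
move=> iu; have ii := convolution_bochner_integrable t iu.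
rewrite (le_trans (norm_bochner_integral_le ii))//.
rewrite -RintegralZl//; last exact: iu.2.
apply: le_Rintegral => //; first by case: ii.
  by apply: rintegrableZ; exact: iu.2.
by move=> s _; exact: coef_Q_past.
Qed.

Lemma convolutionB u w t : past_integrable u -> past_integrable w ->
  convolution Q (fun s => u s - w s) t = convolution Q u t - convolution Q w t.
Proof.
move=> iu iw; rewrite /convolution -bochner_integralB; last 2 first.
- exact: convolution_bochner_integrable t iu.
- exact: convolution_bochner_integrable t iw.
by congr bochner_integral; apply/funext => s; rewrite linearB.
Qed.

Section Mollified.
Variables (r M : R) (k dk : R -> R).
Hypothesis km : mollifier r k dk M.

(** The substitution of [t + s - x] for [x] exchanges the arguments of [k] and [Q]: the kernel that
    smoothed the test function now stands ready to smooth [u]. *)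
Lemma convolution_adj_inner u h t s :
  rintegrable (fun x => k (x - s) * inner (Q (t - x) h) (u s)) /\
  inner (u s) (convolution_adj Q (fun x => k (t - x) *: h) s) =
  \int[mu]_x (k (x - s) * inner (Q (t - x) h) (u s)).
Proof.
pose G x := Q (x - s) (k (t - x) *: h).
have ik := mollifier_reflection_rintegrable t km.
have mk : measurable_fun setT (fun x : R => k (t - x)) by case/rintegrableP : ik.
have mQ : strongly_measurable (fun x => Q (x - s)).
  apply: (@strongly_measurable_comp _ _ Q (fun x => x - s)); last exact: (coef_Q_measurable coef).
  exact: measurable_funB.
have iG : bochner_integrable G.
  apply: (le_bochner_integrable _ _ (rintegrableZ (CQ * `|h|) ik)).
    apply: strongly_measurable_bop => //; apply: strongly_measurable_scale => //.
    exact: strongly_measurable_cst.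
  move=> x; rewrite (le_trans (le_opnorm _ _))// normrZ ger0_norm ?(mollifier_ge0 km)//.
  by rewrite [k _ * _]mulrC mulrA ler_wpM2r ?(mollifier_ge0 km)// ler_wpM2r// (coef_Q_le coef).
have GE x : inner (G x) (u s) = k (t - x) * inner (Q (x - s) h) (u s).
  by rewrite /G linearZ /= innerZl.
have iGu := bochner_integrable_inner (u s) iG.
have kE x : k (t - (t + s - x)) * inner (Q (t + s - x - s) h) (u s) =
    k (x - s) * inner (Q (t - x) h) (u s) by congr (k _ * inner (Q _ h) _); ring.
have iGE : rintegrable (fun x => k (t - x) * inner (Q (x - s) h) (u s)).
  by move: iGu; under eq_fun do rewrite GE.
split; first by have := rintegrable_reflection (t + s) iGE; under eq_fun do rewrite kE.
rewrite innerC /convolution_adj bochner_integral_inner//.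
have -> : \int[mu]_x inner (Q (x - s) (k (t - x) *: h)) (u s) =
    \int[mu]_x (k (t - x) * inner (Q (x - s) h) (u s)).
  by apply: eq_Rintegral => x _; exact: GE.
rewrite -(@Rintegral_reflection _ (t + s) (fun x => k (t - x) * inner (Q (x - s) h) (u s))).
  by apply: eq_Rintegral => x _; exact: kE.
by case/rintegrableP : iGE.
Qed.

(** Fubini's theorem: integrating in [s] first produces [mollify k u x], and self-adjointness of
    [Q (t - x)] moves the operator onto it. This is how the memory commutes with mollification. *)
Lemma convolution_adj_integral u h t : past_integrable u ->
  rintegrable (fun s => inner (u s) (convolution_adj Q (fun x => k (t - x) *: h) s)) /\
  \int[mu]_s inner (u s) (convolution_adj Q (fun x => k (t - x) *: h) s) =
  inner (convolution Q (mollify k u) t) h.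
Proof.
move=> iu; have [mu_ iu'] := iu.
pose F s x := k (x - s) * inner (Q (t - x) h) (u s).
pose c := CQ * `|h|.
have c0 : 0 <= c by rewrite mulr_ge0.
have k0 x : 0 <= k x := mollifier_ge0 km x.
have mq : strongly_measurable (fun x => Q (t - x) h).
  apply: strongly_measurable_bop; first exact: coef_Q_reflection_measurable.
  exact: strongly_measurable_cst.
(* The integrand is nonzero only for [s < x <= t], by the support of [k] and the causality of [Q];
   hence the factor [past t s]. *)
have F_le s x : `|F s x| <= c * (past t s * `|u s|) * k (x - s).
  have [xs|sx] := leP x s.
    rewrite /F (mollifier_support km) ?mul0r ?mulr0 ?normr0//.
    by rewrite negb_and -leNgt subr_le0 xs.
  rewrite normrM ger0_norm// mulrC ler_wpM2r//.
  rewrite (le_trans (cauchy_schwarz _ _))//.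
  have [xt|tx] := leP x t.
    rewrite pastT ?mul1r; last by rewrite (le_trans (ltW sx)).
    by rewrite ler_wpM2r// (le_trans (le_opnorm _ _))// ler_wpM2r// (coef_Q_le coef).
  rewrite (coef_Q_causal coef) ?subr_lt0// normr0 mul0r mulr_ge0// mulr_ge0//.
have mk := mollifier_measurable km.
have mF : measurable_fun setT (fun z : R * R => F z.1 z.2).
  apply: measurable_funM.
    apply: (measurableT_comp mk).
    by apply: measurable_funB; [exact: measurable_snd|exact: measurable_fst].
  under eq_fun do rewrite innerC.
  exact: (measurable_inner_prod mu_ mq).
have i1 s : rintegrable (F s) by have [] := convolution_adj_inner u h t s.
have i2 x : rintegrable (F ^~ x).
  apply: (le_rintegrable _ _ (rintegrableZ M (rintegrableZ c (iu' t)))).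
    apply: measurable_funM.
      by apply: (measurableT_comp mk); exact: measurable_funB.
    by under eq_fun do rewrite innerC; apply: strongly_measurable_inner => //;
      exact: strongly_measurable_cst.
  move=> s; rewrite (le_trans (F_le s x))// mulrC ler_wpM2r ?(mollifier_le km)//.
  by rewrite !mulr_ge0.
have Fb s : \int[mu]_x `|F s x| <= c * (past t s * `|u s|).
  have ks : rintegrable (fun x => k (x - s)).
    apply/rintegrableP; split; first by apply: (measurableT_comp mk); exact: measurable_funB.
    under eq_integral do rewrite ger0_norm//.
    by rewrite (mollifier_shift_mass s km) ltry.
  have ksE : \int[mu]_x k (x - s) = 1.
    by rewrite /Rintegral (mollifier_shift_mass s km).
  rewrite (@le_trans _ _ (\int[mu]_x (c * (past t s * `|u s|) * k (x - s))))//.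
    apply: le_Rintegral => //; first exact: (integrable_norm (i1 s)).
    exact: rintegrableZ.
  by rewrite RintegralZl// ksE mulr1.
have [iF FE] := Rintegral_Fubini mF i1 i2 Fb (rintegrableZ c (iu' t)).
have adjE s : inner (u s) (convolution_adj Q (fun x => k (t - x) *: h) s) = \int[mu]_x F s x.
  by have [_] := convolution_adj_inner u h t s.
split; first by under eq_fun do rewrite adjE.
under eq_Rintegral do rewrite adjE.
rewrite FE /convolution bochner_integral_inner; last first.
  by apply: convolution_bochner_integrable; exact: (mollify_past_integrable km iu).
apply: eq_Rintegral => x _; rewrite (coef_Q_selfadjoint coef).
rewrite (mollify_inner (mollifier_kernel km))//.
by apply: eq_Rintegral => s _; rewrite /F [in RHS]innerC.
Qed.

End Mollified.

(** The equation in the strong sense at one time; [v] is [w t] viewed as an element of the domain of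
    [P]. *)
Definition solves_at (w dw g : R -> H) t := exists v,
  w t = iota v /\ A (dw t) + P v + B (w t) + convolution Q w t = g t.

Hypothesis P_skew : skew_adjoint iota P.

Lemma skew_inner v : inner (P v) (iota v) = 0.
Proof.
have : adjoint_graph iota P (iota v, - P v) by rewrite P_skew; exists v.
move=> /(_ v) /=; rewrite innerNr [inner (iota v) _]innerC; lra.
Qed.

Let weak_equation_inner (a b c d y h : H) :
  inner b y - inner a (A h) - inner b (adjoint B h) - inner c h = - inner d h ->
  inner y b = inner h (A a + B b + c - d).
Proof.
rewrite innerBr 2!innerDr -adjointE -(coef_A_selfadjoint coef).
rewrite (innerC (A a)) (innerC (B b)) (innerC c) (innerC d) (innerC b).
move: (inner h (A a)) (inner h (B b)) (inner h c) (inner h d) (inner y b).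
by move=> x1 x2 x3 x4 x5; lra.
Qed.

(* Testing with [s |-> k (t - s) *: v] puts the mollified solution in the domain
   of [P^*], which is the range of [iota]. *)
Lemma weak_solution_mollify (r M : R) (k dk : R -> R) f u t :
  mollifier r k dk M -> past_integrable f -> past_integrable u ->
  weak_solution iota P A B Q f u ->
  solves_at (mollify k u) (mollify dk u) (mollify k f) t.
Proof.
move=> km intf intu [_ weak].
have kk := mollifier_kernel km; have kd := mollifier_dkernel km.
(* By the expected equation, [z] should be [- P] of the mollified solution, which is its value under
   the adjoint of [P]. *)
pose z := A (mollify dk u t) + B (mollify k u t) + convolution Q (mollify k u) t
  - mollify k f t.
have : adjoint_graph iota P (mollify k u t, z).
  move=> v /=.
  pose h := iota v.
  have dphi s : derive1 (fun s => k (t - s) *: v) s = - dk (t - s) *: v.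
    have d1 : is_derive s 1 (fun y : R => t - y) (-1).
      by apply: (is_derive_eq (is_deriveB (is_derive_cst (t : R) s 1) (is_derive_id s 1)));
        rewrite sub0r.
    have d2 := @is_derive1_comp _ k (fun y => t - y) _ _ _ (mollifier_is_derive km (t - s)) d1.
    rewrite derive1E; have [_ ->] := is_derive_scalev v d2.
    by rewrite mulrN1.
  have := weak _ (mollifier_test km v t).
  have -> : - (\int[mu]_s inner (f s) (iota (k (t - s) *: v))) = - inner (mollify k f t) h.
    congr (- _); rewrite (mollify_inner kk)//; apply: eq_Rintegral => s _.
    by rewrite linearZ /= innerZr.
  have iotaE : iota \o (fun s => k (t - s) *: v) = fun s => k (t - s) *: h.
    by apply/funext => s; rewrite /= linearZ.
  rewrite iotaE.
  have [iR RE] := convolution_adj_integral km h t intu.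
  pose I1 s := dk (t - s) * inner (u s) (A h).
  pose I2 s := k (t - s) * inner (u s) (P v).
  pose I3 s := k (t - s) * inner (u s) (adjoint B h).
  pose I4 s := inner (u s) (convolution_adj Q (fun x => k (t - x) *: h) s).
  have ii c' (ck : kernel r c' M) y : rintegrable (fun s => c' (t - s) * inner (u s) y).
    have := bochner_integrable_inner y (kernel_bochner_integrable ck t intu).
    by under eq_fun do rewrite innerZl.
  have -> : \int[mu]_s inner (u s) (A (iota (derive1 (fun s => k (t - s) *: v) s)) +
      P (k (t - s) *: v) - adjoint B (iota (k (t - s) *: v)) -
      convolution_adj Q (fun x => k (t - x) *: h) s) =
      \int[mu]_s (I2 s - I1 s - I3 s - I4 s).
    apply: eq_Rintegral => s _; rewrite dphi.
    have e1 : inner (u s) (A (iota (- dk (t - s) *: v))) = - I1 s.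
      by rewrite linearZ [A _]linearZ innerZr mulNr.
    have e2 : inner (u s) (P (k (t - s) *: v)) = I2 s by rewrite linearZ innerZr.
    have e3 : inner (u s) (adjoint B (iota (k (t - s) *: v))) = I3 s.
      by rewrite /I3 -!adjointE linearZ innerZr.
    by rewrite 2!innerBr innerDr e1 e2 e3 [_ + I2 s]addrC.
  have i1 : rintegrable I1 by exact: ii.
  have i2 : rintegrable I2 by exact: ii.
  have i3 : rintegrable I3 by exact: ii.
  rewrite RintegralB//; last by do 2 (apply: rintegrableB => //).
  rewrite RintegralB//; last by apply: rintegrableB.
  rewrite RintegralB// RE.
  rewrite -!(mollify_inner kk)// -(mollify_inner kd)//.
  exact: weak_equation_inner.
rewrite P_skew => -[v _ [e1 e2]]; exists v; split=> //.
rewrite -[P v]opprK e2 /z opprB.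
move: (A _) (B _) (convolution _ _ _) (mollify k f t) => a b c d.
by rewrite -(addrA a b c) opprD (addrCA a) addNKr -addrA subrK.
Qed.

End Equation.

(** * Energy estimate *)

(* These do not assume measurability: the integral of a nonnegative function is
   a supremum over the simple functions below it. *)
Section LowerIntegral.
Import HBNNSimple.
Context d (T : measurableType d) (R : realType) (m : {measure set T -> \bar R}).

Lemma ge0_le_integral_lower (f g : T -> \bar R) :
  (forall t, 0 <= f t)%E -> (forall t, f t <= g t)%E ->
  (\int[m]_t f t <= \int[m]_t g t)%E.
Proof.
move=> f0 fg; have g0 t : (0 <= g t)%E by rewrite (le_trans (f0 t)).
rewrite !ge0_integralTE//; apply: le_ereal_sup => _ [h hf <-].
by exists h => // t; rewrite (le_trans (hf t)).
Qed.

Lemma ge0_integralZl_lower (c : R) (h : T -> \bar R) : 0 < c ->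
  (forall t, 0 <= h t)%E ->
  (\int[m]_t (c%:E * h t) <= c%:E * \int[m]_t h t)%E.
Proof.
move=> c0 h0; have ch0 t : (0 <= c%:E * h t)%E by rewrite mule_ge0// lee_fin ltW.
rewrite !ge0_integralTE//; apply: ge_ereal_sup => _ [s hs <-].
have i0 : 0 <= c^-1 by rewrite invr_ge0 ltW.
have -> : sintegral m s = (c%:E * sintegral m (scale_nnsfun s i0))%E.
  by rewrite sintegralrM muleA -EFinM mulfV ?gt_eqF// mul1e.
rewrite lee_pmul2l// ?lte_fin//; apply: ereal_sup_ubound; exists (scale_nnsfun s i0) => // t.
rewrite -(@lee_pmul2l _ c%:E)// ?lte_fin// /= -EFinM mulrA mulfV ?gt_eqF// mul1r.
exact: hs.
Qed.

End LowerIntegral.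

Section Energy.
Context {R : realType} {H V : hilbertType R}.
Local Notation mu := (@lebesgue_measure R).

Lemma is_derive_inner (x y : R -> H) (dx dy : H) (t : R) :
  is_derive t 1 x dx -> is_derive t 1 y dy ->
  is_derive t 1 (fun t => inner (x t) (y t)) (inner dx (y t) + inner (x t) dy).
Proof.
move=> dxt dyt.
have cy : y (h *: 1 + t) @[h --> 0^'] --> y t.
  have /differentiable_continuous cy : differentiable y t.
    by apply/derivable1_diffP; case: dyt.
  have : (h *: 1 + t : R) @[h --> (0 : R)^'] --> t.
    rewrite -[X in _ --> X]add0r -[X in X + _](scale0r (1 : R)).
    apply: cvgD; last exact: cvg_cst.
    by apply: cvgZr_tmp; apply: cvg_within.
  by move=> ht; apply: (continuous_cvg _ cy ht).
have cvgq (z : R -> H) dz : is_derive t 1 z dz ->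
    h^-1 *: (z (h *: 1 + t) - z t) @[h --> 0^'] --> dz.
  by move=> [/cvg_ex[l zl] <-]; rewrite /derive (cvg_lim _ zl).
suff cv : h^-1 *: (inner (x (h *: 1 + t)) (y (h *: 1 + t)) - inner (x t) (y t) : R^o)
    @[h --> 0^'] --> inner dx (y t) + inner (x t) dy.
  by apply: DeriveDef; [apply/cvg_ex; eexists; exact: cv|exact: cvg_lim cv].
have qE h : h^-1 *: (inner (x (h *: 1 + t)) (y (h *: 1 + t)) - inner (x t) (y t) : R^o) =
    inner (h^-1 *: (x (h *: 1 + t) - x t)) (y (h *: 1 + t)) +
    inner (x t) (h^-1 *: (y (h *: 1 + t) - y t)).
  rewrite innerZl innerZr innerBl innerBr /GRing.scale /=; ring.
under eq_cvg do rewrite qE.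
apply: cvgD; apply: inner_cvg => //; [exact: cvgq|exact: cvg_cst|exact: cvgq].
Qed.

Lemma is_derive_bop (A : 'B(H)) (x : R -> H) (dx : H) (t : R) :
  is_derive t 1 x dx -> is_derive t 1 (fun t => A (x t)) (A dx).
Proof.
move=> [/cvg_ex[l xl] dxE].
have cv : h^-1 *: (A (x (h *: 1 + t)) - A (x t)) @[h --> 0^'] --> A dx.
  rewrite -dxE /derive (cvg_lim _ xl)//.
  under eq_cvg do rewrite -linearB -linearZ.
  by apply: (continuous_cvg _ _ xl); exact: bop_continuous.
by apply: DeriveDef; [apply/cvg_ex; eexists; exact: cv|exact: cvg_lim cv].
Qed.

Lemma past_Rintegral (f : R -> R) t :
  \int[mu]_(s in `]-oo, t]) f s = \int[mu]_s (past t s * f s).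
Proof.
rewrite Rintegral_mkcond; apply: eq_Rintegral => s _; rewrite patchE /past.
have -> : (s \in `]-oo, t]%classic) = (s <= t).
  by apply/idP/idP => [|st]; [rewrite inE|apply/mem_set]; rewrite /= in_itv.
by case: ifP => _; rewrite ?mul1r ?mul0r.
Qed.

Lemma past_integrable_itv (f : R -> R) t : rintegrable (fun s => past t s * f s) ->
  mu.-integrable `]-oo, t] (EFin \o f).
Proof.
move=> fi; apply/integrable_mkcond => //.
apply: eq_integrable fi => // s _; rewrite patchE /past /=.
have -> : (s \in `]-oo, t]%classic) = (s <= t).
  by apply/idP/idP => [|st]; [rewrite inE|apply/mem_set]; rewrite /= in_itv.
by case: ifP => _; rewrite ?mul1r ?mul0r.
Qed.

Lemma is_derive_past (f : R -> R) (t : R) : continuous f ->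
  (forall T, rintegrable (fun s => past T s * f s)) ->
  is_derive t 1 (fun t => \int[mu]_s (past t s * f s)) (f t).
Proof.
move=> cf fi; have tt : t < t + 1 by rewrite ltrDl.
have [|d e] := (fun h => continuous_FTC1 tt (past_integrable_itv (fi (t + 1))) h (cf t)).
  exact: ltNyr.
rewrite (_ : (fun t => _) = (fun x => \int[mu]_(s in `]-oo, x]) f s)); last first.
  by apply/funext => x; rewrite past_Rintegral.
by apply: DeriveDef; [exact: d|rewrite -derive1E].
Qed.

Lemma is_derive_continuous (W : normedModType R) (f df : R -> W) :
  (forall t : R, is_derive t 1 f (df t)) -> continuous f.
Proof.
move=> fdf t; apply: differentiable_continuous; apply/derivable1_diffP.
by case: (fdf t).
Qed.

Lemma growth_le (Y dY c e : R -> R) (T1 t a : R) : T1 <= t ->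
  (forall s : R, is_derive s 1 Y (dY s)) -> continuous dY -> Y T1 = 0 ->
  (forall s, 0 <= c s) -> (forall s, 0 <= e s) ->
  (forall s, T1 <= s <= t -> dY s <= c s + e s) ->
  rintegrable (fun s => past t s * c s) ->
  (\int[mu]_s (past t s * e s)%:E <= a%:E)%E ->
  Y t <= \int[mu]_s (past t s * c s) + a.
Proof.
move=> T1t dYE cdY Y0 c0 e0 dY_le ic ea.
have a0 : 0 <= a.
  rewrite -lee_fin (le_trans _ ea)//; apply: integral_ge0 => s _.
  by rewrite lee_fin mulr_ge0.
have [T1t'|tT1] := ltP T1 t; last first.
  have -> : t = T1 by apply/eqP; rewrite eq_le tT1 T1t.
  by rewrite Y0 addr_ge0//; apply: Rintegral_ge0 => s _; rewrite mulr_ge0.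
pose I : set R := `[T1, t]%classic.
have mI : measurable I by exact: measurable_itv.
have cY := is_derive_continuous dYE.
have FTC : (\int[mu]_(s in I) (dY s)%:E = (Y t)%:E - (Y T1)%:E)%E.
  apply: continuous_FTC2 => //; first exact: continuous_subspaceT.
    split; first by move=> s _; case: (dYE s).
      by apply: cvg_at_right_filter; exact: cY.
    by apply: cvg_at_left_filter; exact: cY.
  by move=> s _; rewrite derive1E; case: (dYE s).
have iY : rintegrable (fun s => \1_I s * dY s).
  have iI := continuous_compact_integrable (@segment_compact R T1 t)
    (continuous_subspaceT cdY).
  have : mu.-integrable setT ((EFin \o dY) \_ I).
    by apply: (proj1 (integrable_mkcond _ _)); [exact: mI|exact: iI].
  rewrite /rintegrable.
  by apply: eq_integrable => // s _; rewrite /= patchE indicE;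
    case: ifP => _; rewrite ?mul1r ?mul0r.
have YE : Y t = \int[mu]_s (\1_I s * dY s).
  apply: EFin_inj; rewrite EFin_Rintegral// -[LHS]sube0 -[X in (_ - X)%E]/(0%:E) -Y0 -FTC.
  rewrite integral_mkcond; apply: eq_integral => s _; rewrite patchE indicE.
  by case: ifP => _; rewrite ?mul1r ?mul0r.
(* A measurable substitute for [e]: it lies below [past t * e], so its integral is at most [a], and
   it still dominates the excess of the derivative over [c]. *)
pose p s := Num.max (\1_I s * dY s - past t s * c s) 0.
have mp : measurable_fun setT p.
  by apply: measurable_maxr => //; case/rintegrableP : (rintegrableB iY ic).
have p0 s : 0 <= p s by rewrite le_max lexx orbT.
have pe s : p s <= past t s * e s.
  rewrite ge_max mulr_ge0// andbT lerBlDr -mulrDr indicE.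
  have [|_] := boolP (s \in I); last by rewrite mul0r mulr_ge0// addr_ge0.
  rewrite inE /I /= in_itv/= => sI; case/andP: (sI) => _ st.
  by rewrite pastT// !mul1r addrC dY_le.
have p_le : (\int[mu]_s (p s)%:E <= a%:E)%E.
  by apply: le_trans ea; apply: ge0_le_integral_lower => s; rewrite lee_fin.
have ip : rintegrable p.
  apply/rintegrableP; split => //; under eq_integral do rewrite ger0_norm//.
  by rewrite (le_lt_trans p_le)// ltry.
rewrite YE (@le_trans _ _ (\int[mu]_s (past t s * c s + p s)))//.
  apply: le_Rintegral => //; first exact: rintegrableD.
  by move=> s _; rewrite -lerBlDl le_max lexx.
rewrite RintegralD// lerD2l -lee_fin EFin_Rintegral//.
Qed.

Variables (iota P : {linear V -> H}).
Variables (Clow Cup CB CQ : R) (A B : 'B(H)) (Q : R -> 'B(H)).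
Hypothesis coef : coef_class Clow Cup CB CQ A B Q.
Hypothesis P_skew : skew_adjoint iota P.
Hypothesis Clow_gt0 : 0 < Clow.

(** Young's inequality bounds the derivative of the energy by [|g|^2 + (2 + 2 CB + CQ) |w|^2 + (CQ +
    1) S^2], where [S] is the integral of [|w|] up to the present. The term in [|w|^2] is absorbed
    by [inner (A w) w] at the price of division by [Clow]; the rate is the sum of the two resulting
    coefficients. *)
Definition energy_rate : R := (2 + 2 * CB + CQ) / Clow + CQ + 1.

(* The bound on the source is split because the convolution part of it, unlike
   [c], is not known to be measurable. *)
Lemma energy_estimate (w dw g : R -> H) (c e : R -> R) (T1 T a t : R) :
  (forall s : R, is_derive s 1 w (dw s)) -> continuous dw -> past_integrable w ->
  (forall s, s <= T1 -> w s = 0) ->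
  (forall s, solves_at iota P A B Q w dw g s) ->
  (forall s, s <= T -> `|g s| ^+ 2 <= c s + e s) ->
  (forall s, 0 <= c s) -> (forall s, 0 <= e s) ->
  rintegrable (fun s => past T s * c s) ->
  (\int[mu]_s (past T s * e s)%:E <= a%:E)%E ->
  T1 <= T -> t <= T ->
  Clow * `|w t| ^+ 2 <= expR (energy_rate * (T - T1)) * (\int[mu]_s (past T s * c s) + a).
Proof.
move=> dwE cdw iw w0 sol g_le c0 e0 ic ea T1T tT.
have CQ0 : 0 <= CQ by rewrite (le_trans _ (coef_Q_le coef 0)).
have CB0 : 0 <= CB by rewrite (le_trans _ (coef_B_bound coef)).
have a0 : 0 <= a.
  rewrite -lee_fin (le_trans _ ea)//; apply: integral_ge0 => s _.
  by rewrite lee_fin mulr_ge0.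
have rhs0 : 0 <= \int[mu]_s (past T s * c s) + a.
  by rewrite addr_ge0//; apply: Rintegral_ge0 => s _; rewrite mulr_ge0.
have [tT1|T1t] := leP t T1.
  by rewrite w0// normr0 expr0n mulr0 mulr_ge0// expR_ge0.
have K0 : 0 <= energy_rate.
  by rewrite /energy_rate !addr_ge0// divr_ge0 ?(ltW Clow_gt0)// !addr_ge0// mulr_ge0.
set K := energy_rate in K0 *.
have cw := is_derive_continuous dwE.
pose y s := `|w s|.
have cy : continuous y by move=> s; apply: cvg_norm; exact: cw.
pose S s := \int[mu]_x (past s x * y x).
have dS (s : R) : is_derive s 1 S (y s) := is_derive_past s cy iw.2.
have S0 s : 0 <= S s by apply: Rintegral_ge0 => x _; rewrite mulr_ge0 ?normr_ge0.
pose E s := inner (A (w s)) (w s).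
pose dE s := 2 * inner (A (dw s)) (w s).
have dEE (s : R) : is_derive s 1 E (dE s).
  apply: (is_derive_eq (is_derive_inner (is_derive_bop A (dwE s)) (dwE s))).
  by rewrite (coef_A_selfadjoint coef (w s)) [inner (w s) _]innerC /dE mulr_natl mulr2n.
have E_ge s : Clow * y s ^+ 2 <= E s.
  by have /andP[+ _] := coef_A_bounds coef (w s); rewrite inner_norm.
(* The term [S s ^+ 2] absorbs the memory term [convolution Q w], whose norm is at
   most [CQ * S s]. *)
pose Z s := E s + S s * S s.
pose dZ s := dE s + (S s * y s + S s * y s).
have dZE (s : R) : is_derive s 1 Z (dZ s).
  by apply: is_deriveD; exact: (is_deriveM (dS s) (dS s)).
(* Integrating factor: it is at most 1 after [T1], so it does not enlarge the source, and it is
   undone at the end at the price of [expR (K * (t - T1))]. *)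
pose psi s := expR (- K * (s - T1)).
have dpsi (s : R) : is_derive s 1 psi (- K * psi s).
  have d1 : is_derive s 1 (fun x : R => x - T1) 1.
    by apply: (is_derive_eq (is_deriveB (is_derive_id s 1) (is_derive_cst T1 s 1)));
      rewrite subr0.
  have d2 : is_derive s 1 (fun x : R => - K * (x - T1)) (- K).
    by apply: (is_derive_eq (is_deriveZ (- K) d1)); rewrite /GRing.scale /= mulr1.
  apply: (is_derive_eq (@is_derive1_comp _ expR _ _ _ _ (is_derive_expR _) d2)).
  by rewrite mulrC.
pose Y s := psi s * Z s.
pose dY s := psi s * dZ s + Z s * (- K * psi s).
have dYE (s : R) : is_derive s 1 Y (dY s) by exact: (is_deriveM (dpsi s) (dZE s)).
have cS := is_derive_continuous dS.
have cpsi := is_derive_continuous dpsi.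
have cZ := is_derive_continuous dZE.
have cAdw : continuous (fun s => inner (A (dw s)) (w s)).
  move=> s; apply: inner_cvg; last exact: cw.
  by apply: (continuous_cvg _ _ (cdw s)); exact: bop_continuous.
have cdZ : continuous dZ.
  move=> s; apply: cvgD; first by apply: cvgMr; exact: cAdw.
  by apply: cvgD; apply: cvgM; [exact: cS|exact: cy|exact: cS|exact: cy].
have cdY : continuous dY.
  move=> s; apply: cvgD; apply: cvgM; [exact: cpsi|exact: cdZ|exact: cZ|].
  by apply: cvgMr; exact: cpsi.
have S_T1 : S T1 = 0.
  rewrite /S (_ : (fun x => _) = fun=> 0) ?Rintegral_cst ?mul0r//.
  apply/funext => x; have [xT|Tx] := leP x T1; first by rewrite /y w0// normr0 mulr0.
  by rewrite past_gt// mul0r.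
have Y_T1 : Y T1 = 0.
  by rewrite /Y /Z S_T1 /E w0// inner0r mulr0 addr0 mulr0.
have dZ_le s : s <= T -> dZ s <= (c s + e s) + K * Z s.
  move=> sT; have [v [wv eqv]] := sol s.
  have eA : inner (A (dw s)) (w s) =
      inner (g s) (w s) - inner (B (w s)) (w s) - inner (convolution Q w s) (w s).
    have := skew_inner P_skew v; rewrite -wv -eqv 3!innerDl.
    by move: (inner (A _) _) (inner (B _) _) (inner (P v) _) (inner (convolution _ _ _) _);
      move=> x1 x2 x3 x4; lra.
  have b1 : inner (g s) (w s) <= `|g s| * y s by exact: le_inner.
  have b2 : - inner (B (w s)) (w s) <= CB * y s ^+ 2.
    rewrite -innerNl (le_trans (le_inner _ _))// normrN expr2 mulrA ler_wpM2r//.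
    by rewrite (le_trans (le_opnorm _ _))// ler_wpM2r// (coef_B_bound coef).
  have b3 : - inner (convolution Q w s) (w s) <= CQ * S s * y s.
    rewrite -innerNl (le_trans (le_inner _ _))// normrN ler_wpM2r//.
    exact: (convolution_norm_le coef).
  have g2 := g_le s sT.
  have h1 : (2 + 2 * CB + CQ) * y s ^+ 2 <= (2 + 2 * CB + CQ) / Clow * E s.
    rewrite -mulrA ler_wpM2l ?addr_ge0 ?mulr_ge0//.
    by rewrite -ler_pdivrMl ?invr_gt0// invrK.
  have E0 : 0 <= E s.
    by apply: le_trans (E_ge s); rewrite mulr_ge0 ?sqr_ge0 ?(ltW Clow_gt0).
  have k0 : 0 <= (2 + 2 * CB + CQ) / Clow.
    by rewrite divr_ge0 ?(ltW Clow_gt0)// !addr_ge0 ?mulr_ge0.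
  rewrite /dZ /dE eA /Z /K /energy_rate.
  move: k0 h1 b1 b2 b3 g2 (E0) (S0 s); set k := _ / Clow.
  move: (inner (g s) _) (inner (B _) _) (inner (convolution _ _ _) _) => i1 i2 i3.
  have := normr_ge0 (g s); have y0 : 0 <= y s by exact: normr_ge0.
  move: (`|g s|) (y s) y0 (S s) (E s) (c s + e s) => G z z0 s' E' ce G0 k0 h1 b1 b2 b3 g2 E'0 s'0.
  (* [q1], [q2] and [q3] are Young's inequality for the source, the derivative of [S ^+ 2] and the
     memory; [q4] and [q5] discard products left over in [K * Z s]. *)
  have q1 := sqr_ge0 (G - z).
  have q2 := sqr_ge0 (s' - z); have q3 : 0 <= CQ * (s' - z) ^+ 2 by rewrite mulr_ge0.
  have q4 : 0 <= k * (s' * s') := mulr_ge0 k0 (mulr_ge0 s'0 s'0).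
  have q5 : 0 <= CQ * E' by rewrite mulr_ge0.
  by clear -q1 q2 q3 q4 q5 h1 b1 b2 b3 g2 E'0; nra.
have dY_le s : T1 <= s <= t -> dY s <= c s + e s.
  move=> /andP[T1s st]; have dZs := dZ_le s (le_trans st tT).
  have psi1 : psi s <= 1.
    rewrite /psi -expR0 ler_expR mulNr oppr_le0 mulr_ge0//.
    by rewrite subr_ge0.
  have psi0 : 0 <= psi s by exact: expR_ge0.
  have -> : dY s = psi s * (dZ s - K * Z s) by rewrite /dY; ring.
  rewrite (@le_trans _ _ (psi s * (c s + e s)))//.
    by rewrite ler_wpM2l// lerBlDr.
  by rewrite ler_piMl ?addr_ge0.
have it : rintegrable (fun s => past t s * c s).
  apply: (le_rintegrable _ _ ic).
    have -> : (fun s => past t s * c s) = fun s => past t s * (past T s * c s).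
      apply/funext => s; rewrite mulrA; congr (_ * _); rewrite /past.
      by case: (leP s t) => st; rewrite ?mul0r// (le_trans st tT) mulr1.
    apply: measurable_funM; first exact: measurable_past.
    by case/rintegrableP : ic.
  by move=> s; rewrite ger0_norm ?mulr_ge0// ler_wpM2r// past_mono.
have et : (\int[mu]_s (past t s * e s)%:E <= a%:E)%E.
  apply: le_trans ea; apply: ge0_le_integral_lower => s; rewrite lee_fin ?mulr_ge0//.
  by rewrite ler_wpM2r// past_mono.
have Yt := growth_le (ltW T1t) dYE cdY Y_T1 c0 e0 dY_le it et.
have Yt' : Y t <= \int[mu]_s (past T s * c s) + a.
  rewrite (le_trans Yt)// lerD2r; apply: le_Rintegral => // s _.
  by rewrite ler_wpM2r// past_mono.
rewrite (le_trans (E_ge t))// (@le_trans _ _ (Z t))//.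
  by rewrite /Z lerDl mulr_ge0.
have -> : Z t = expR (K * (t - T1)) * Y t.
  by rewrite /Y /psi mulrA -expRD mulNr subrr expR0 mul1r.
rewrite (@le_trans _ _ (expR (K * (t - T1)) * (\int[mu]_s (past T s * c s) + a)))//.
  by rewrite ler_wpM2l// expR_ge0.
by rewrite ler_wpM2r// ler_expR ler_wpM2l// lerD2r.
Qed.

End Energy.

(** * Stability of solutions *)

Section Stability.
Context {R : realType} {H V : hilbertType R}.
Local Notation mu := (@lebesgue_measure R).
Variables (iota P : {linear V -> H}) (Clow Cup CB CQ : R).
Hypothesis P_skew : skew_adjoint iota P.
Hypothesis Clow_gt0 : 0 < Clow.

Lemma solves_atB (A B : 'B(H)) (Q : R -> 'B(H)) (w1 dw1 g1 w2 dw2 g2 : R -> H) t :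
  coef_class Clow Cup CB CQ A B Q -> past_integrable w1 -> past_integrable w2 ->
  solves_at iota P A B Q w1 dw1 g1 t -> solves_at iota P A B Q w2 dw2 g2 t ->
  solves_at iota P A B Q (fun s => w1 s - w2 s) (fun s => dw1 s - dw2 s)
    (fun s => g1 s - g2 s) t.
Proof.
move=> coef i1 i2 [v1 [e1 q1]] [v2 [e2 q2]]; exists (v1 - v2); split.
  by rewrite e1 e2 linearB.
rewrite (convolutionB coef)// -q1 -q2 [A _]linearB [P _]linearB [B _]linearB.
have addB (a b c d : H) : a - b + (c - d) = a + c - (b + d) by rewrite opprD addrACA.
by rewrite 3!addB.
Qed.

(** For a self-adjoint operator the bound on the quadratic form bounds the norm: the form is
    nonnegative at [x - Cup^-1 *: A x], and its upper bound is used at [x] and at [A x]. *)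
Lemma coef_A_le (A B : 'B(H)) (Q : R -> 'B(H)) x :
  coef_class Clow Cup CB CQ A B Q -> `|A x| <= Cup * `|x|.
Proof.
move=> coef; have sA := coef_A_selfadjoint coef; have bA := coef_A_bounds coef.
have A0 y : 0 <= inner (A y) y.
  have /andP[+ _] := bA y; apply: le_trans.
  by rewrite inner_norm mulr_ge0 ?sqr_ge0// ltW.
have [->|x0] := eqVneq x 0; first by rewrite linear0 !normr0 mulr0.
have Cup0 : 0 < Cup.
  rewrite (lt_le_trans Clow_gt0)//; have /andP[h1 h2] := bA x.
  have xx : 0 < inner x x by rewrite inner_norm exprn_gt0// normr_gt0.
  by rewrite -(ler_pM2r xx) (le_trans h1).
have quad y (a : R) : 0 <= inner (A x) x + a * (2 * inner (A x) y) + a ^+ 2 * inner (A y) y.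
  have AE : A (x + a *: y) = A x + a *: A y by rewrite linearD linearZ.
  have := A0 (x + a *: y); rewrite AE.
  have : inner (A y) x = inner (A x) y by rewrite sA innerC.
  move: (A x) (A y) => Ax Ay e; rewrite innerDl !innerDr !innerZl !innerZr e; lra.
have /andP[_ p_le] := bA x; have /andP[_ r_le] := bA (A x).
have := quad (A x) (- Cup^-1); move: p_le r_le; rewrite !inner_norm.
move: (inner (A x) x) (inner (A (A x)) (A x)) => p r p_le r_le h.
rewrite -(@ler_pXn2r _ 2)// ?nnegrE ?mulr_ge0 ?(ltW Cup0)// exprMn.
move: (`|A x| ^+ 2) (`|x| ^+ 2) p_le r_le h => q n p_le r_le.
rewrite sqrrN => h.
have i0 : 0 < Cup^-1 by rewrite invr_gt0.
have r_le' : Cup^-1 ^+ 2 * r <= Cup^-1 * q.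
  rewrite expr2 -mulrA ler_wpM2l ?(ltW i0)// -ler_pdivlMl// invrK//.
have q_le : Cup^-1 * q <= Cup * n by lra.
by move: q_le; rewrite ler_pdivrMl// expr2 mulrA.
Qed.

Lemma coef_B_le (A B : 'B(H)) (Q : R -> 'B(H)) x :
  coef_class Clow Cup CB CQ A B Q -> `|B x| <= CB * `|x|.
Proof.
move=> coef; rewrite (le_trans (le_opnorm B x))// ler_wpM2r//.
exact: (coef_B_bound coef).
Qed.

Lemma bopB_sqr_le (D E : 'B(H)) (c : R) x : `|D x| <= c * `|x| -> `|E x| <= c * `|x| ->
  `|(D - E) x| ^+ 2 <= (2 * c) ^+ 2 * `|x| ^+ 2.
Proof.
move=> hD hE; have c0 : 0 <= c * `|x| by rewrite (le_trans _ hD).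
have c20 : 0 <= 2 * (c * `|x|) by rewrite mulr_ge0.
rewrite bopBE -exprMn -mulrA; apply: lerXn2r; rewrite ?nnegrE//.
by rewrite (le_trans (ler_normB _ _))// mulr_natl mulr2n lerD.
Qed.

Lemma norm_add3_sqr_le (x y z : H) :
  `|x + y + z| ^+ 2 <= 3 * `|x| ^+ 2 + 3 * `|y| ^+ 2 + 3 * `|z| ^+ 2.
Proof.
have n0 (v : H) := normr_ge0 v.
have : `|x + y + z| ^+ 2 <= (`|x| + `|y| + `|z|) ^+ 2.
  rewrite lerXn2r ?nnegrE ?addr_ge0//.
  by rewrite (le_trans (ler_normD _ _))// lerD2r ler_normD.
move/le_trans; apply; move: `|x| `|y| `|z| => a b c.
have := sqr_ge0 (a - b); have := sqr_ge0 (b - c); have := sqr_ge0 (a - c); nra.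
Qed.

(** The same [v] serves both equations, so the unbounded term cancels and only differences of
    bounded coefficients enter the source. *)
Lemma solves_at_perturb (A B A' B' : 'B(H)) (Q Q' : R -> 'B(H)) w dw g t :
  solves_at iota P A B Q w dw g t ->
  solves_at iota P A' B' Q' w dw (fun s => g s + ((A' - A) (dw s) + (B' - B) (w s)
    + (convolution Q' w s - convolution Q w s))) t.
Proof.
move=> [v [e1 e2]]; exists v; split=> //; rewrite -e2 !bopBE.
move: (A _) (A' _) (B _) (B' _) (P v) (convolution Q' w t) (convolution Q w t).
move=> a a' b b' p r' r.
rewrite [RHS]addrACA (addrC r) subrK addrACA (addrC b) subrK.
by rewrite [a + p + _]addrAC (addrC a) subrK.
Qed.

Lemma past_integrableB (w1 w2 : R -> H) : past_integrable w1 -> past_integrable w2 ->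
  past_integrable (fun s => w1 s - w2 s).
Proof.
move=> [m1 i1] [m2 i2]; have m12 := strongly_measurableB m1 m2; split=> // T.
apply: (le_rintegrable _ _ (rintegrableD (i1 T) (i2 T))).
  apply: measurable_funM; first exact: measurable_past.
  exact: strongly_measurable_norm.
move=> s; rewrite ger0_norm ?mulr_ge0// -mulrDr ler_wpM2l//.
exact: ler_normB.
Qed.

Lemma continuous_past_rintegrable (h : R -> R) (T1 T : R) : continuous h ->
  (forall t, t <= T1 -> h t = 0) -> rintegrable (fun t => past T t * h t).
Proof.
move=> ch h0.
pose I : set R := `[T1, T]%classic.
have mI : measurable I by exact: measurable_itv.
have iI := continuous_compact_integrable (@segment_compact R T1 T) (continuous_subspaceT ch).
have : mu.-integrable setT ((EFin \o h) \_ I).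
  by apply: (proj1 (integrable_mkcond _ _)); [exact: mI|exact: iI].
rewrite /rintegrable; apply: eq_integrable => // s _.
rewrite patchE /past /=; have [sT1|T1s] := leP s T1.
  by rewrite (h0 s)// mulr0; case: ifP.
have -> : (s \in I) = (s <= T).
  by apply/idP/idP => [|sT]; [rewrite inE|apply/mem_set]; rewrite /I /= in_itv/= (ltW T1s).
by case: ifP => _; rewrite ?mul1r ?mul0r.
Qed.

Lemma continuous_norm_sqr (w : R -> H) : continuous w ->
  continuous (fun t => `|w t| ^+ 2).
Proof.
move=> cw; have -> : (fun t => `|w t| ^+ 2) = fun t => `|w t| * `|w t|.
  by apply/funext => t; rewrite expr2.
by move=> t; apply: cvgM; apply: cvg_norm; exact: cw.
Qed.

Lemma Rintegral_comb (x y : R) (a b : R -> R) : rintegrable a -> rintegrable b ->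
  \int[mu]_s (x * a s + y * b s) = x * \int[mu]_s a s + y * \int[mu]_s b s.
Proof.
move=> ia ib; rewrite RintegralD ?RintegralZl//; exact: rintegrableZ.
Qed.

Lemma sqr_dist_le (x y z : H) :
  `|x - y| ^+ 2 <= 2 * `|x - z| ^+ 2 + 2 * `|y - z| ^+ 2.
Proof.
rewrite -parallelogram (_ : x - z - (y - z) = x - y); last by rewrite opprB addrA subrK.
by rewrite lerDr sqr_ge0.
Qed.

Lemma past_sqr_in_L2plus (w : R -> H) : strongly_measurable w ->
  (forall T, rintegrable (fun t => past T t * `|w t| ^+ 2)) -> in_L2plus w.
Proof.
move=> mw iw.
have key (D : set R) T : D `<=` `]-oo, T] -> in_Lp 2%:E D w.
  move=> DT; split=> //; apply/LpNorm2_lty.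
  have /rintegrableP[_] := iw T; apply: le_lt_trans.
  apply: ge0_le_integral_lower => t; first by rewrite lee_fin mulr_ge0 ?sqr_ge0.
  rewrite lee_fin [leRHS]ger0_norm ?mulr_ge0 ?sqr_ge0// ler_wpM2r ?sqr_ge0// indicE.
  have [|_] := boolP (t \in D); last exact: past_ge0.
  by rewrite inE => /DT; rewrite /= in_itv/= => tT; rewrite pastT.
split=> [K cK|T]; last exact: (key _ T).
have [N [_ hN]] := compact_bounded cK; apply: (key _ (`|N| + 1)) => t Kt.
rewrite /= in_itv/=; have := hN (`|N| + 1); rewrite (le_lt_trans (ler_norm N)) ?ltrDl//.
by move=> /(_ isT t Kt); apply: le_trans; exact: ler_norm.
Qed.

Variables (k dk : nat -> R -> R) (M : nat -> R) (C : R).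
Hypothesis km : forall n, mollifier n.+1%:R^-1 (k n) (dk n) (M n).
Hypothesis kC : forall n x, k n x <= C * n.+1%:R.
Variables (f : R -> H) (Tf : R).
Hypothesis f_past : past_integrable f.
Hypothesis f_past2 : forall T, rintegrable (fun s => past T s * `|f s| ^+ 2).
Hypothesis f_vanishes : {ae mu, forall t, t < Tf -> f t = 0}.

(** It involves the source alone, whence the uniformity in [m] of the distance to the mollified
    solutions. *)
Definition source_error T n := \int[mu]_t (past T t * `|mollify (k n) f t - f t| ^+ 2).

Let mollify_f_sqr_integrable n T :
  rintegrable (fun t => past T t * `|mollify (k n) f t - f t| ^+ 2).
Proof.
have kk := mollifier_kernel (km n).
have cf := mollify_continuous kk f_past.
have i1 : rintegrable (fun t => past T t * `|mollify (k n) f t| ^+ 2).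
  apply: (@continuous_past_rintegrable (fun t => `|mollify (k n) f t| ^+ 2) Tf).
    exact: continuous_norm_sqr.
  by move=> t tT; rewrite (mollify_vanishes kk f_past f_vanishes)// normr0 expr0n.
apply: (le_rintegrable _ _ (rintegrableD (rintegrableZ 2 i1) (rintegrableZ 2 (f_past2 T)))).
  apply: measurable_funM; first exact: measurable_past.
  apply: measurable_funX; apply: strongly_measurable_norm.
  by apply: strongly_measurableB; [exact: continuous_strongly_measurable|case: f_past].
move=> t; rewrite ger0_norm ?mulr_ge0 ?sqr_ge0//.
have E (p a b : R) : 2 * (p * a) + 2 * (p * b) = p * (2 * a + 2 * b) by ring.
by rewrite E ler_wpM2l// -parallelogram lerDr sqr_ge0.
Qed.

Section Solution.
Variables (A B : 'B(H)) (Q : R -> 'B(H)) (u : R -> H) (Tu : R).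
Hypothesis coef : coef_class Clow Cup CB CQ A B Q.
Hypothesis u_past : past_integrable u.
Hypothesis u_vanishes : {ae mu, forall t, t < Tu -> u t = 0}.
Hypothesis u_weak : weak_solution iota P A B Q f u.

Lemma mollify_solves n t :
  solves_at iota P A B Q (mollify (k n) u) (mollify (dk n) u) (mollify (k n) f) t.
Proof. exact: (weak_solution_mollify coef P_skew t (km n) f_past u_past u_weak). Qed.

Lemma mollify_is_derive n (t : R) : is_derive t 1 (mollify (k n) u) (mollify (dk n) u t).
Proof. exact: (is_derive_mollify t (km n) u_past). Qed.

Lemma mollify_dcontinuous n : continuous (mollify (dk n) u).
Proof. exact: (mollify_continuous (mollifier_dkernel (km n)) u_past). Qed.

(* The source vanishes before [Tf], and the energy estimate does the rest. *)
Lemma mollify_solution_vanishes n t : t <= Tf -> mollify (k n) u t = 0.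
Proof.
move=> tT.
have kk := mollifier_kernel (km n).
pose T1 := Num.min Tu Tf.
have T1T : T1 <= Tf by rewrite ge_min lexx orbT.
have w0 s : s <= T1 -> mollify (k n) u s = 0.
  by rewrite le_min => /andP[sT _]; exact: (mollify_vanishes kk u_past u_vanishes).
have z0 T : (fun s => past T s * 0) = fun=> 0 :> R by apply/funext => s; rewrite mulr0.
have ic : rintegrable (fun s => past Tf s * 0) by rewrite z0; exact: rintegrable0.
have ea : (\int[mu]_s (past Tf s * 0)%:E <= 0%:E)%E.
  by rewrite (eq_integral (fun=> 0%E)) ?integral0// => s _; rewrite mulr0.
have g0 s : s <= Tf -> `|mollify (k n) f s| ^+ 2 <= 0 + 0.
  by move=> sT; rewrite (mollify_vanishes kk f_past f_vanishes)// normr0 expr0n addr0.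
have := energy_estimate coef P_skew Clow_gt0 (mollify_is_derive n) (@mollify_dcontinuous n)
  (mollify_past_integrable (km n) u_past) w0 (mollify_solves n) g0
  (fun=> lexx 0) (fun=> lexx 0) ic ea T1T tT.
rewrite z0 Rintegral_cst// mul0r addr0 mulr0 pmulr_rle0// => h.
by apply/eqP; rewrite -normr_eq0 -sqrf_eq0 eq_le h sqr_ge0.
Qed.

(** [u] is not known to be differentiable, so the energy estimate is applied to the difference of
    the mollifications of indices [j] and [n], with source the difference of the mollified [f]; then
    [j] tends to infinity at almost every [t]. Starting the estimate at [Tf] keeps the exponential
    independent of the solution. *)
Lemma mollify_solution_dist n T : separable H -> Tf <= T ->
  {ae mu, forall t, t <= T -> Clow * `|u t - mollify (k n) u t| ^+ 2 <=
    expR (energy_rate Clow CB CQ * (T - Tf)) * (2 * source_error T n)}.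
Proof.
move=> sH TfT.
have key j t : t <= T -> Clow * `|mollify (k j) u t - mollify (k n) u t| ^+ 2 <=
    expR (energy_rate Clow CB CQ * (T - Tf)) *
      (2 * source_error T j + 2 * source_error T n).
  move=> tT.
  pose c s := 2 * `|mollify (k j) f s - f s| ^+ 2 + 2 * `|mollify (k n) f s - f s| ^+ 2.
  have cE : (fun s => past T s * c s) = fun s =>
      2 * (past T s * `|mollify (k j) f s - f s| ^+ 2) +
      2 * (past T s * `|mollify (k n) f s - f s| ^+ 2).
    have E (p a b : R) : p * (2 * a + 2 * b) = 2 * (p * a) + 2 * (p * b) by ring.
    by apply/funext => s; exact: E.
  have i1 := rintegrableZ 2 (mollify_f_sqr_integrable j T).
  have i2 := rintegrableZ 2 (mollify_f_sqr_integrable n T).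
  have ic : rintegrable (fun s => past T s * c s) by rewrite cE; exact: rintegrableD.
  have icE : \int[mu]_s (past T s * c s) = 2 * source_error T j + 2 * source_error T n.
    rewrite cE.
    exact: (Rintegral_comb 2 2 (mollify_f_sqr_integrable j T) (mollify_f_sqr_integrable n T)).
  have ea : (\int[mu]_s (past T s * 0)%:E <= 0%:E)%E.
    by rewrite (eq_integral (fun=> 0%E)) ?integral0// => s _; rewrite mulr0.
  have c0 s : 0 <= c s by rewrite addr_ge0 ?mulr_ge0 ?sqr_ge0.
  have g_le s : s <= T -> `|mollify (k j) f s - mollify (k n) f s| ^+ 2 <= c s + 0.
    by move=> _; rewrite addr0; exact: sqr_dist_le.
  have pj := mollify_past_integrable (km j) u_past.
  have pn := mollify_past_integrable (km n) u_past.
  have sol s := solves_atB coef pj pn (mollify_solves j s) (mollify_solves n s).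
  have cdw : continuous (fun s => mollify (dk j) u s - mollify (dk n) u s).
    by move=> s; apply: cvgB; exact: mollify_dcontinuous.
  have dm (s : R) := is_deriveB (mollify_is_derive j s) (mollify_is_derive n s).
  have v0 s : s <= Tf -> mollify (k j) u s - mollify (k n) u s = 0.
    by move=> sT; rewrite (mollify_solution_vanishes j sT) (mollify_solution_vanishes n sT) subrr.
  have := (@energy_estimate _ _ _ iota P Clow Cup CB CQ A B Q coef P_skew Clow_gt0
    _ _ _ c (fun=> 0) Tf T 0 t dm cdw (past_integrableB pj pn) v0 sol g_le c0
    (fun=> lexx 0) ic ea TfT tT).
  by rewrite icE addr0.
apply: (ae_imply (mollify_cvg_ae km kC u_past sH)) => t ut tT.
have e0 : source_error T j @[j --> \oo] --> (0 : R).
  exact: (mollify_L2_cvg km kC f_past f_past2 T sH).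
have lim1 : Clow * `|mollify (k j) u t - mollify (k n) u t| ^+ 2 @[j --> \oo] -->
    Clow * `|u t - mollify (k n) u t| ^+ 2.
  rewrite expr2; under eq_cvg do rewrite expr2.
  by apply: cvgMr; apply: cvgM; apply: cvg_norm; apply: cvgB => //; exact: cvg_cst.
have lim2 : expR (energy_rate Clow CB CQ * (T - Tf)) *
      (2 * source_error T j + 2 * source_error T n) @[j --> \oo] -->
    expR (energy_rate Clow CB CQ * (T - Tf)) * (2 * 0 + 2 * source_error T n).
  by apply: cvgMr; apply: cvgD; [exact: cvgMr|exact: cvg_cst].
rewrite mulr0 add0r in lim2.
by apply: (ler_cvg_to lim1 lim2); apply: nearW => j; exact: key.
Qed.

Lemma mollify_sqr_past (c : nat -> R -> R) (Mc : nat -> R) n T :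
  (forall n, kernel n.+1%:R^-1 (c n) (Mc n)) ->
  rintegrable (fun t => past T t * `|mollify (c n) u t| ^+ 2).
Proof.
move=> ck; apply: (@continuous_past_rintegrable (fun t => `|mollify (c n) u t| ^+ 2) Tu).
  by apply: continuous_norm_sqr; exact: (mollify_continuous (ck n) u_past).
by move=> t tT; rewrite (mollify_vanishes (ck n) u_past u_vanishes)// normr0 expr0n.
Qed.

End Solution.

(** * Perturbation of the coefficients at a fixed mollification scale *)

Section Comparison.
Variables (A_ B_ : nat -> 'B(H)) (Q_ : nat -> R -> 'B(H)).
Variables (A B : 'B(H)) (Q : R -> 'B(H)).
Hypothesis coef_m : forall m, coef_class Clow Cup CB CQ (A_ m) (B_ m) (Q_ m).
Hypothesis coef : coef_class Clow Cup CB CQ A B Q.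
Hypothesis A_cvg : forall w : H, `|(A_ m - A) w| @[m --> \oo] --> (0 : R).
Hypothesis B_cvg : forall w : H, `|(B_ m - B) w| @[m --> \oo] --> (0 : R).
Hypothesis R_cvg : forall (T : R) (w : R -> H), in_L2plus w ->
  LpNorm 2%:E `]-oo, T] (convolution (Q_ m) w - convolution Q w) @[m --> \oo] --> 0%E.
Variables (u_ : nat -> R -> H) (u : R -> H) (Tu_ : nat -> R) (Tu : R).
Hypothesis um_past : forall m, past_integrable (u_ m).
Hypothesis u_past : past_integrable u.
Hypothesis um_vanishes : forall m, {ae mu, forall t, t < Tu_ m -> u_ m t = 0}.
Hypothesis u_vanishes : {ae mu, forall t, t < Tu -> u t = 0}.
Hypothesis um_weak : forall m, weak_solution iota P (A_ m) (B_ m) (Q_ m) f (u_ m).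
Hypothesis u_weak : weak_solution iota P A B Q f u.

Let w n := mollify (k n) u.
Let dw n := mollify (dk n) u.

(** The measurable part of the perturbed source, with the constants of [norm_add3_sqr_le]; the
    memory part is treated apart. *)
Let defect n m t := 3 * `|(A_ m - A) (dw n t)| ^+ 2 + 3 * `|(B_ m - B) (w n t)| ^+ 2.

Let defect_ge0 n m t : 0 <= defect n m t.
Proof. by rewrite addr_ge0 ?mulr_ge0 ?sqr_ge0. Qed.

(** A majorant independent of [m], as dominated convergence requires; it comes from the bounds
    common to the class. *)
Let defect_le n m t : defect n m t <=
  3 * (2 * Cup) ^+ 2 * `|dw n t| ^+ 2 + 3 * (2 * CB) ^+ 2 * `|w n t| ^+ 2.
Proof.
have hA := bopB_sqr_le (coef_A_le (dw n t) (coef_m m)) (coef_A_le (dw n t) coef).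
have hB := bopB_sqr_le (coef_B_le (w n t) (coef_m m)) (coef_B_le (w n t) coef).
rewrite -(mulrA 3 ((2 * Cup) ^+ 2)) -(mulrA 3 ((2 * CB) ^+ 2)).
exact: lerD (ler_wpM2l _ hA) (ler_wpM2l _ hB).
Qed.

Lemma defect_integral_cvg n T :
  (forall m, rintegrable (fun t => past T t * defect n m t)) /\
  \int[mu]_t (past T t * defect n m t) @[m --> \oo] --> (0 : R).
Proof.
have ik := mollifier_kernel (km n); have idk := mollifier_dkernel (km n).
have cw : continuous (w n) := mollify_continuous ik u_past.
have cdw : continuous (dw n) := mollify_continuous idk u_past.
pose bd t := past T t *
  (3 * (2 * Cup) ^+ 2 * `|dw n t| ^+ 2 + 3 * (2 * CB) ^+ 2 * `|w n t| ^+ 2).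
have ibd : rintegrable bd.
  have i1 := mollify_sqr_past u_past u_vanishes n T (fun n => mollifier_dkernel (km n)).
  have i2 := mollify_sqr_past u_past u_vanishes n T (fun n => mollifier_kernel (km n)).
  have := rintegrableD (rintegrableZ (3 * (2 * Cup) ^+ 2) i1) (rintegrableZ (3 * (2 * CB) ^+ 2) i2).
  have E (p a b c d : R) : a * (p * b) + c * (p * d) = p * (a * b + c * d) by ring.
  by congr rintegrable; apply/funext => t; exact: E.
have md m : measurable_fun setT (fun t => past T t * defect n m t).
  have cop (D : 'B(H)) (v : R -> H) : continuous v ->
      measurable_fun setT (fun t => `|D (v t)| ^+ 2).
    move=> cv; apply: measurable_funX; apply: strongly_measurable_norm.
    apply: continuous_strongly_measurable => t.
    by apply: (continuous_cvg _ _ (cv t)); exact: bop_continuous.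
  apply: measurable_funM; first exact: measurable_past.
  apply: measurable_funD; apply: measurable_funM; try exact: measurable_cst.
    exact: cop cdw.
  exact: cop cw.
have le_bd m t : `|past T t * defect n m t| <= bd t.
  by rewrite ger0_norm ?mulr_ge0// /bd ler_wpM2l.
split=> [m|]; first exact: le_rintegrable (md m) (le_bd m) ibd.
rewrite -[X in _ --> X](_ : \int[mu]_t 0 = 0); last by rewrite Rintegral_cst// mul0r.
apply: (Rintegral_dominated_cvg md (measurable_cst _) _ ibd le_bd).
apply: aeW => t.
have A0 := A_cvg (dw n t); have B0 := B_cvg (w n t).
have lim0 : past T t * (3 * (`|(A_ m - A) (dw n t)| * `|(A_ m - A) (dw n t)|) +
    3 * (`|(B_ m - B) (w n t)| * `|(B_ m - B) (w n t)|)) @[m --> \oo] -->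
    past T t * (3 * (0 * 0) + 3 * (0 * 0)).
  apply: cvgMr; apply: cvgD; apply: cvgMr; first exact: (cvgM A0 A0).
  exact: (cvgM B0 B0).
rewrite !mulr0 addr0 mulr0 in lim0.
have E (p x y : R) : p * (3 * x ^+ 2 + 3 * y ^+ 2) = p * (3 * (x * x) + 3 * (y * y)).
  by rewrite !expr2.
rewrite /defect; have -> : (fun m => past T t * (3 * `|(A_ m - A) (dw n t)| ^+ 2 +
    3 * `|(B_ m - B) (w n t)| ^+ 2)) = fun m =>
    past T t * (3 * (`|(A_ m - A) (dw n t)| * `|(A_ m - A) (dw n t)|) +
      3 * (`|(B_ m - B) (w n t)| * `|(B_ m - B) (w n t)|)).
  by apply/funext => m; exact: E.
exact: lim0.
Qed.

Lemma mollify_comparison n T (e : R) : Tf <= T -> 0 < e ->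
  \forall m \near \oo, forall t, t <= T ->
    Clow * `|mollify (k n) (u_ m) t - mollify (k n) u t| ^+ 2 <= e.
Proof.
move=> TfT e0.
pose K := expR (energy_rate Clow CB CQ * (T - Tf)).
have K0 : 0 < K by exact: expR_gt0.
(* The coefficient part and the memory part of the source each receive [a], and
   [K * (a + a) = e]. *)
pose a := e / K / 2.
have a0 : 0 < a by rewrite !divr_gt0.
have [idef cdef] := defect_integral_cvg n T.
have wL2 : in_L2plus (w n).
  apply: past_sqr_in_L2plus.
    apply: continuous_strongly_measurable.
    exact: (mollify_continuous (mollifier_kernel (km n)) u_past).
  move=> T'; exact: (mollify_sqr_past u_past u_vanishes n T' (fun n => mollifier_kernel (km n))).
have near1 : \forall m \near \oo, \int[mu]_t (past T t * defect n m t) <= a.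
  by move: cdef => /cvgr_le; apply.
(* An L^2 norm below [Num.sqrt (a / 3)] leaves [a] after squaring and multiplying by the constant 3;
   pulling out that constant is an inequality valid without measurability. *)
have near2 : \forall m \near \oo, (\int[mu]_t (past T t *
    (3 * `|convolution (Q_ m) (w n) t - convolution Q (w n) t| ^+ 2))%:E <= a%:E)%E.
  have b0 : 0 < a / 3 by rewrite divr_gt0.
  have nb : nbhs 0%E [set x : \bar R | (x < (Num.sqrt (a / 3))%:E)%E].
    apply: open_nbhs_nbhs; split; first exact: open_ereal_lt_ereal.
    by rewrite /= lte_fin sqrtr_gt0.
  have near_lt : \forall m \near \oo, (LpNorm 2%:E `]-oo, T]
    (convolution (Q_ m) (w n) - convolution Q (w n))%R < (Num.sqrt (a / 3))%:E)%E.
    exact: (R_cvg T wL2 nb).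
  apply: filterS near_lt => m ltm.
  have E (p x : R) : (p * (3 * x))%:E = (3%:E * (p * x)%:E)%E.
    by rewrite -EFinM mulrCA.
  under eq_integral do rewrite E.
  have r0 t : (0 <= (past T t *
      `|convolution (Q_ m) (w n) t - convolution Q (w n) t| ^+ 2)%:E)%E.
    by rewrite lee_fin mulr_ge0 ?sqr_ge0.
  have c3 : 0 < 3 :> R by [].
  have scal := @ge0_integralZl_lower _ _ _ mu 3 (fun t => (past T t *
    `|convolution (Q_ m) (w n) t - convolution Q (w n) t| ^+ 2)%:E) c3 r0.
  apply: (le_trans scal).
  have -> : (a%:E = 3%:E * (a / 3)%:E)%E by rewrite -EFinM mulrC divfK.
  rewrite lee_pmul2l// ?lte_fin//.
  rewrite -(sqr_sqrtr (ltW b0)) -powR_mulrn// -poweR_EFin.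
  rewrite (_ : (\int[mu]_t _)%E = (LpNorm 2%:E `]-oo, T]
    (convolution (Q_ m) (w n) - convolution Q (w n))%R `^ 2)%E); last first.
    rewrite LpNorm2_sqr; apply: eq_integral => t _; congr (_ * _)%:E.
    rewrite indicE /past; congr (nat_of_bool _)%:R.
    by apply/idP/idP => [tT|]; [apply/mem_set|rewrite inE]; rewrite /= in_itv.
  apply: gt0_ler_poweR => //; rewrite ?in_itv/= ?leey ?andbT ?Lnorm_ge0//.
  exact: ltW.
apply: filterS2 near1 near2 => m d_le r_le t tT.
have pm := mollify_past_integrable (km n) (um_past m).
have pu := mollify_past_integrable (km n) u_past.
(* The mollified limit solution is read as a solution of the [m]-th equation; its source then
   differs from the mollified [f] only by the coefficient errors. *)
have sol_u s := solves_at_perturb (A_ m) (B_ m) (Q_ m) (mollify_solves coef u_past u_weak n s).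
have sol s := solves_atB (coef_m m) pm pu
  (mollify_solves (coef_m m) (um_past m) (um_weak m) n s) (sol_u s).
have g_le s : s <= T -> `|mollify (k n) f s - (mollify (k n) f s +
    ((A_ m - A) (dw n s) + (B_ m - B) (w n s) +
      (convolution (Q_ m) (w n) s - convolution Q (w n) s)))| ^+ 2 <=
    defect n m s + 3 * `|convolution (Q_ m) (w n) s - convolution Q (w n) s| ^+ 2.
  have E (x y : H) : x - (x + y) = - y by rewrite opprD addrA subrr sub0r.
  by move=> _; rewrite E normrN; exact: norm_add3_sqr_le.
have e0' s : 0 <= 3 * `|convolution (Q_ m) (w n) s - convolution Q (w n) s| ^+ 2.
  by rewrite mulr_ge0 ?sqr_ge0.
have dm (s : R) := is_deriveB (mollify_is_derive (um_past m) n s) (mollify_is_derive u_past n s).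
have cdw : continuous (fun s => mollify (dk n) (u_ m) s - mollify (dk n) u s).
  by move=> s; apply: cvgB; exact: mollify_dcontinuous.
have v0 s : s <= Tf -> mollify (k n) (u_ m) s - mollify (k n) u s = 0.
  move=> sT.
  rewrite (mollify_solution_vanishes (coef_m m) (um_past m) (um_vanishes m)
    (um_weak m) n sT).
  by rewrite (mollify_solution_vanishes coef u_past u_vanishes u_weak n sT) subrr.
have := @energy_estimate _ _ _ iota P Clow Cup CB CQ _ _ _ (coef_m m) P_skew Clow_gt0
  _ _ _ _ _ Tf T a t dm cdw (past_integrableB pm pu) v0 sol g_le
  (defect_ge0 n m) e0' (idef m) r_le TfT tT.
move=> /le_trans; apply; rewrite -/K.
rewrite (@le_trans _ _ (K * (a + a)))//.
  by rewrite ler_wpM2l ?(ltW K0)// lerD2r.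
by rewrite /a -splitr mulrC divfK ?gt_eqF.
Qed.

End Comparison.

End Stability.

(** * From uniform bounds almost everywhere to convergence of the essential supremum *)

Lemma LpNorm_oo_cvg0 (R : realType) (W : normedModType R) (D : set R)
    (g : nat -> R -> W) :
  (forall e : R, 0 < e -> \forall m \near \oo,
    {ae @lebesgue_measure R, forall t, D t -> `|g m t| <= e}) ->
  LpNorm +oo%E D (g m) @[m --> \oo] --> 0%E.
Proof.
move=> small.
have le_e (e : R) : 0 < e -> \forall m \near \oo, (LpNorm +oo D (g m) <= e%:E)%E.
  move=> e0; apply: filterS (small _ e0) => m h; apply/LpNorm_oo_leP.
  apply: (ae_imply h) => t; rewrite patchE => ht.
  case: ifP => [/set_mem /ht|_]; first by rewrite /= normr_id lee_fin.
  by rewrite abse0 lee_fin ltW.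
apply/fine_cvgP; split.
  apply: filterS (le_e 1 ltr01) => m h.
  by rewrite ge0_fin_numE ?Lnorm_ge0// (le_lt_trans h)// ltry.
apply/cvgrPdist_le => e e0; apply: filterS (le_e e e0) => m h /=.
rewrite sub0r normrN ger0_norm ?fine_ge0 ?Lnorm_ge0//.
by rewrite -[leRHS]/(fine e%:E) fine_le// ge0_fin_numE ?Lnorm_ge0// (le_lt_trans h)// ltry.
Qed.

Theorem theorem7 (R : realType) (H V : hilbertType R)
  (iota P : {linear V -> H})
  (H_separable : separable H) (V_separable : separable V)
  (V_dense : dense_inclusion iota)
  (P_skew_adjoint : skew_adjoint iota P)
  (P_graph_norm : graph_norm_equiv iota P)
  (Clow Cup CB CQ : R)
  (Clow_gt0 : 0 < Clow) (Clow_le_Cup : Clow <= Cup)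
  (CB_ge0 : 0 <= CB) (CQ_ge0 : 0 <= CQ)
  (A_ B_ : nat -> 'B(H)) (Q_ : nat -> R -> 'B(H))
  (A B : 'B(H)) (Q : R -> 'B(H))
  (coef_m : forall m, coef_class Clow Cup CB CQ (A_ m) (B_ m) (Q_ m))
  (coef : coef_class Clow Cup CB CQ A B Q)
  (A_cvg : forall w : H, `|(A_ m - A) w| @[m --> \oo] --> (0 : R))
  (B_cvg : forall w : H, `|(B_ m - B) w| @[m --> \oo] --> (0 : R))
  (R_cvg : forall (T : R) (w : R -> H), in_L2plus w ->
    LpNorm 2%:E `]-oo, T] (convolution (Q_ m) w - convolution Q w) @[m --> \oo] --> 0%E)
  (f : R -> H) (f_L2loc : in_L2loc f) (f_causal : causal f)
  (u_ : nat -> R -> H) (u : R -> H)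
  (u_m_causal : forall m, causal (u_ m))
  (u_m_solution : forall m, weak_solution iota P (A_ m) (B_ m) (Q_ m) f (u_ m))
  (u_causal : causal u)
  (u_solution : weak_solution iota P A B Q f u)
  (T0 T : R) (T0_le_T : T0 <= T) :
  LpNorm +oo%E `[T0, T] (u_ m - u) @[m --> \oo] --> 0%E.
Proof.
have L2loc_past_integrable (g : R -> H) Tg : in_L2loc g ->
    {ae @lebesgue_measure R, forall t, t < Tg -> g t = 0} -> past_integrable g.
  by move=> gL g0; split; [exact: in_L2loc_measurable|exact: (in_L2loc_past gL g0)].
have [Tf f0] := causal_vanishes f_causal.
have [Tu u0] := causal_vanishes u_causal.
have /choice[Tu_ um0] m := causal_vanishes (u_m_causal m).
have f_past := L2loc_past_integrable _ _ f_L2loc f0.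
have u_past := L2loc_past_integrable _ _ u_solution.1.1 u0.
have um_past m := L2loc_past_integrable _ _ (u_m_solution m).1.1 (um0 m).
have f_past2 := in_L2loc_past_sqr f_L2loc f0.
have [C exk] := @mollifier_exists R.
have /choice[k /choice[dk /choice[M kP]]] := exk.
have km n := (kP n).1; have kC n := (kP n).2.
apply: LpNorm_oo_cvg0 => e e0.
(* The estimates start at [Tf] and need a final time beyond it. In [d], each of the three distances,
   from [u_ m] to its mollification, between the mollifications, and from there to [u], is allotted
   [e / 3]. *)
pose T' := Num.max T Tf; pose d := Clow * (e / 3) ^+ 2.
have TfT' : Tf <= T' by rewrite le_max lexx orbT.
have d0 : 0 < d by rewrite mulr_gt0// exprn_gt0// divr_gt0.
(* [n] is chosen from [f] before [m] appears, and the one inequality serves [u] and every [u_ m]. *)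
have [n n_le] : exists n, expR (energy_rate Clow CB CQ * (T' - Tf)) *
    (2 * source_error k f T' n) <= d.
  have : expR (energy_rate Clow CB CQ * (T' - Tf)) * (2 * source_error k f T' j)
      @[j --> \oo] --> expR (energy_rate Clow CB CQ * (T' - Tf)) * (2 * 0).
    by apply: cvgMr; apply: cvgMr; exact: (mollify_L2_cvg km kC f_past f_past2 T' H_separable).
  rewrite mulr0 mulr0 => /cvgr_le/(_ _ d0)[n _ hn]; exists n; exact: (hn n (leqnn n)).
have du := mollify_solution_dist P_skew_adjoint Clow_gt0 km kC f_past f_past2 f0
  coef u_past u0 u_solution n H_separable TfT'.
have dum m := mollify_solution_dist P_skew_adjoint Clow_gt0 km kC f_past f_past2 f0
  (coef_m m) (um_past m) (um0 m) (u_m_solution m) n H_separable TfT'.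
have := mollify_comparison P_skew_adjoint Clow_gt0 km f_past f0 coef_m coef
  A_cvg B_cvg R_cvg um_past u_past um0 u0 u_m_solution u_solution n TfT' d0.
apply: filterS => m hm.
apply: (ae_imply (ae_and du (dum m))) => t [h1 h2] /=; rewrite in_itv/= => /andP[_ tT].
have tT' : t <= T' by rewrite (le_trans tT)// le_max lexx.
have le_third (x : H) : Clow * `|x| ^+ 2 <= d -> `|x| <= e / 3.
  by rewrite ler_pM2l// ler_pXn2r// nnegrE ?divr_ge0// ltW.
move: (le_third _ (le_trans (h1 tT') n_le)) (le_third _ (le_trans (h2 tT') n_le))
  (le_third _ (hm t tT')).
rewrite [(u_ m - u) t](_ : _ = u_ m t - u t)//.
move: (mollify (k n) (u_ m) t) (mollify (k n) u t) (u_ m t) (u t) => w1 w2 x y.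
move=> hy hx hw.
have -> : x - y = (x - w1) + (w1 - w2) + (w2 - y) by rewrite !addrA !subrK.
rewrite (le_trans (ler_normD _ _))// (_ : e = e / 3 + e / 3 + e / 3); last by field.
rewrite lerD// ?(distrC w2)//.
by rewrite (le_trans (ler_normD _ _))// lerD.
Qed.
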